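(* Consider the MFG-2 model $$\mathcal V(q,t)=\inf_{q(\cdot),\alpha(\cdot)}\left(\mathcal G(q_T)+\int_t^T\left[\int\tfrac12|\alpha_s|^2q_s(x)\,dx+\mathcal F(q_s)\right]ds\right),$$ subject to $\partial_sq_s+\nabla\cdot[(\mathcal Tq_s+\alpha_s)q_s]=D\Delta q_s$ for $t\le s\le T$ and $q_t=q$. Assume that it achieves an optimal solution $(q_s,\varphi_s)_{t\le s\le T}$ (with optimal control $\alpha_s=\nabla\varphi_s$), which solves the MFG-2 system $$\partial_sq_s+\nabla\cdot[(\mathcal Tq_s+\nabla\varphi_s)q_s]=D\Delta q_s,\qquad q_t=q,$$ $$\partial_s\varphi_s+\tfrac12|\nabla\varphi_s|^2+\nabla\varphi_s\cdot\mathcal Tq_s+\mathcal T^*\cdot(\nabla\varphi_s\,q_s)+D\Delta\varphi_s=F(x,q_s),\qquad\varphi_T(x)=-G(x,q_T).$$ Then the optimal value function $\mathcal V(q,t)$ is the solution to the functional Hamilton-Jacobi equation $$\partial_t\mathcal V(q,t)-\mathcal H_2\left(q,-\frac{\delta\mathcal V}{\delta q}\right)=0,\quad\forall\,t\le T;\qquad\mathcal V(q,T)=\mathcal G(q),$$ where $$\mathcal H_2(q,\varphi)=\int\left[\left(\tfrac12|\nabla\varphi|^2+\nabla\varphi\cdot\mathcal Tq\right)q(x)-D\nabla\varphi\cdot\nabla q\right]dx-\mathcal F(q);$$ that is, for $t\le T$, $$\begin{aligned}\partial_t\mathcal V(q,t)&-\frac12\int\left|\nabla\frac{\delta\mathcal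 V}{\delta q}(q,x,t)\right|^2q(x)\,dx+\int\left(\nabla\frac{\delta\mathcal V}{\delta q}(q,x,t)\cdot\mathcal Tq(x)\right)q(x)\,dx\\&-D\int\nabla\frac{\delta\mathcal V}{\delta q}(q,x,t)\cdot\nabla q(x)\,dx+\mathcal F(q)=0.\end{aligned}$$ In addition, the control solution $\varphi_s$, which solves $\partial_s\varphi_s=-\frac{\delta\mathcal H_2}{\delta q}(q_s,\varphi_s)$, satisfies $\varphi_s(x)=-\frac{\delta\mathcal V}{\delta q}(q_s,x,s)$.
   Context: The spatial domain is the torus $\mathbb T^d$ (with $d\le2$), all spatial integrals are over it, $D$ is the diffusion coefficient and $T$ is the terminal time. $\mathcal T$ is an (invertible) linear operator sending a scalar vorticity field $q$ to the velocity field $u=\mathcal Tq$, which is incompressible: $\nabla\cdot\mathcal Tq=0$. $\mathcal T^*\cdot$ denotes its adjoint, mapping vector fields to scalar fields: $\int v\cdot\mathcal Tq\,dx=\int(\mathcal T^*\cdot v)\,q\,dx$. $\mathcal F,\mathcal G$ are functionals of a scalar field with $F(x,q)=\frac{\delta\mathcal F}{\delta q}(q,x)$ and $G(x,q)=\frac{\delta\mathcal G}{\delta q}(q,x)$, where $\frac{\delta}{\delta q}$ is the first variation (functional derivative, a function of $x$); $\frac{\delta\mathcal V}{\delta q}(q,x,t)$ is the first variation of $\mathcal V(\cdot,t)$ at $q$, evaluated at $x$. No function spaces are specified; equations and functional derivatives are understood in the classical sense.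
   Formalization: Added hypothesis: the value function V has, for all states q and t ≤ T, a time derivative and a first variation δV/δq that is smooth in x with gradient continuous in (t,x); without this the claim fails when optimal solutions are non-unique. *)

(* Defs.v *)
From HB Require Import structures.
From mathcomp Require Import all_boot all_order all_algebra.
From mathcomp Require Import all_classical all_reals all_analysis.

Set Implicit Arguments.
Unset Strict Implicit.
Unset Printing Implicit Defensive.

Import Order.TTheory GRing.Theory Num.Theory.
Import numFieldNormedType.Exports.

Local Open Scope classical_set_scope.
Local Open Scope ring_scope.

(* The torus is R^d / Z^d: a field on it is a 1-periodic function on R^d
   (periodicity is part of [smooth] and of [first_variation]). *)
Definition field (R : realType) (d : nat) := 'rV[R]_d -> R.

(* vector fields, given by their components *)
Definition vfield (R : realType) (d : nat) := 'I_d -> field R d.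

Definition basis_vec (R : realType) (d : nat) (i : 'I_d) : 'rV[R]_d :=
  delta_mx 0 i.

Definition periodic (R : realType) (d : nat) (f : field R d) : Prop :=
  forall i x, f (x + basis_vec R i) = f x.

Definition pd (R : realType) (d : nat) (i : 'I_d) (f : field R d) : field R d :=
  fun x => 'D_(basis_vec R i) f x.

(* Iterated partial derivative along a list of directions. *)
Definition pds (R : realType) (d : nat) (l : seq 'I_d) (f : field R d) :
    field R d :=
  foldr (@pd R d) f l.

(* C^oo functions on the torus.  ['D_v f x] has a junk value where the limit
   does not exist, whence the explicit derivability. *)
Definition smooth (R : realType) (d : nat) (f : field R d) : Prop :=
  periodic f /\
  forall l : seq 'I_d,
    continuous (pds l f) /\
    forall i x, derivable (pds l f) x (basis_vec R i).

Definition vsmooth (R : realType) (d : nat) (v : vfield R d) : Prop :=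
  forall i, smooth (v i).

Definition grad (R : realType) (d : nat) (f : field R d) : vfield R d :=
  fun i => pd i f.

Definition dot (R : realType) (d : nat) (v w : vfield R d) : field R d :=
  fun x => \sum_(i < d) v i x * w i x.

Definition diverg (R : realType) (d : nat) (v : vfield R d) : field R d :=
  fun x => \sum_(i < d) pd i (v i) x.

Definition lapl (R : realType) (d : nat) (f : field R d) : field R d :=
  diverg (grad f).

(* Integral over the unit cell [0,1]^d of R^d, as an iterated integral. *)
Fixpoint tint (R : realType) (d : nat) : field R d -> R :=
  match d with
  | 0 => fun f => f 0
  | n.+1 => fun f =>
      \int[lebesgue_measure]_(a in `[0, 1])
        tint (fun y : 'rV[R]_n => f (row_mx (a%:M : 'rV[R]_1) y))
  end.

(* [C_k_close k e p q]: p and q are e-close in the C^k norm. *)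
Definition C_k_close (R : realType) (d : nat) (k : nat) (e : R)
    (p q : field R d) : Prop :=
  forall l : seq 'I_d, (size l <= k)%N ->
    forall x, `|pds l (fun y => p y - q y) x| <= e.

(* The function space of the states q: any set of C^oo fields which is open
   for the C^oo topology, so that first variations at its points make sense. *)
Definition state_space (R : realType) (d : nat) (Q : set (field R d)) : Prop :=
  (forall q, Q q -> smooth q) /\
  (forall q, Q q -> exists (k : nat) (e : R), 0 < e /\
     forall p, smooth p -> C_k_close k e p q -> Q p).

(* A linear operator q |-> u with incompressible values, continuous from the
   C^oo topology to the uniform one; only its values on smooth fields matter. *)
Definition velocity_operator (R : realType) (d : nat)
    (T : field R d -> vfield R d) : Prop :=
  [/\ forall q, smooth q -> vsmooth (T q),
      forall (a : R) p q, smooth p -> smooth q ->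
        forall i x, T (fun y => a * p y + q y) i x = a * T p i x + T q i x,
      forall q, smooth q -> forall x, diverg (T q) x = 0
    & exists (k : nat) (C : R), forall q (c : R), smooth q ->
        C_k_close k c q (fun=> 0) -> forall i x, `|T q i x| <= C * c].

Definition adjoint_operator (R : realType) (d : nat)
    (T : field R d -> vfield R d) (Tadj : vfield R d -> field R d) : Prop :=
  forall v, vsmooth v ->
    smooth (Tadj v) /\
    forall q, smooth q ->
      tint (dot v (T q)) = tint (fun x => Tadj v x * q x).

(* g is the first variation of Phi at q *)
Definition first_variation (R : realType) (d : nat) (Phi : field R d -> R)
    (q g : field R d) : Prop :=
  [/\ periodic g, continuous g
    & forall h, smooth h ->
        is_derive (0 : R) (1 : R) (fun e : R => Phi (fun x => q x + e * h x))
          (tint (fun x => g x * h x))].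

(* Phi has a first variation dPhi at every state, which is continuous in the
   state, from the C^oo topology to the uniform one. *)
Definition C1_functional (R : realType) (d : nat) (Q : set (field R d))
    (Phi : field R d -> R) (dPhi : field R d -> field R d) : Prop :=
  (forall q, Q q -> first_variation Phi q (dPhi q)) /\
  (forall q, Q q -> forall e : R, 0 < e ->
     exists (k : nat) (r : R), 0 < r /\
       forall p, Q p -> C_k_close k r p q ->
         forall x, `|dPhi p x - dPhi q x| <= e).

(* f has derivative l at s within A: one-sided at an end point of an interval
   A, the usual derivative in its interior. *)
Definition is_tderive (R : realType) (A : set R) (f : R -> R) (s l : R) : Prop :=
  (fun r => (f r - f s) / (r - s)) @ within A s^' --> l.

(* s |-> q_s is continuous from [a, b] to the space of C^oo fields. *)
Definition smooth_path (R : realType) (d : nat) (a b : R)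
    (q : R -> field R d) : Prop :=
  (forall s, a <= s <= b -> smooth (q s)) /\
  (forall l : seq 'I_d,
    {within [set z : R * 'rV[R]_d | a <= z.1 <= b],
      continuous (fun z : R * 'rV[R]_d => pds l (q z.1) z.2)}).

(* dq is the time derivative of q on [a, b] and is jointly continuous. *)
Definition time_C1 (R : realType) (d : nat) (a b : R)
    (q dq : R -> field R d) : Prop :=
  (forall s, a <= s <= b ->
     forall x, is_tderive [set r | a <= r <= b] (fun r => q r x) s (dq s x)) /\
  {within [set z : R * 'rV[R]_d | a <= z.1 <= b],
    continuous (fun z : R * 'rV[R]_d => dq z.1 z.2)}.

(* right-hand side D lap q - div((T q + al) q) of the vorticity equation *)
Definition transport (R : realType) (d : nat) (T : field R d -> vfield R d)
    (D : R) (q : field R d) (al : vfield R d) : field R d :=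
  fun x => D * lapl q x - diverg (fun i y => (T q i y + al i y) * q y) x.

(* The pairs (q, al) over which the infimum is taken.  Controls are piecewise
   continuous in time: E is the finite set of times at which al may be
   discontinuous and q may fail to be differentiable. *)
Definition admissible (R : realType) (d : nat) (Q : set (field R d))
    (T : field R d -> vfield R d) (D tf : R) (q0 : field R d) (t : R)
    (q : R -> field R d) (al : R -> vfield R d) : Prop :=
  [/\ q t = q0,
      smooth_path t tf q,
      forall s, t <= s <= tf -> Q (q s),
      forall s, t <= s <= tf -> vsmooth (al s)
    & exists E : seq R,
        (forall i, {within [set z : R * 'rV[R]_d | t <= z.1 <= tf /\ z.1 \notin E],
           continuous (fun z : R * 'rV[R]_d => al z.1 i z.2)}) /\
        (forall s, t <= s <= tf -> s \notin E -> forall x,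
           is_tderive [set r | t <= r <= tf] (fun r => q r x) s
             (transport T D (q s) (al s) x))].

Definition cost (R : realType) (d : nat) (F G : field R d -> R) (tf t : R)
    (q : R -> field R d) (al : R -> vfield R d) : \bar R :=
  ((G (q tf))%:E +
   \int[lebesgue_measure]_(s in `[t, tf])
     (tint (fun x => 2^-1 * dot (al s) (al s) x * q s x)%R + F (q s))%:E)%E.

Definition value (R : realType) (d : nat) (Q : set (field R d))
    (T : field R d -> vfield R d) (D : R) (F G : field R d -> R) (tf : R)
    (q0 : field R d) (t : R) : \bar R :=
  ereal_inf [set c | exists (q : R -> field R d) (al : R -> vfield R d),
    admissible Q T D tf q0 t q al /\ c = cost F G tf t q al].

(* the MFG-2 system on [t, tf], with first variations dF and dG *)
Definition mfg2_system (R : realType) (d : nat)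
    (T : field R d -> vfield R d) (Tadj : vfield R d -> field R d) (D : R)
    (dF dG : field R d -> field R d) (tf : R) (q0 : field R d) (t : R)
    (q phi : R -> field R d) : Prop :=
  [/\ smooth_path t tf q,
      smooth_path t tf phi,
      q t = q0,
      forall x, phi tf x = - dG (q tf) x
    & exists dq dphi : R -> field R d,
        [/\ time_C1 t tf q dq,
            time_C1 t tf phi dphi,
            forall s, t <= s <= tf -> forall x,
              dq s x
              + diverg (fun i y => (T (q s) i y + grad (phi s) i y) * q s y) x
              = D * lapl (q s) x
          & forall s, t <= s <= tf -> forall x,
              dphi s x + 2^-1 * dot (grad (phi s)) (grad (phi s)) x
              + dot (grad (phi s)) (T (q s)) x
              + Tadj (fun i y => grad (phi s) i y * q s y) x
              + D * lapl (phi s) x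
              = dF (q s) x]].

Definition optimal_solution (R : realType) (d : nat) (Q : set (field R d))
    (T : field R d -> vfield R d) (Tadj : vfield R d -> field R d) (D : R)
    (F G : field R d -> R) (dF dG : field R d -> field R d)
    (tf : R) (q0 : field R d) (t : R) (q phi : R -> field R d) : Prop :=
  [/\ admissible Q T D tf q0 t q (fun s => grad (phi s)),
      cost F G tf t q (fun s => grad (phi s)) = value Q T D F G tf q0 t
    & mfg2_system T Tadj D dF dG tf q0 t q phi].

Definition H2 (R : realType) (d : nat) (T : field R d -> vfield R d) (D : R)
    (F : field R d -> R) (q phi : field R d) : R :=
  tint (fun x => (2^-1 * dot (grad phi) (grad phi) x
                  + dot (grad phi) (T q) x) * q x
                 - D * dot (grad phi) (grad q) x) - F q.

(* V is classically differentiable for times t <= tf: dtV is its time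
   derivative (a left derivative at tf), dV its first variation, smooth in x
   and with a gradient in x that is jointly continuous in (t, x). *)
Definition classically_differentiable (R : realType) (d : nat)
    (Q : set (field R d)) (tf : R) (V dtV : field R d -> R -> R)
    (dV : field R d -> R -> field R d) : Prop :=
  forall q, Q q ->
    [/\ forall t, t <= tf ->
          is_tderive [set r | r <= tf] (V q) t (dtV q t),
        forall t, t <= tf -> first_variation (V ^~ t) q (dV q t),
        forall t, t <= tf -> smooth (dV q t)
      & forall i, {within [set z : R * 'rV[R]_d | z.1 <= tf],
          continuous (fun z : R * 'rV[R]_d => grad (dV q z.1) i z.2)}].

(* Main.v *)
(** Write v = T q + al for the velocity. As v is arbitrary, the state equation
    dq = D lapl q - div (v q) is linear in q, and wherever q does not vanish every path
    whose time derivative is the divergence of a known flux is admissible: v is the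
    flux divided by q. So competitors are written down explicitly and no PDE is solved.

    - States are positive. Where q < 0 the kinetic energy is negative, and a fast
      ramp supported there would lower the cost without bound compared with the
      first-order change of the value, which is differentiable in q.
    - phi = - dV. The line q_s + e h through the optimal path is admissible for small
      e, and V (q_t + e h) t is at most its cost, with equality at e = 0. So both have
      the same derivative at 0, which the equation of phi and an integration by parts
      in space and time turn into - \int phi_t h.
    - Hamilton-Jacobi equation. Running through the optimal path at another speed on
      [t, t + eta] bounds V q (t + tau) from above, with equality at tau = 0; this gives
      eta * dtV q t as the integral of H2 (q_s, phi_s) over [t, t + eta], and
      eta tends to 0. *)

(* Hence every comparison varies one argument of [V] only: the lines [q_s + e h] all start at time
   [t], and the path run at another speed starts at time [t + tau] from the very state [q t]. Each
   comparison is a mere inequality; it determines a derivative because [e] and [tau] take both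
   signs.

   Dividing a flux by the state requires states without zeros. The ramp only excludes negative
   values; vanishing is then excluded because [Q] is open, as lowering such a state by a small
   constant would give a negative one. The ramp itself starts from a state that may change sign, so
   its flux must be supported where the state is bounded away from zero. This is the reason for the
   cut-offs built from [exp (- 1 / z)]. *)
Require Import Defs.
From HB Require Import structures.
From mathcomp Require Import all_boot all_order all_algebra.
From mathcomp Require Import all_classical all_reals all_analysis.
From mathcomp Require Import measurable_realfun ring lra.

Set Implicit Arguments.
Unset Strict Implicit.
Unset Printing Implicit Defensive.

Import Order.TTheory GRing.Theory Num.Theory.
Import numFieldNormedType.Exports.

Local Open Scope classical_set_scope.
Local Open Scope ring_scope.

(** * Continuity *)

Section continuity.
Context {R : realType}.
Implicit Types (U V W : topologicalType).

Lemma cont_comp U V W (f : U -> V) (g : V -> W) :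
  continuous f -> continuous g -> continuous (fun u => g (f u)).
Proof. by move=> cf cg u; exact: (cvg_comp _ _ (cf u) (cg (f u))). Qed.

Lemma cont_id U : continuous (fun u : U => u).
Proof. by move=> u; exact: cvg_id. Qed.

Lemma cont_cst U V (c : V) : continuous (fun _ : U => c).
Proof. by move=> u; exact: cvg_cst. Qed.

Lemma cont_pair U V W (f : U -> V) (g : U -> W) :
  continuous f -> continuous g -> continuous (fun u => (f u, g u)).
Proof. by move=> cf cg u; apply: cvg_pair; [exact: cf|exact: cg]. Qed.

Lemma cont_fst U V : continuous (fun z : U * V => z.1).
Proof. by move=> u; exact: cvg_fst. Qed.

Lemma cont_snd U V : continuous (fun z : U * V => z.2).
Proof. by move=> u; exact: cvg_snd. Qed.

Lemma contD U (f g : U -> R) :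
  continuous f -> continuous g -> continuous (fun u => f u + g u).
Proof. by move=> cf cg u; apply: cvgD; [exact: cf|exact: cg]. Qed.

Lemma contN U (f : U -> R) : continuous f -> continuous (fun u => - f u).
Proof. by move=> cf u; apply: cvgN; exact: cf. Qed.

Lemma contB U (f g : U -> R) :
  continuous f -> continuous g -> continuous (fun u => f u - g u).
Proof. by move=> cf cg u; apply: cvgB; [exact: cf|exact: cg]. Qed.

Lemma contM U (f g : U -> R) :
  continuous f -> continuous g -> continuous (fun u => f u * g u).
Proof. by move=> cf cg u; apply: cvgM; [exact: cf|exact: cg]. Qed.

Lemma contV U (f : U -> R) :
  (forall u, f u != 0) -> continuous f -> continuous (fun u => (f u)^-1).
Proof. by move=> f0 cf u; apply: cvgV => //; exact: cf. Qed.

Lemma cont_sum U (I : finType) (f : I -> U -> R) :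
  (forall i, continuous (f i)) -> continuous (fun u => \sum_i f i u).
Proof.
move=> cf.
have H (s : seq I) : continuous (fun u => \sum_(i <- s) f i u).
  elim: s => [|i s IH].
    rewrite (_ : (fun u => _) = (fun=> 0)); first exact: cont_cst.
    by apply/funext => u; rewrite big_nil.
  rewrite (_ : (fun u => _) = (fun u => f i u + \sum_(j <- s) f j u)).
    exact: contD.
  by apply/funext => u; rewrite big_cons.
exact: H.
Qed.

Lemma cont_slice U V W (f : U * V -> W) (u : U) :
  continuous f -> continuous (fun v => f (u, v)).
Proof.
move=> cf; apply: (cont_comp (f := fun v => (u, v)) (g := f)) => //.
by apply: cont_pair; [exact: cont_cst|exact: cont_id].
Qed.

Lemma cont_swap U V W (f : U * V -> W) :
  continuous f -> continuous (fun p : V * U => f (p.2, p.1)).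
Proof.
move=> cf; apply: (cont_comp (f := fun p : V * U => (p.2, p.1)) (g := f)) => //.
by apply: cont_pair; [exact: cont_snd|exact: cont_fst].
Qed.

(** Compactness in its near-covering form leaves a local claim around each point [s] of [K]; there
    both values are compared with [f (u, s)]. *)
Lemma compact_uniform_near U V (K : set V) (f : U * V -> R) (u : U) (e : R) :
  compact K -> continuous f -> 0 < e ->
  \forall v \near u, forall x, K x -> `|f (v, x) - f (u, x)| <= e.
Proof.
move=> /compact_near_coveringP cK cf e0.
apply: (cK U (nbhs u) (fun v x => `|f (v, x) - f (u, x)| <= e)) => s _.
have e20 : 0 < e / 2 by rewrite divr_gt0.
have H1 : \forall p \near (s, u), `|f (u, s) - f (p.2, p.1)| < e / 2.
  have c2 : continuous (fun p : V * U => f (p.2, p.1)) by exact: cont_swap.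
  by have /cvgrPdist_lt /(_ _ e20) := c2 (s, u).
have H2 : \forall p \near (s, u), `|f (u, s) - f (u, p.1)| < e / 2.
  have c2 : continuous (fun p : V * U => f (u, p.1)).
    apply: (cont_comp (f := fun p : V * U => p.1) (g := fun s => f (u, s))).
      exact: cont_fst.
    exact: cont_slice.
  by have /cvgrPdist_lt /(_ _ e20) := c2 (s, u).
near=> p.
have h1 : `|f (u, s) - f (p.2, p.1)| < e / 2 by near: p; exact: H1.
have h2 : `|f (u, s) - f (u, p.1)| < e / 2 by near: p; exact: H2.
rewrite distrC in h1.
have := ltrD h1 h2; rewrite -splitr.
move=> h3; rewrite /= ltW// (le_lt_trans _ h3)//.
by rewrite (le_trans _ (ler_normD _ _))// addrA subrK.
Unshelve. all: by end_near. Qed.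

Lemma cont_mx U m n (f : U -> 'M[R]_(m, n)) :
  (forall i j, continuous (fun u => f u i j)) -> continuous f.
Proof.
move=> cf u A [P Pf PA].
apply: (@filterS _ _ _ (fun v => forall ij, P ij.1 ij.2 (f v ij.1 ij.2))).
  by move=> v Pv; apply: PA => i j; exact: (Pv (i, j)).
by apply: filter_forall => -[i j]; exact: (cf i j u _ (Pf i j)).
Qed.

Lemma cont_coord m n (i : 'I_m) (j : 'I_n) : continuous (fun x : 'M[R]_(m, n) => x i j).
Proof. exact: coord_continuous. Qed.

End continuity.

(** * Derivatives and integrals on an interval *)

(** Multiplied out, the condition has no quotient and may also be used at [r = s]. *)
Lemma is_tderiveP (R : realType) (A : set R) (f : R -> R) (s l : R) :
  is_tderive A f s l <->
  (forall e, 0 < e -> exists2 dl, 0 < dl & forall r, A r -> `|r - s| < dl ->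
     `|f r - f s - l * (r - s)| <= e * `|r - s|).
Proof.
split=> [H e e0|H].
  move/cvgrPdist_le: H => /(_ e e0) [dl /= dl0 H].
  exists dl => // r Ar rs.
  have [->|rs0] := eqVneq r s; first by rewrite !subrr mulr0 subr0 normr0 mulr0.
  have := H r; rewrite /= distrC => /(_ rs rs0 Ar).
  have rs1 : r - s != 0 by rewrite subr_eq0.
  move=> He.
  rewrite (_ : f r - f s - l * (r - s) = - ((l - (f r - f s) / (r - s)) * (r - s))).
    by rewrite normrN normrM ler_wpM2r.
  by field.
apply/cvgrPdist_le => e e0; have [dl dl0 Hd] := H e e0.
exists dl => //= r /=; rewrite distrC => rs rs0 Ar.
have rs1 : r - s != 0 by rewrite subr_eq0.
rewrite -(ler_pM2r (_ : 0 < `|r - s|)) ?normr_gt0//.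
rewrite -normrM -normrN.
rewrite (_ : - ((l - _) * _) = f r - f s - l * (r - s)); last by field.
exact: Hd.
Qed.

Lemma is_tderive_continuous (R : realType) (A : set R) (f : R -> R) (s l : R) :
  is_tderive A f s l -> f @ within A (nbhs s) --> f s.
Proof.
move=> /is_tderiveP /(_ 1 ltr01) [dl dl0 H].
apply/cvgrPdist_le => e e0.
have k0 : 0 < e / (1 + `|l|) by rewrite divr_gt0// ltr_wpDr.
rewrite near_withinE; near=> r => Ar.
have rs : `|r - s| < dl by rewrite distrC; near: r; exact: (nbhsx_ballx s dl dl0).
have := H r Ar rs; rewrite mul1r => H1.
have H2 : `|r - s| <= e / (1 + `|l|).
  by rewrite ltW// distrC; near: r; exact: (nbhsx_ballx s _ k0).
rewrite distrC (_ : f r - f s = (f r - f s - l * (r - s)) + l * (r - s)); last by ring.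
rewrite (le_trans (ler_normD _ _))// normrM.
rewrite (le_trans (lerD H1 (lexx _)))//.
rewrite -[X in X + _]mul1r -mulrDl mulrC -ler_pdivlMr//; by rewrite ltr_wpDr.
Unshelve. all: by end_near. Qed.

Lemma is_tderive_is_derive (R : realType) (A : set R) (f : R -> R) (s l : R) :
  nbhs s A -> is_tderive A f s l -> is_derive s 1 f l.
Proof.
move=> sA H.
suff : (fun h => h^-1 *: (f (h + s) - f s)) @ 0^' --> l.
  move=> H1; apply: DeriveDef.
    by apply/cvg_ex; exists l => /=; under eq_fun do rewrite [_ *: 1]mulr1.
  by rewrite /derive; under eq_fun do rewrite [_ *: 1]mulr1; apply/cvg_lim.
move/is_tderiveP: H => H; apply/cvgrPdist_le => e e0.
have [dl dl0 Hd] := H e e0.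
have [dA /= dA0 HA] := sA.
near=> h.
have h0 : h != 0 by near: h; exact: nbhs_dnbhs_neq.
have hd : `|h| < dl by near: h; exact: dnbhs0_lt.
have hA : `|h| < dA by near: h; exact: dnbhs0_lt.
have := Hd (h + s); rewrite addrK => /(_ _ hd).
have Ah : A (h + s) by apply: HA; rewrite /ball_/= opprD addrCA subrr addr0 normrN.
move=> /(_ Ah) H1.
rewrite -(ler_pM2r (_ : 0 < `|h|)) ?normr_gt0// -normrM -normrN.
rewrite (_ : - ((l - _) * _) = f (h + s) - f s - l * h)//.
by rewrite /GRing.scale/=; field.
Unshelve. all: by end_near. Qed.

Lemma is_derive_is_tderive (R : realType) (A : set R) (f : R -> R) (s l : R) :
  is_derive s 1 f l -> is_tderive A f s l.
Proof.
move=> [df <-]; apply/is_tderiveP => e e0.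
have : (fun h => h^-1 *: (f (h + s) - f s)) @ 0^' --> 'D_1 f s.
  have := df; rewrite /derivable/derive.
  under eq_fun do rewrite [_ *: 1]mulr1.
  by move=> /[dup] H; apply.
move/cvgrPdist_le => /(_ e e0) [dl /= dl0 H].
exists dl => // r Ar rs.
have [->|rs0] := eqVneq r s; first by rewrite !subrr mulr0 subr0 normr0 mulr0.
have rs1 : r - s != 0 by rewrite subr_eq0.
have := H (r - s); rewrite /= sub0r normrN => /(_ rs rs1).
rewrite subrK => He.
set D := 'D_1 f s in He *.
rewrite (_ : f r - f s - D * (r - s) = - ((D - (r - s)^-1 *: (f r - f s)) * (r - s))).
  by rewrite normrN normrM ler_wpM2r.
by rewrite /GRing.scale/=; field.
Qed.

Lemma is_tderive_subset (R : realType) (A B : set R) (f : R -> R) (s l : R) :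
  A `<=` B -> is_tderive B f s l -> is_tderive A f s l.
Proof.
move=> AB /is_tderiveP H; apply/is_tderiveP => e /H [dl dl0 Hd].
by exists dl => // r /AB; exact: Hd.
Qed.

(** Locality: near [s] the set [A] may be replaced by [B] and the function by another one. Glued
    paths inherit the derivatives of their pieces in this way. *)
Lemma is_tderive_near_eq (R : realType) (A B : set R) (f g : R -> R) (s l dl : R) :
  0 < dl -> A s ->
  (forall r, A r -> `|r - s| < dl -> B r /\ f r = g r) ->
  is_tderive B f s l -> is_tderive A g s l.
Proof.
move=> dl0 As AB /is_tderiveP H; apply/is_tderiveP => e /H [d2 d20 Hd].
exists (Num.min dl d2); first by rewrite lt_min dl0.
move=> r Ar; rewrite lt_min => /andP[r1 r2].
have [Br <-] := AB r Ar r1.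
have [|_ <-] := AB s As; first by rewrite subrr normr0.
exact: Hd.
Qed.

Lemma is_tderive_eq (R : realType) (A : set R) (f g : R -> R) (s l : R) :
  A s -> (forall r, A r -> f r = g r) ->
  is_tderive A f s l -> is_tderive A g s l.
Proof.
move=> As fg; apply: (is_tderive_near_eq (dl := 1)) => // r Ar _.
by split=> //; exact: fg.
Qed.

Lemma is_tderiveD (R : realType) (A : set R) (f g : R -> R) (s l m : R) :
  is_tderive A f s l -> is_tderive A g s m ->
  is_tderive A (fun r => f r + g r) s (l + m).
Proof.
rewrite /is_tderive => H1 H2.
rewrite (_ : (fun r => _) = (fun r => (f r - f s) / (r - s) + (g r - g s) / (r - s))).
  exact: cvgD.
by apply/funext => r; ring.
Qed.

Lemma is_tderiveZ (R : realType) (A : set R) (f : R -> R) (c s l : R) :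
  is_tderive A f s l -> is_tderive A (fun r => c * f r) s (c * l).
Proof.
rewrite /is_tderive => H1.
rewrite (_ : (fun r => _) = (fun r => c * ((f r - f s) / (r - s)))).
  exact: cvgMr.
by apply/funext => r; ring.
Qed.

Lemma is_tderive_cst (R : realType) (A : set R) (c s : R) :
  is_tderive A (fun=> c) s 0.
Proof.
apply/is_tderiveP => e e0; exists 1 => // r _ _.
by rewrite !(subrr, mul0r, normr0) mulr_ge0// ltW.
Qed.

Lemma is_tderive_affine (R : realType) (A : set R) (c d s : R) :
  is_tderive A (fun r => c * r + d) s c.
Proof.
apply/is_tderiveP => e e0; exists 1 => // r _ _.
rewrite (_ : _ - _ = 0); last by ring.
by rewrite normr0 mulr_ge0// ltW.
Qed.

Lemma is_tderive_comp_affine (R : realType) (A B : set R) (f : R -> R) (c d s l : R) :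
  (forall r, A r -> B (c * r + d)) ->
  is_tderive B f (c * s + d) l -> is_tderive A (fun r => f (c * r + d)) s (c * l).
Proof.
move=> AB /is_tderiveP H; apply/is_tderiveP => e e0.
(* The summand 1 spares a separate case for [c = 0]. *)
have k0 : 0 < 1 + `|c| by rewrite ltr_wpDr.
have [dl dl0 Hd] := H (e / (1 + `|c|)) (divr_gt0 e0 k0).
exists (dl / (1 + `|c|)); first exact: divr_gt0.
move=> r Ar; rewrite ltr_pdivlMr// => rs.
have E : c * r + d - (c * s + d) = c * (r - s) by ring.
have := Hd _ (AB _ Ar); rewrite E => H1.
rewrite (_ : c * l * _ = l * (c * (r - s))); last by ring.
have cr : `|c * (r - s)| <= `|r - s| * (1 + `|c|).
  by rewrite normrM mulrC ler_wpM2l// lerDr.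
apply: le_trans (H1 _) _; first exact: le_lt_trans rs.
rewrite -mulrA ler_wpM2l ?(ltW e0)//.
by rewrite mulrC ler_pdivrMr.
Qed.

Lemma within_segment_continuous (R : realType) (a b : R) (f : R -> R) :
  (forall s, a <= s <= b -> f @ within [set r | a <= r <= b] (nbhs s) --> f s) ->
  {within `[a, b], continuous f}.
Proof.
move=> H; rewrite (_ : `[a, b]%classic = [set r | a <= r <= b]).
  by apply/subspace_continuousP => s; exact: H.
by apply/seteqP; split=> r /=; rewrite in_itv.
Qed.

Lemma nbhs_segment (R : realType) (a b s : R) : a < s < b ->
  nbhs s [set r | a <= r <= b].
Proof.
move=> /andP[as_ sb].
have : nbhs s `]a, b[%classic.
  by apply: open_nbhs_nbhs; split; [exact: interval_open|rewrite /= in_itv/= as_].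
by apply: filterS => r /=; rewrite in_itv/= => /andP[/ltW -> /ltW ->].
Qed.

Lemma is_tderive_MVT (R : realType) (a b : R) (f df : R -> R) (s r : R) :
  (forall s, a <= s <= b -> is_tderive [set r | a <= r <= b] f s (df s)) ->
  a <= s -> s < r -> r <= b ->
  exists2 x, s < x < r & f r - f s = df x * (r - s).
Proof.
move=> H as_ sr rb.
have [||x] := @MVT R f df s r sr.
- move=> x; rewrite in_itv/= => /andP[sx xr].
  apply: (is_tderive_is_derive (A := [set r | a <= r <= b])).
    by apply: nbhs_segment; rewrite (le_lt_trans as_ sx)/= (lt_le_trans xr).
  by apply: H; rewrite (le_trans as_ (ltW sx))/= (le_trans (ltW xr)).
- apply: within_segment_continuous => x /andP[sx xr].
  apply: (is_tderive_continuous (l := df x)).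
  apply: (is_tderive_subset (B := [set r | a <= r <= b])).
    by move=> y /= /andP[sy yr]; rewrite (le_trans as_ sy) (le_trans yr).
  by apply: H; rewrite (le_trans as_ sx)/= (le_trans xr).
- by rewrite in_itv/= => xsr E; exists x.
Qed.

Section interval_integral.
Context {R : realType}.
Implicit Types (a b c : R) (f g : R -> R).

Definition Int a b f : R := \int[lebesgue_measure]_(s in `[a, b]) f s.

Lemma continuous_integrable a b f : continuous f ->
  lebesgue_measure.-integrable `[a, b] (EFin \o f).
Proof.
move=> cf; apply: continuous_compact_integrable; first exact: segment_compact.
exact: continuous_subspaceT.
Qed.

Lemma EFin_Int a b f : continuous f ->
  (\int[lebesgue_measure]_(s in `[a, b]) (f s)%:E)%E = (Int a b f)%:E.
Proof.
move=> cf; rewrite fineK//; apply: integrable_fin_num => //.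
exact: continuous_integrable.
Qed.

Lemma eq_Int a b f g : (forall s, a <= s <= b -> f s = g s) -> Int a b f = Int a b g.
Proof. by move=> fg; apply: eq_Rintegral => s; rewrite inE/= in_itv/= => /fg. Qed.

Lemma IntD a b f g : continuous f -> continuous g ->
  Int a b (fun s => f s + g s) = Int a b f + Int a b g.
Proof. by move=> cf cg; rewrite /Int RintegralD//; exact: continuous_integrable. Qed.

Lemma IntB a b f g : continuous f -> continuous g ->
  Int a b (fun s => f s - g s) = Int a b f - Int a b g.
Proof. by move=> cf cg; rewrite /Int RintegralB//; exact: continuous_integrable. Qed.

Lemma IntZ a b c f : continuous f -> Int a b (fun s => c * f s) = c * Int a b f.
Proof. by move=> cf; rewrite /Int RintegralZl//; exact: continuous_integrable. Qed.

Lemma Int_cst a b c : a <= b -> Int a b (fun=> c) = c * (b - a).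
Proof.
move=> ab; rewrite /Int Rintegral_cst//= lebesgue_measure_itv/= lte_fin.
by case: ltgtP ab => // -> _; rewrite subrr.
Qed.

Lemma ler_Int a b f g : continuous f -> continuous g ->
  (forall s, a <= s <= b -> f s <= g s) -> Int a b f <= Int a b g.
Proof.
move=> cf cg fg; apply: le_Rintegral => //; exact: continuous_integrable.
Qed.

Lemma Int_norm_le a b f c : a <= b -> continuous f ->
  (forall s, a <= s <= b -> `|f s| <= c) -> `|Int a b f| <= c * (b - a).
Proof.
move=> ab cf fc; rewrite ler_norml -mulNr -!Int_cst//.
by apply/andP; split; apply: ler_Int => //; try exact: cont_cst;
  move=> s /fc; rewrite ler_norml => /andP[].
Qed.

Lemma Int_nn a f : Int a a f = 0.
Proof. by rewrite /Int set_itv1 Rintegral_set1. Qed.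

Lemma Int_cat a b c f : continuous f -> a <= b -> b <= c ->
  Int a c f = Int a b f + Int b c f.
Proof.
move=> cf ab bc.
have := @Rintegral_itvB R f (BLeft a) (BRight c) b (continuous_integrable _ _ cf).
rewrite !bnd_simp => /(_ ab bc) H; rewrite /Int -[LHS](subrK (Int a b f)) H addrC.
congr (_ + _); apply: Rintegral_itv_obnd_cbnd.
apply: integrableS (continuous_integrable b c cf) => //.
exact: subset_itv_oc_cc.
Qed.

Lemma Int_gt0 a b f x : a < b -> continuous f ->
  (forall s, a <= s <= b -> 0 <= f s) -> a <= x <= b -> 0 < f x -> 0 < Int a b f.
Proof.
move=> ab cf f0 /andP[ax xb] fx.
have fx2 : 0 < f x / 2 by rewrite divr_gt0.
have /cvgrPdist_lt /(_ _ fx2) := cf x.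
move=> [dl /= dl0 Hd].
pose m := Num.min dl (b - a).
have m0 : 0 < m by rewrite lt_min dl0 subr_gt0.
have [u [v [au uv vb Huv]]] : exists u v, [/\ a <= u, u < v, v <= b &
    forall s, u <= s <= v -> `|x - s| < dl].
  (* The interval of length [m / 2] is placed on the side of [x] where [[a, b]] extends by at least
     half its length, so it fits even if [x] is an end point. *)
  have [xm|xm] := leP x ((a + b) / 2).
    exists x, (x + m / 2); split=> //.
    - by rewrite ltrDl divr_gt0.
    - rewrite (le_trans (y := x + (b - a) / 2))//; last by lra.
      by rewrite lerD2l ler_pM2r// ge_min lexx orbT.
    - move=> s /andP[xs sx]; rewrite ler0_norm ?subr_le0// opprB ltrBlDl.
      rewrite (le_lt_trans sx)// ltrD2l (lt_le_trans (y := m))//; first by lra.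
      by rewrite ge_min lexx.
  exists (x - m / 2), x; split=> //.
  - rewrite (le_trans (y := x - (b - a) / 2))//; first by lra.
    by rewrite lerD2l lerN2 ler_pM2r// ge_min lexx orbT.
  - by rewrite ltrBlDr ltrDl divr_gt0.
  - move=> s /andP[xs sx]; rewrite ger0_norm ?subr_ge0// ltrBlDl -ltrBlDr.
    rewrite (lt_le_trans _ xs)// ltrD2l ltrN2 (lt_le_trans (y := m))//; first by lra.
    by rewrite ge_min lexx.
rewrite (Int_cat cf au (le_trans (ltW uv) vb)) (Int_cat cf (ltW uv) vb).
have I0 p q : a <= p -> q <= b -> 0 <= Int p q f.
  move=> ap qb; apply: Rintegral_ge0 => s /=; rewrite in_itv/= => /andP[ps sq].
  by apply: f0; rewrite (le_trans ap ps) (le_trans sq qb).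
apply: ltr_wpDl; first by apply: I0 => //; lra.
apply: ltr_wpDr; first by apply: I0 => //; lra.
apply: (@lt_le_trans _ _ (f x / 2 * (v - u))).
  by rewrite !mulr_gt0// subr_gt0.
rewrite -Int_cst ?(ltW uv)//; apply: ler_Int => //; first exact: cont_cst.
move=> s /Huv /Hd; rewrite ltr_norml => /andP[_]; lra.
Qed.

Lemma Int_param_continuous (U : topologicalType) (f : U * R -> R) a b :
  a <= b -> continuous f -> continuous (fun u => Int a b (fun s => f (u, s))).
Proof.
move=> ab cf u; apply/cvgrPdist_le => e e0.
(* The summand 1 keeps the denominator positive when [a = b]. *)
have k0 : 0 < e / (b - a + 1) by rewrite divr_gt0// ltr_wpDl// subr_ge0.
have := compact_uniform_near u (@segment_compact R a b) cf k0.
apply: filterS => v Hv; rewrite -IntB; try exact: cont_slice.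
apply: (le_trans (Int_norm_le (c := e / (b - a + 1)) ab _ _)).
- by apply: contB; exact: cont_slice.
- by move=> s sab; rewrite distrC; apply: Hv; rewrite /= in_itv.
- by rewrite -mulrA ger_pMr// mulrC ler_pdivrMr ?ltr_wpDl// ?subr_ge0// mul1r lerDl.
Qed.

(** The one-sided derivatives at the end points only serve to give continuity of [F] there; the
    fundamental theorem uses derivatives in the interior. *)
Lemma Int_is_tderive a b f F : a <= b -> continuous f ->
  (forall s, a <= s <= b -> is_tderive [set r | a <= r <= b] F s (f s)) ->
  Int a b f = F b - F a.
Proof.
rewrite le_eqVlt => /predU1P[-> _ _|ab cf H]; first by rewrite Int_nn subrr.
have dF s : a < s < b -> is_derive s 1 F (f s).
  move=> sab; apply: is_tderive_is_derive (nbhs_segment sab) _; apply: H.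
  by case/andP: sab => /ltW -> /ltW ->.
have cF : {within `[a, b], continuous F}.
  by apply: within_segment_continuous => s /H /is_tderive_continuous.
apply: EFin_inj; rewrite -EFin_Int//.
rewrite (@continuous_FTC2 R f F) ?EFinB//.
- exact: continuous_subspaceT.
- move/(continuous_within_itvP _ ab): cF => [_ Fa Fb]; split=> //.
  by move=> s; rewrite in_itv/= => /dF [].
- by move=> s; rewrite in_itv/= => /dF ds; rewrite derive1E derive_val.
Qed.

Lemma Int_derive a b f s : continuous f -> a <= s <= b ->
  is_tderive [set r | a <= r <= b] (fun x => Int a x f) s (f s).
Proof.
move=> cf /andP[as_ sb]; apply/is_tderiveP => e e0.
have /cvgrPdist_le /(_ _ e0) [dl /= dl0 Hd] := cf s.
exists dl => // r /andP[ar rb] rs.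
have cB : continuous (fun x => f x - f s) by apply: contB => //; exact: cont_cst.
have K x y : x <= y -> (forall z, x <= z <= y -> `|s - z| < dl) ->
    `|Int x y f - f s * (y - x)| <= e * (y - x).
  move=> xy H; rewrite -(Int_cst _ xy) -IntB//; last exact: cont_cst.
  by apply: Int_norm_le => // z /H /Hd; rewrite distrC.
have [sr|rs'] := leP s r.
  rewrite (Int_cat cf as_ sr) [Int a s f + _]addrC addrK [`|r - s|]ger0_norm ?subr_ge0//.
  apply: K => // z /andP[sz zr]; rewrite (le_lt_trans _ rs)// distrC.
  by rewrite !ger0_norm ?subr_ge0//; lra.
rewrite (Int_cat cf ar (ltW rs')) [`|r - s|]ltr0_norm ?subr_lt0// opprB.
rewrite (_ : _ - _ = - (Int r s f - f s * (s - r))); last by ring.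
rewrite normrN; apply: K; first exact: ltW.
move=> z /andP[rz zs]; rewrite (le_lt_trans _ rs)// [`|r - s|]ltr0_norm ?subr_lt0//.
by rewrite ger0_norm ?subr_ge0//; lra.
Qed.

(** Change of variables through the fundamental theorem: [c * f (c * s + e)] is the derivative of
    the right-hand integral with upper bound [c * s + e]. *)
Lemma Int_affine a b c e f : 0 < c -> a <= b -> continuous f ->
  c * Int a b (fun s => f (c * s + e)) = Int (c * a + e) (c * b + e) f.
Proof.
move=> c0 ab cf.
have cg : continuous (fun s => f (c * s + e)).
  apply: (cont_comp (f := fun s => c * s + e)) => //.
  by apply: contD; [apply: contM; [exact: cont_cst|exact: cont_id]|exact: cont_cst].
rewrite -IntZ//.
rewrite (@Int_is_tderive a b _ (fun s => Int (c * a + e) (c * s + e) f))//.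
- by rewrite Int_nn subr0.
- by apply: contM => //; exact: cont_cst.
move=> s /andP[as_ sb].
apply: (is_tderive_comp_affine (B := [set r | c * a + e <= r <= c * b + e])
  (f := fun x => Int (c * a + e) x f)).
  by move=> r /= /andP[ar rb]; rewrite !lerD2r !ler_pM2l// ar.
by apply: Int_derive => //; rewrite !lerD2r !ler_pM2l// as_.
Qed.

End interval_integral.

(** * Integration on the torus *)

Section torus_integral.
Context {R : realType}.

Definition cube n : set 'rV[R]_n := [set x | forall i, 0 <= x 0 i <= 1].

Lemma cube_compact n : compact (@cube n).
Proof.
rewrite (_ : @cube n = [set v : 'rV[R]_n | forall i, `[0, 1]%classic (v ord0 i)]).
  exact: (@rV_compact R n (fun=> `[0, 1]%classic) (fun=> @segment_compact R 0 1)).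
by apply/seteqP; split=> x /= H i; move: (H i); rewrite /= in_itv.
Qed.

(** The term that occurs in [tint], so that [tintS] holds by conversion. *)
Definition rcons0 n (a : R) (y : 'rV[R]_n) : 'rV[R]_n.+1 :=
  row_mx (a%:M : 'rV[R]_1) y.

Lemma rcons0_0 n (a : R) (y : 'rV[R]_n) : rcons0 a y 0 0 = a.
Proof.
rewrite /rcons0 mxE; case: splitP => [j _|//].
by rewrite !ord1 mxE eqxx mulr1n.
Qed.

Lemma rcons0_lift n (a : R) (y : 'rV[R]_n) i : rcons0 a y 0 (lift 0 i) = y 0 i.
Proof.
rewrite /rcons0 mxE; case: splitP => [j|j /= [E]]; first by rewrite ord1.
by congr (y 0 _); exact: val_inj.
Qed.

Lemma rcons0_cube n a (y : 'rV[R]_n) : 0 <= a <= 1 -> cube y -> cube (rcons0 a y).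
Proof.
move=> a01 cy i; case: (unliftP 0 i) => [j|] ->; first by rewrite rcons0_lift.
by rewrite rcons0_0.
Qed.

Lemma rcons0_surj n (x : 'rV[R]_n.+1) :
  x = rcons0 (x 0 0) (\row_i x 0 (lift 0 i)).
Proof.
apply/rowP => i; case: (unliftP 0 i) => [j|] ->; last by rewrite rcons0_0.
by rewrite rcons0_lift mxE.
Qed.

Lemma cont_rcons0 n : continuous (fun z : R * 'rV[R]_n => rcons0 z.1 z.2).
Proof.
apply: cont_mx => i j; rewrite ord1.
case: (unliftP 0 j) => [k|] ->.
  under eq_fun do rewrite rcons0_lift.
  apply: (cont_comp (f := fun z : R * 'rV[R]_n => z.2) (g := fun x : 'rV[R]_n => x 0 k)).
    exact: cont_snd.
  exact: cont_coord.
under eq_fun do rewrite rcons0_0.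
exact: cont_fst.
Qed.

Lemma cont_rcons0r n (a : R) : continuous (@rcons0 n a).
Proof.
apply: (cont_comp (f := fun y : 'rV[R]_n => (a, y))
  (g := fun z : R * 'rV[R]_n => rcons0 z.1 z.2)); last exact: cont_rcons0.
by apply: cont_pair; [exact: cont_cst|exact: cont_id].
Qed.

Lemma tintS n (f : field R n.+1) :
  tint f = Int 0 1 (fun a => tint (fun y => f (rcons0 a y))).
Proof. by []. Qed.

(** The parameter space is arbitrary because the induction needs it: the coordinate split off from
    the cube becomes a further parameter. *)
Lemma tint_param_continuous n (U : topologicalType) (f : U * 'rV[R]_n -> R) :
  continuous f -> continuous (fun u => tint (fun x => f (u, x))).
Proof.
elim: n U f => [|n IH] U f cf /=.
  apply: (cont_comp (f := fun u => (u, 0 : 'rV[R]_0)) (g := f)) => //.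
  by apply: cont_pair; [exact: cont_id|exact: cont_cst].
apply: (Int_param_continuous
  (f := fun z => tint (fun y => f (z.1, rcons0 z.2 y)))) => //.
apply: (IH _ (fun w : (U * R) * 'rV[R]_n => f (w.1.1, rcons0 w.1.2 w.2))).
apply: (cont_comp (f := fun w : (U * R) * 'rV[R]_n => (w.1.1, rcons0 w.1.2 w.2)) (g := f)) => //.
have c1 : continuous (fun w : (U * R) * 'rV[R]_n => w.1) by exact: cont_fst.
apply: cont_pair.
  apply: (cont_comp (f := fun w : (U * R) * 'rV[R]_n => w.1) (g := fun z : U * R => z.1)) => //.
  exact: cont_fst.
apply: (cont_comp (f := fun w : (U * R) * 'rV[R]_n => (w.1.2, w.2))
   (g := fun z : R * 'rV[R]_n => rcons0 z.1 z.2)); last exact: cont_rcons0.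
apply: cont_pair; last exact: cont_snd.
apply: (cont_comp (f := fun w : (U * R) * 'rV[R]_n => w.1) (g := fun z : U * R => z.2)) => //.
exact: cont_snd.
Qed.

Lemma cont_tint_rcons0 n (f : field R n.+1) :
  continuous f -> continuous (fun a => tint (fun y => f (rcons0 a y))).
Proof.
move=> cf; apply: (tint_param_continuous (f := fun z => f (rcons0 z.1 z.2))).
by apply: (cont_comp _ cf); exact: cont_rcons0.
Qed.

Lemma cont_rcons0_comp n (f : field R n.+1) a :
  continuous f -> continuous (fun y => f (rcons0 a y)).
Proof. by move=> cf; apply: (cont_comp _ cf); exact: cont_rcons0r. Qed.

Lemma tintD n (f g : field R n) : continuous f -> continuous g ->
  tint (fun x => f x + g x) = tint f + tint g.
Proof.
elim: n f g => [//|n IH] f g cf cg; rewrite !tintS -IntD; try exact: cont_tint_rcons0.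
by apply: eq_Int => a _; apply: IH; exact: cont_rcons0_comp.
Qed.

Lemma tintZ n c (f : field R n) : continuous f ->
  tint (fun x => c * f x) = c * tint f.
Proof.
elim: n f => [//|n IH] f cf; rewrite !tintS -IntZ; last exact: cont_tint_rcons0.
by apply: eq_Int => a _; apply: IH; exact: cont_rcons0_comp.
Qed.

Lemma tintN n (f : field R n) : continuous f -> tint (fun x => - f x) = - tint f.
Proof.
move=> cf; rewrite -mulN1r -tintZ//; congr tint; apply/funext => x.
by rewrite mulN1r.
Qed.

Lemma tintB n (f g : field R n) : continuous f -> continuous g ->
  tint (fun x => f x - g x) = tint f - tint g.
Proof. by move=> cf cg; rewrite tintD ?tintN//; exact: contN. Qed.

Lemma tint_cst n (c : R) : tint (fun _ : 'rV[R]_n => c) = c.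
Proof.
elim: n => [//|n IH]; rewrite tintS; under eq_Int do rewrite IH.
by rewrite Int_cst ?ler01// subr0 mulr1.
Qed.

Lemma ler_tint n (f g : field R n) : continuous f -> continuous g ->
  (forall x, cube x -> f x <= g x) -> tint f <= tint g.
Proof.
elim: n f g => [|n IH] f g cf cg fg; first by apply: fg => -[].
rewrite !tintS; apply: ler_Int; try exact: cont_tint_rcons0.
move=> a a01; apply: IH; try exact: cont_rcons0_comp.
by move=> y cy; apply: fg; exact: rcons0_cube.
Qed.

Lemma tint_norm_le n c (f : field R n) : continuous f ->
  (forall x, cube x -> `|f x| <= c) -> `|tint f| <= c.
Proof.
move=> cf fc; rewrite ler_norml -[- c](tint_cst n) -[c in X in _ && X](tint_cst n).
by apply/andP; split; apply: ler_tint => //; try exact: cont_cst;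
  move=> x /fc; rewrite ler_norml => /andP[].
Qed.

Lemma tint_gt0 n (f : field R n) x : continuous f ->
  (forall y, cube y -> 0 <= f y) -> cube x -> 0 < f x -> 0 < tint f.
Proof.
elim: n f x => [|n IH] f x cf f0 cx fx.
  by rewrite /= (_ : 0 = x)//; apply/rowP => -[].
rewrite tintS; apply: (Int_gt0 (x := x 0 0)) => //.
- exact: cont_tint_rcons0.
- move=> a a01; rewrite -[leLHS](tint_cst n); apply: ler_tint.
  + exact: cont_cst.
  + exact: cont_rcons0_comp.
  + by move=> y cy; apply: f0; exact: rcons0_cube.
- apply: (IH _ (\row_i x 0 (lift 0 i))).
  + exact: cont_rcons0_comp.
  + by move=> y cy; apply: f0; exact: rcons0_cube.
  + by move=> i; rewrite mxE.
  + by rewrite -rcons0_surj.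
Qed.

(** Differentiation under the integral. For each [x] the increment is [df] at an intermediate time
    multiplied by [r - s], and compactness of the cube makes this [df] close to the one at [s],
    uniformly in [x]. *)
Lemma tint_is_tderive n a b (f df : R * 'rV[R]_n -> R) : a <= b ->
  continuous f -> continuous df ->
  (forall s, a <= s <= b -> forall x, cube x ->
     is_tderive [set r | a <= r <= b] (fun r => f (r, x)) s (df (s, x))) ->
  forall s, a <= s <= b ->
     is_tderive [set r | a <= r <= b] (fun r => tint (fun x => f (r, x))) s
       (tint (fun x => df (s, x))).
Proof.
move=> ab cf cdf H s sab; apply/is_tderiveP => e e0.
have [dl /= dl0 Hd] := compact_uniform_near s (@cube_compact n) cdf e0.
exists dl => // r rab rs.
have cfs u : continuous (fun x => f (u, x)) by exact: cont_slice.
have cdfs u : continuous (fun x => df (u, x)) by exact: cont_slice.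
rewrite -tintB// mulrC -tintZ// -tintB//; last first.
- by apply: contM => //; exact: cont_cst.
- exact: contB.
apply: tint_norm_le.
  by apply: contB; [exact: contB|apply: contM => //; exact: cont_cst].
move=> x cx.
have Hx u : a <= u <= b -> is_tderive [set r | a <= r <= b] (fun r => f (r, x)) u (df (u, x)).
  by move=> uab; exact: H.
have K u : `|u - s| <= `|r - s| -> `|df (u, x) - df (s, x)| <= e.
  by move=> us; apply: Hd => //=; rewrite distrC (le_lt_trans us).
have [rs'|sr|->] := ltgtP r s; last by rewrite !subrr mul0r subr0 normr0 mulr0.
- have [||y /andP[ry ys] E] := is_tderive_MVT (f := fun r => f (r, x)) (df := fun r => df (r, x)) Hx _ rs'.
  + by case/andP: rab.
  + by case/andP: sab.
  rewrite (_ : f (r, x) - f (s, x) = - (f (s, x) - f (r, x))); last by ring.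
  rewrite [X in - X]E mulrC (_ : _ - _ = (df (y, x) - df (s, x)) * (r - s)); last by ring.
  rewrite normrM ler_wpM2r// K// !ltr0_norm ?subr_lt0//; lra.
- have [||y /andP[ry ys] E] := is_tderive_MVT (f := fun r => f (r, x)) (df := fun r => df (r, x)) Hx _ sr.
  + by case/andP: sab.
  + by case/andP: rab.
  rewrite [X in X - _]E (_ : _ - _ = (df (y, x) - df (s, x)) * (r - s)); last by ring.
  rewrite normrM ler_wpM2r// K// !gtr0_norm ?subr_gt0//; lra.
Qed.

End torus_integral.

(** * Smooth fields *)

Section flat_function.
Context {R : realType}.

Lemma is_derive_line (V : normedModType R) (f : V -> R) (x v : V) (l : R) :
  is_derive x v f l <-> is_derive (0 : R) (1 : R) (fun h : R => f (h *: v + x)) l.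
Proof.
have E : (fun h : R => h^-1 *: ((f \o shift x) (h *: v) - f x)) =
  (fun h => h^-1 *: (((fun h : R => f (h *: v + x)) \o shift 0) (h *: 1) - f (0 *: v + x))).
  by apply/funext => h /=; rewrite [h *: 1]mulr1 addr0 scale0r add0r.
by split=> -[d e]; apply: DeriveDef; move: d e; rewrite /derivable /derive E.
Qed.

(** Since [f] is only derivable in the direction [v], the chain rule is applied to its restriction
    to a line. *)
Lemma is_derive_comp (V : normedModType R) (h : R -> R) (f : V -> R) (x v : V) (l m : R) :
  is_derive x v f l -> is_derive (f x) 1 h m -> is_derive x v (fun y => h (f y)) (m * l).
Proof.
move=> /is_derive_line d1 dh; apply/is_derive_line.
have dh' : is_derive ((fun t : R => f (t *: v + x)) 0) 1 h m.
  by rewrite /= scale0r add0r.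
set g := fun t : R => f (t *: v + x) in d1 dh' *.
have df1 : derivable g 0 1 by case: d1.
have df2 : derivable h (g 0) 1 by case: dh'.
apply: DeriveDef.
  apply/derivable1_diffP; apply: differentiable_comp.
    by move/derivable1_diffP : df1.
  by move/derivable1_diffP : df2.
rewrite -derive1E (derive1_comp df1 df2) !derive1E.
by rewrite [X in X * _]derive_val derive_val.
Qed.

(** The classical flat function [exp (- 1 / z)] together with its products by negative powers of
    [z]. Derivatives of members of this family are linear combinations of members, which reduces
    smoothness to an induction. *)
Definition flat n (z : R) : R := if 0 < z then z ^- n * expR (- z^-1) else 0.

Lemma flat0 n z : z <= 0 -> flat n z = 0.
Proof. by rewrite /flat ltNge => ->. Qed.

Lemma flat_gt0 n z : 0 < z -> 0 < flat n z.
Proof. by move=> z0; rewrite /flat z0 mulr_gt0 ?expR_gt0// invr_gt0 exprn_gt0. Qed.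

(** One term of the exponential series suffices: [exp (1 / z)] dominates
    [z ^ - (n + 1) / (n + 1)!]. *)
Lemma flat_le n z : `|flat n z| <= (n.+1)`!%:R * `|z|.
Proof.
have [z0|z0] := leP z 0; first by rewrite flat0// normr0 mulr_ge0.
rewrite !gtr0_norm ?flat_gt0// /flat z0.
have zi : 0 < z^-1 by rewrite invr_gt0.
have := @expR_ge1Dxn R z^-1 n (ltW zi).
rewrite expRN => H.
have H1 : z^-1 ^+ n.+1 / (n.+1)`!%:R <= expR z^-1 by rewrite (le_trans _ H)// lerDr.
have c0 : 0 < z^-1 ^+ n.+1 / (n.+1)`!%:R :> R.
  by rewrite divr_gt0 ?exprn_gt0// ltr0n fact_gt0.
have H2 : (expR z^-1)^-1 <= (n.+1)`!%:R * z ^+ n.+1.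
  rewrite (le_trans (y := (z^-1 ^+ n.+1 / (n.+1)`!%:R)^-1)) ?lef_pV2 ?posrE ?expR_gt0//.
  by rewrite invfM invrK exprVn invrK mulrC.
rewrite (le_trans (ler_wpM2l _ H2)) ?invr_ge0 ?exprn_ge0 ?(ltW z0)//.
rewrite mulrCA exprSr mulKf// expf_neq0// gt_eqF//.
Qed.

Lemma is_derive_flat n (z : R) :
  is_derive z 1 (flat n) (flat n.+2 z - n%:R * flat n.+1 z).
Proof.
have T0 (w : R) : nbhs w [set: R] by have /= := @filterT _ _ (nbhs_filter w).
have [z0|z0|->] := ltgtP z 0.
- apply: (is_tderive_is_derive (T0 z)); rewrite !flat0 ?(ltW z0)// mulr0 subr0.
  apply: (@is_tderive_near_eq R setT setT (cst 0) _ _ _ (- z)) => //.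
  + by rewrite oppr_gt0.
  + move=> r _; rewrite ltr_norml => /andP[_ rz]; split=> //.
    by rewrite flat0//; lra.
  + exact: is_tderive_cst.
- apply: (is_tderive_is_derive (T0 z)).
  apply: (@is_tderive_near_eq R setT setT (fun w => (w^-1) ^+ n * expR (- w^-1)) _ _ _ z) => //.
  + move=> r _; rewrite ltr_norml => /andP[rz _]; split=> //.
    have r0 : 0 < r by lra.
    by rewrite /flat r0 exprVn.
  apply: is_derive_is_tderive.
  have zn0 : z != 0 by rewrite gt_eqF.
  have iv : is_derive z 1 (fun w : R => w^-1) (- z ^- 2).
    apply: DeriveDef; first exact: derivableV.
    by rewrite deriveV// derive_id [_ *: 1]mulr1.
  have e1 : is_derive z 1 (fun w : R => expR (- w^-1)) (expR (- z^-1) * - (- z ^- 2)).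
    exact: (is_derive_comp (f := - (fun w : R => w^-1)) (is_deriveN iv) (is_derive_expR _)).
  rewrite (_ : (fun w => _) = (fun w : R => w^-1) ^+ n * (fun w : R => expR (- w^-1))).
    2: by apply/funext => w; rewrite !fctE.
  have D := is_deriveM (is_deriveX n iv) e1.
  apply: (is_derive_eq D) => {D}.
  rewrite /flat z0 -!exprVn !fctE /GRing.scale /= !opprK.
  set u := z^-1; set E := expR _; case: n {iv e1}=> [|n] /=; first by ring.
  by rewrite !exprS expr0; ring.
- apply: (is_tderive_is_derive (T0 0)); rewrite !flat0// mulr0 subr0.
  apply/is_tderiveP => e e0; exists (e / (n.+2)`!%:R).
    by rewrite divr_gt0// ltr0n fact_gt0.
  move=> r _; rewrite mul0r (flat0 n (lexx 0)) !subr0.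
  rewrite ltr_pdivlMr ?ltr0n ?fact_gt0// => re.
  have [r0|r0] := leP r 0; first by rewrite flat0// normr0 mulr_ge0// ltW.
  (* Splitting off one power of [r] before applying [flat_le] makes [flat n r] quadratic in [r],
     whence the derivative 0 at the origin. *)
  have -> : flat n r = flat n.+1 r * r.
    by rewrite /flat r0 exprSr invfM mulrAC divfK ?gt_eqF.
  rewrite normrM ler_wpM2r// (le_trans (flat_le _ _))//.
  by rewrite mulrC ltW.
Qed.

Lemma flat_continuous n : continuous (flat n).
Proof.
move=> z; apply: differentiable_continuous; apply/derivable1_diffP.
by have [] := is_derive_flat n z.
Qed.

End flat_function.

(** * Smooth fields as a class of expressions closed under differentiation *)

Section smooth_fields.
Context {R : realType} {d : nat}.
Implicit Types (f g h : field R d) (i : 'I_d) (l : seq 'I_d).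
Notation e := (@basis_vec R d).

Lemma smooth_periodic f : smooth f -> Defs.periodic f. Proof. by case. Qed.

Lemma smooth_continuous f : smooth f -> continuous f.
Proof. by case=> _ /(_ [::]) []. Qed.

Lemma smooth_derivable f i x : smooth f -> derivable f x (e i).
Proof. by case=> _ /(_ [::]) []. Qed.

Lemma smooth_is_derive f i x : smooth f -> is_derive x (e i) f (pd i f x).
Proof. by move=> sf; apply: DeriveDef; [exact: (smooth_derivable sf)|]. Qed.

Lemma pds_rcons l i f : pds (rcons l i) f = pds l (pd i f).
Proof. by rewrite /pds foldr_rcons. Qed.

Lemma periodic_pd f i : Defs.periodic f -> Defs.periodic (pd i f).
Proof.
move=> pf j x; rewrite /pd /derive.
rewrite (_ : (fun t => _) = (fun t => t^-1 *: ((f \o shift x) (t *: e i) - f x)))//.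
by apply/funext => t /=; rewrite addrA !pf.
Qed.

Lemma smooth_pd f i : smooth f -> smooth (pd i f).
Proof.
by case=> pf sf; split=> [|l]; [exact: periodic_pd|rewrite -pds_rcons; exact: sf].
Qed.

Lemma smooth_pds f l : smooth f -> smooth (pds l f).
Proof. by move=> sf; elim: l => [|i l IH]; [exact: sf|exact: (smooth_pd i IH)]. Qed.

(** Proving products and inverses smooth directly would take Leibniz formulas of every order. Here
    the derivative of an expression is again an expression, so induction on the list of directions
    is enough. *)
Inductive smooth_expr : field R d -> Prop :=
| se_smooth f : smooth f -> smooth_expr f
| se_add f g : smooth_expr f -> smooth_expr g -> smooth_expr (fun x => f x + g x)
| se_mul f g : smooth_expr f -> smooth_expr g -> smooth_expr (fun x => f x * g x)
| se_inv f : (forall x, f x != 0) -> smooth_expr f -> smooth_expr (fun x => (f x)^-1)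
| se_flat n f : smooth_expr f -> smooth_expr (fun x => flat n (f x))
| se_cst c : smooth_expr (fun=> c).

Definition has_pd f g i := forall x, is_derive x (e i) f (g x).

Lemma has_pdE f g i : has_pd f g i -> pd i f = g.
Proof. by move=> H; apply/funext => x; rewrite /pd; have [_] := H x. Qed.

Lemma has_pd_smooth f i : smooth f -> has_pd f (pd i f) i.
Proof. by move=> sf x; exact: smooth_is_derive. Qed.

Lemma has_pdD f g f' g' i : has_pd f f' i -> has_pd g g' i ->
  has_pd (fun x => f x + g x) (fun x => f' x + g' x) i.
Proof. by move=> H1 H2 x; exact: (is_deriveD (H1 x) (H2 x)). Qed.

Lemma has_pdM f g f' g' i : has_pd f f' i -> has_pd g g' i ->
  has_pd (fun x => f x * g x) (fun x => f' x * g x + f x * g' x) i.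
Proof.
move=> H1 H2 x; apply: is_derive_eq; first exact: (is_deriveM (H1 x) (H2 x)).
by rewrite /GRing.scale /= addrC mulrC.
Qed.

(** The derivative is written with products and inverses only, so that it is visibly a
    [smooth_expr]. *)
Lemma has_pdV f f' i : (forall x, f x != 0) -> has_pd f f' i ->
  has_pd (fun x => (f x)^-1) (fun x => -1 * (f' x * ((f x)^-1 * (f x)^-1))) i.
Proof.
move=> f0 H x; have [df dv] := H x; apply: DeriveDef; first exact: derivableV.
by rewrite deriveV// dv /GRing.scale /= expr2 invfM; ring.
Qed.

Lemma has_pd_flat n f f' i : has_pd f f' i ->
  has_pd (fun x => flat n (f x))
    (fun x => (flat n.+2 (f x) + - n%:R * flat n.+1 (f x)) * f' x) i.
Proof.
move=> H x; apply: is_derive_eq; first exact: (is_derive_comp (H x) (is_derive_flat n _)).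
by rewrite mulNr.
Qed.

Lemma has_pd_cst c i : has_pd (fun=> c) (fun=> 0) i.
Proof. by move=> x; exact: is_derive_cst. Qed.

Lemma smooth_exprP f : smooth_expr f ->
  [/\ Defs.periodic f, continuous f & forall i, exists2 g, smooth_expr g & has_pd f g i].
Proof.
elim=> {f}.
- move=> f sf; split; first exact: smooth_periodic.
  + exact: smooth_continuous.
  + move=> i; exists (pd i f); first by apply: se_smooth; exact: smooth_pd.
    exact: has_pd_smooth.
- move=> f g sf [pf cf df] sg [pg cg dg]; split.
  + by move=> i x; rewrite pf pg.
  + exact: contD.
  + move=> i; have [f' sf' Hf] := df i; have [g' sg' Hg] := dg i.
    by exists (fun x => f' x + g' x); [exact: se_add|exact: has_pdD].
- move=> f g sf [pf cf df] sg [pg cg dg]; split.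
  + by move=> i x; rewrite pf pg.
  + exact: contM.
  + move=> i; have [f' sf' Hf] := df i; have [g' sg' Hg] := dg i.
    exists (fun x => f' x * g x + f x * g' x); last exact: has_pdM.
    by apply: se_add; exact: se_mul.
- move=> f f0 sf [pf cf df]; split.
  + by move=> i x; rewrite pf.
  + exact: contV.
  + move=> i; have [f' sf' Hf] := df i.
    eexists; last exact: (has_pdV f0 Hf).
    apply: se_mul; first exact: se_cst.
    by apply: se_mul => //; apply: se_mul; exact: se_inv.
- move=> n f sf [pf cf df]; split.
  + by move=> i x; rewrite pf.
  + by apply: (cont_comp cf); exact: flat_continuous.
  + move=> i; have [f' sf' Hf] := df i.
    eexists; last exact: (has_pd_flat n Hf).
    apply: se_mul => //; apply: se_add; first exact: se_flat.
    by apply: se_mul; [exact: se_cst|exact: se_flat].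
- move=> c; split=> //; first exact: cont_cst.
  by move=> i; exists (fun=> 0); [exact: se_cst|exact: has_pd_cst].
Qed.

Lemma smooth_expr_smooth f : smooth_expr f -> smooth f.
Proof.
move=> sf; have H l : smooth_expr (pds l f).
  elim: l => //= i l IH; have [_ _ /(_ i) [g sg Hg]] := smooth_exprP IH.
  by rewrite (has_pdE Hg).
split; first by have [] := smooth_exprP sf.
move=> l; have [_ cl dl] := smooth_exprP (H l); split=> // i x.
by have [g _ Hg] := dl i; have [] := Hg x.
Qed.

End smooth_fields.

(* Left transparent, [smooth] is unfolded by every failing unification and by [done]. *)
Global Opaque smooth.

Section smooth_calculus.
Context {R : realType} {d : nat}.
Implicit Types (f g h : field R d) (i : 'I_d) (l : seq 'I_d).

Lemma smoothD f g : smooth f -> smooth g -> smooth (fun x => f x + g x).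
Proof. by move=> sf sg; apply: smooth_expr_smooth; apply: se_add; exact: se_smooth. Qed.

Lemma smoothM f g : smooth f -> smooth g -> smooth (fun x => f x * g x).
Proof. by move=> sf sg; apply: smooth_expr_smooth; apply: se_mul; exact: se_smooth. Qed.

Lemma smoothV f : (forall x, f x != 0) -> smooth f -> smooth (fun x => (f x)^-1).
Proof. by move=> f0 sf; apply: smooth_expr_smooth; apply: se_inv => //; exact: se_smooth. Qed.

Lemma smooth_flat n f : smooth f -> smooth (fun x => flat n (f x)).
Proof. by move=> sf; apply: smooth_expr_smooth; apply: se_flat; exact: se_smooth. Qed.

Lemma smooth_cst c : smooth (fun _ : 'rV[R]_d => c).
Proof. by apply: smooth_expr_smooth; exact: se_cst. Qed.

Lemma smoothZ c f : smooth f -> smooth (fun x => c * f x).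
Proof. by move=> sf; apply: smoothM; [exact: smooth_cst|]. Qed.

Lemma smoothN f : smooth f -> smooth (fun x => - f x).
Proof.
move=> sf; have -> : (fun x => - f x) = (fun x => -1 * f x).
  by apply/funext => x; rewrite mulN1r.
exact: (smoothZ _ sf).
Qed.

Lemma smoothB f g : smooth f -> smooth g -> smooth (fun x => f x - g x).
Proof. by move=> sf sg; apply: smoothD; [|exact: smoothN]. Qed.

Lemma smooth_sum (I : finType) (F : I -> field R d) :
  (forall k, smooth (F k)) -> smooth (fun x => \sum_k F k x).
Proof.
move=> sF.
have H (s : seq I) : smooth (fun x => \sum_(k <- s) F k x).
  elim: s => [|k s IH].
    under [X in smooth X]eq_fun do rewrite big_nil.
    exact: smooth_cst.
  under [X in smooth X]eq_fun do rewrite big_cons.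
  exact: (smoothD (sF k) IH).
exact: H.
Qed.


Lemma pdD f g i : smooth f -> smooth g ->
  pd i (fun x => f x + g x) = (fun x => pd i f x + pd i g x).
Proof.
move=> sf sg; apply: has_pdE.
exact: (has_pdD (has_pd_smooth i sf) (has_pd_smooth i sg)).
Qed.

Lemma pdM f g i : smooth f -> smooth g ->
  pd i (fun x => f x * g x) = (fun x => pd i f x * g x + f x * pd i g x).
Proof.
move=> sf sg; apply: has_pdE.
exact: (has_pdM (has_pd_smooth i sf) (has_pd_smooth i sg)).
Qed.

Lemma pd_cst c i : pd i (fun _ : 'rV[R]_d => c) = (fun=> 0).
Proof. by apply: has_pdE; exact: has_pd_cst. Qed.

Lemma pdZ c f i : smooth f -> pd i (fun x => c * f x) = (fun x => c * pd i f x).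
Proof.
move=> sf; rewrite (pdM i (smooth_cst c) sf) pd_cst.
by apply/funext => x; rewrite mul0r add0r.
Qed.

Lemma pdN f i : smooth f -> pd i (fun x => - f x) = (fun x => - pd i f x).
Proof.
move=> sf; have -> : (fun x => - f x) = (fun x => -1 * f x).
  by apply/funext => x; rewrite mulN1r.
by rewrite (pdZ _ i sf); apply/funext => x; rewrite mulN1r.
Qed.

Lemma pdB f g i : smooth f -> smooth g ->
  pd i (fun x => f x - g x) = (fun x => pd i f x - pd i g x).
Proof. by move=> sf sg; rewrite (pdD i sf (smoothN sg)) (pdN i sg). Qed.

Lemma pdsD f g l : smooth f -> smooth g ->
  pds l (fun x => f x + g x) = (fun x => pds l f x + pds l g x).
Proof.
move=> sf sg; elim: l => [//|i l IH].
by rewrite /= IH (pdD i (smooth_pds l sf) (smooth_pds l sg)).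
Qed.

Lemma pdsZ c f l : smooth f -> pds l (fun x => c * f x) = (fun x => c * pds l f x).
Proof.
move=> sf; elim: l => [//|i l IH].
by rewrite /= IH (pdZ c i (smooth_pds l sf)).
Qed.

Lemma pdsB f g l : smooth f -> smooth g ->
  pds l (fun x => f x - g x) = (fun x => pds l f x - pds l g x).
Proof.
move=> sf sg; elim: l => [//|i l IH].
by rewrite /= IH (pdB i (smooth_pds l sf) (smooth_pds l sg)).
Qed.

Lemma pds_cst c l : pds l (fun _ : 'rV[R]_d => c) = (fun=> if l is [::] then c else 0).
Proof. by elim: l => [//|i l IH]; rewrite /= IH pd_cst. Qed.

Lemma smooth_grad f : smooth f -> vsmooth (grad f).
Proof. by move=> sf i; exact: (smooth_pd i sf). Qed.

Lemma smooth_diverg (v : vfield R d) : vsmooth v -> smooth (diverg v).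
Proof. by move=> sv; apply: smooth_sum => i; exact: (smooth_pd i (sv i)). Qed.

Lemma smooth_lapl f : smooth f -> smooth (lapl f).
Proof. by move=> sf; exact: (smooth_diverg (smooth_grad sf)). Qed.

Lemma smooth_dot (v w : vfield R d) : vsmooth v -> vsmooth w -> smooth (dot v w).
Proof. by move=> sv sw; apply: smooth_sum => i; exact: (smoothM (sv i) (sw i)). Qed.

Lemma divergD (v w : vfield R d) : vsmooth v -> vsmooth w ->
  diverg (fun i y => v i y + w i y) = (fun x => diverg v x + diverg w x).
Proof.
move=> sv sw; apply/funext => x; rewrite /diverg -big_split /=.
by apply: eq_bigr => i _; rewrite (pdD i (sv i) (sw i)).
Qed.

Lemma divergZ c (v : vfield R d) : vsmooth v ->
  diverg (fun i y => c * v i y) = (fun x => c * diverg v x).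
Proof.
move=> sv; apply/funext => x; rewrite /diverg mulr_sumr.
by apply: eq_bigr => i _; rewrite (pdZ c i (sv i)).
Qed.

Lemma divergM f (v : vfield R d) : smooth f -> vsmooth v ->
  diverg (fun i y => v i y * f y) = (fun x => diverg v x * f x + dot v (grad f) x).
Proof.
move=> sf sv; apply/funext => x; rewrite /diverg /dot mulr_suml -big_split /=.
by apply: eq_bigr => i _; rewrite (pdM i (sv i) sf).
Qed.

End smooth_calculus.

(** * Periodicity and integrals of derivatives *)

Section torus_calculus.
Context {R : realType}.

Lemma rcons0_basis0 n (a t : R) (y : 'rV[R]_n) :
  t *: basis_vec R 0 + rcons0 a y = rcons0 (t + a) y.
Proof.
have r0 := rcons0_0 a y; have rl := rcons0_lift a y.
have s0 := rcons0_0 (t + a) y; have sl := rcons0_lift (t + a) y.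
move: (rcons0 a y) (rcons0 (t + a) y) r0 rl s0 sl => r s r0 rl s0 sl.
apply/rowP => i; rewrite !mxE; case: (unliftP 0 i) => [j|] ->.
  rewrite rl sl (_ : (lift 0 j == 0) = false); first by rewrite andbF /= ?mulr0n mulr0 add0r.
  by apply/negbTE; rewrite eq_sym neq_lift.
by rewrite r0 s0 !eqxx mulr1.
Qed.

Lemma rcons0_basis_lift n (a t : R) (y : 'rV[R]_n) j :
  t *: basis_vec R (lift 0 j) + rcons0 a y = rcons0 a (t *: basis_vec R j + y).
Proof.
set z := t *: _ + y.
have r0 := rcons0_0 a y; have rl := rcons0_lift a y.
have s0 := rcons0_0 a z; have sl := rcons0_lift a z.
move: (rcons0 a y) (rcons0 a z) r0 rl s0 sl => r s r0 rl s0 sl.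
apply/rowP => i; rewrite !mxE; case: (unliftP 0 i) => [k|] ->.
  by rewrite rl sl !mxE (inj_eq lift_inj).
by rewrite r0 s0 (negbTE (neq_lift _ _)) andbF /= ?mulr0n mulr0 add0r.
Qed.

(** In the first coordinate this is the fundamental theorem and periodicity; the other coordinates
    follow by induction on slices. The hypotheses are weaker than [smooth] so that slices inherit
    them at once. *)
Lemma tint_has_pd n (f g : field R n) i : Defs.periodic f -> continuous f ->
  continuous g -> has_pd f g i -> tint g = 0.
Proof.
elim: n f g i => [f g []//|n IH] f g i pf cf cg H; rewrite tintS.
case: (unliftP 0 i) H => [j|] -> {i} H; last first.
  rewrite (@Int_is_tderive _ 0 1 _ (fun a => tint (fun y => f (rcons0 a y)))) ?ler01//.
  - rewrite (_ : (fun y => f (rcons0 1 y)) = (fun y => f (rcons0 0 y))) ?subrr//.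
    apply/funext => y; rewrite -[in RHS](pf 0); congr f.
    by rewrite addrC -[basis_vec R 0]scale1r rcons0_basis0 addr0.
  - exact: cont_tint_rcons0.
  - apply: (@tint_is_tderive R n 0 1 (fun z => f (rcons0 z.1 z.2)) (fun z => g (rcons0 z.1 z.2))) => //.
    + exact: (cont_comp (@cont_rcons0 R n) cf).
    + exact: (cont_comp (@cont_rcons0 R n) cg).
    + move=> s _ x _; apply: is_derive_is_tderive.
      apply/is_derive_line; have /is_derive_line := H (rcons0 s x).
      by under eq_fun do rewrite rcons0_basis0; under [X in _ -> is_derive _ _ X _]eq_fun do rewrite [_ *: 1]mulr1.
rewrite -[RHS](mul0r (1 - 0)) -Int_cst ?ler01//; apply: eq_Int => a _.
apply: (IH (fun y => f (rcons0 a y)) _ j).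
- move=> k y; rewrite -[in RHS](pf (lift 0 k)); congr f.
  rewrite [in RHS]addrC -[basis_vec R (lift 0 k)]scale1r rcons0_basis_lift.
  by rewrite scale1r addrC.
- exact: cont_rcons0_comp.
- exact: cont_rcons0_comp.
- move=> y; apply/is_derive_line; have /is_derive_line := H (rcons0 a y).
  by under eq_fun do rewrite rcons0_basis_lift.
Qed.

Lemma periodic_int n (f : field R n) i (z : int) x : Defs.periodic f ->
  f (x + z%:~R *: basis_vec R i) = f x.
Proof.
move=> pf.
have H (m : nat) y : f (y + m%:R *: basis_vec R i) = f y.
  elim: m y => [|m IH] y; first by rewrite scale0r addr0.
  by rewrite -natr1 scalerDl scale1r addrA pf IH.
case: z => m; first exact: H.
rewrite NegzE rmorphN /= scaleNr -[in LHS](H m.+1 (x - _)).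
by rewrite subrK.
Qed.

(** The point [y] of fractional parts does not depend on [f], so several fields can be moved into
    the cube simultaneously. *)
Lemma periodic_cube n (x : 'rV[R]_n) :
  exists2 y, cube y & forall f : field R n, Defs.periodic f -> f y = f x.
Proof.
pose fr i := x 0 i - (Num.floor (x 0 i))%:~R.
exists (\row_i fr i).
  move=> i; rewrite mxE /fr.
  have := floor_le (x 0 i); have := floorD1_gt (x 0 i).
  rewrite intrD; lra.
move=> f pf.
(* The coordinates are reduced one at a time; [s] lists those already replaced by their fractional
   parts. *)
suff H (s : seq 'I_n) : uniq s -> f (\row_i (if i \in s then fr i else x 0 i)) = f x.
  rewrite -(H (enum 'I_n) (enum_uniq _)); congr f; apply/rowP => i.
  by rewrite !mxE mem_enum.
elim: s => [_|i s IH /= /andP[is_ us]].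
  by congr f; apply/rowP => i; rewrite mxE.
rewrite -(IH us) -(periodic_int i (Num.floor (x 0 i)) _ pf); congr f.
apply/rowP => j; rewrite !mxE in_cons eqxx /=.
have [->|ji] /= := eqVneq j i; first by rewrite (negbTE is_) /fr mulr1 subrK.
by rewrite mulr0 addr0.
Qed.

End torus_calculus.

Section smooth_integrals.
Context {R : realType} {d : nat}.
Implicit Types (f g h : field R d) (v w : vfield R d) (i : 'I_d).

Lemma tint_pd f i : smooth f -> tint (pd i f) = 0.
Proof.
move=> sf; apply: (tint_has_pd (f := f) (i := i)).
- exact: (smooth_periodic sf).
- exact: (smooth_continuous sf).
- exact: (smooth_continuous (smooth_pd i sf)).
- exact: (has_pd_smooth i sf).
Qed.

Lemma tint_sum (I : finType) (F : I -> field R d) :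
  (forall k, continuous (F k)) -> tint (fun x => \sum_k F k x) = \sum_k tint (F k).
Proof.
move=> cF.
have H (s : seq I) : continuous (fun x => \sum_(k <- s) F k x) /\
    tint (fun x => \sum_(k <- s) F k x) = \sum_(k <- s) tint (F k).
  elim: s => [|k s [cs IH]].
    under eq_fun do rewrite big_nil; rewrite big_nil; split; first exact: cont_cst.
    by rewrite tint_cst.
  have E : (fun x => \sum_(j <- k :: s) F j x) = (fun x => F k x + \sum_(j <- s) F j x).
    by apply/funext => x; rewrite big_cons.
  rewrite E big_cons -IH; split; first exact: (contD (cF k) cs).
  exact: (tintD (cF k) cs).
by have [] := H (index_enum I).
Qed.

Lemma tint_diverg v : vsmooth v -> tint (diverg v) = 0.
Proof.
move=> sv; rewrite tint_sum; last first.
  by move=> i; exact: (smooth_continuous (smooth_pd i (sv i))).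
by rewrite big1// => i _; exact: (tint_pd i (sv i)).
Qed.

Lemma tint_dot_grad v f : vsmooth v -> smooth f ->
  tint (dot v (grad f)) = - tint (fun x => diverg v x * f x).
Proof.
move=> sv sf.
have sd := smooth_diverg sv.
have sdf : smooth (fun x => diverg v x * f x) by exact: (smoothM sd sf).
have sdg : smooth (dot v (grad f)) by exact: (smooth_dot sv (smooth_grad sf)).
have svf : vsmooth (fun i y => v i y * f y) by move=> i; exact: (smoothM (sv i) sf).
have := tint_diverg svf; rewrite (divergM sf sv).
rewrite (tintD (smooth_continuous sdf) (smooth_continuous sdg)) => /eqP.
by rewrite addrC addr_eq0 => /eqP.
Qed.

Lemma dotC v w : dot v w = dot w v.
Proof. by apply/funext => x; apply: eq_bigr => i _; rewrite mulrC. Qed.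

Lemma tint_sqr_eq0 f : Defs.periodic f -> continuous f -> tint (fun x => f x * f x) = 0 ->
  forall x, f x = 0.
Proof.
move=> pf cf f0 x; have [y cy /(_ f pf) <-] := periodic_cube x.
apply/eqP/negPn/negP => fy.
have : 0 < tint (fun x => f x * f x).
  apply: (tint_gt0 (x := y)) => //.
  - exact: (contM cf cf).
  - by move=> z _; rewrite -expr2 sqr_ge0.
  - by rewrite -expr2 lt_def sqr_ge0 sqrf_eq0 fy.
by rewrite f0 ltxx.
Qed.

End smooth_integrals.

(** * Families of fields and functionals *)

Section families.
Context {R : realType} {d : nat}.
Implicit Types (U V : topologicalType) (f g h p q : field R d) (i : 'I_d).

(** A continuous family of smooth fields, in the sense of [smooth_path] but over any parameter space
    and without a restricted domain. *)
Definition cfam U (q : U -> field R d) :=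
  (forall u, smooth (q u)) /\
  forall l, continuous (fun z : U * 'rV[R]_d => pds l (q z.1) z.2).

(** The weaker notion is what velocities satisfy, as [T] is only continuous into the uniform
    topology. It suffices for controls and integrands, and products and inverses preserve it without
    any rule for derivatives. *)
Definition c0fam U (f : U -> field R d) :=
  (forall u, smooth (f u)) /\ continuous (fun z : U * 'rV[R]_d => f z.1 z.2).

Lemma cfam_smooth U (q : U -> field R d) u : cfam q -> smooth (q u).
Proof. by case. Qed.

Lemma c0fam_smooth U (q : U -> field R d) u : c0fam q -> smooth (q u).
Proof. by case. Qed.

Lemma cfam_pd U (q : U -> field R d) i : cfam q -> cfam (fun u => pd i (q u)).
Proof.
case=> sq cq; split=> [u|l]; first exact: (smooth_pd i (sq u)).
by under eq_fun do rewrite -pds_rcons; exact: cq.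
Qed.

Lemma cfam_c0fam U (q : U -> field R d) : cfam q -> c0fam q.
Proof. by case=> sq cq; split=> //; exact: (cq [::]). Qed.

Lemma cont_comp1 U V (q : U -> field R d) (c : V -> U) :
  continuous c -> continuous (fun z : U * 'rV[R]_d => q z.1 z.2) ->
  continuous (fun z : V * 'rV[R]_d => q (c z.1) z.2).
Proof.
move=> cc cq.
apply: (cont_comp (f := fun z : V * 'rV[R]_d => (c z.1, z.2))
  (g := fun z : U * 'rV[R]_d => q z.1 z.2)) => //.
apply: cont_pair; last exact: cont_snd.
by apply: (cont_comp (f := fun z : V * 'rV[R]_d => z.1) (g := c)) => //; exact: cont_fst.
Qed.

Lemma cfam_comp U V (q : U -> field R d) (c : V -> U) :
  continuous c -> cfam q -> cfam (fun v => q (c v)).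
Proof.
move=> cc [sq cq]; split=> [v|l]; first exact: sq.
exact: (cont_comp1 (q := fun u => pds l (q u)) cc (cq l)).
Qed.

Lemma c0fam_comp U V (q : U -> field R d) (c : V -> U) :
  continuous c -> c0fam q -> c0fam (fun v => q (c v)).
Proof.
by move=> cc [sq cq]; split=> [v|]; [exact: sq|exact: (cont_comp1 cc cq)].
Qed.

Lemma cfam_cst U f : smooth f -> cfam (fun _ : U => f).
Proof.
move=> sf; split=> // l.
apply: (cont_comp (f := fun z : U * 'rV[R]_d => z.2) (g := pds l f)); first exact: cont_snd.
exact: (smooth_continuous (smooth_pds l sf)).
Qed.

Lemma cfamD U (p q : U -> field R d) : cfam p -> cfam q ->
  cfam (fun u x => p u x + q u x).
Proof.
move=> [sp cp] [sq cq]; split=> [u|l]; first exact: (smoothD (sp u) (sq u)).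
rewrite (_ : (fun z => _) = (fun z => pds l (p z.1) z.2 + pds l (q z.1) z.2)).
  exact: (contD (cp l) (cq l)).
by apply/funext => z; rewrite (pdsD l (sp z.1) (sq z.1)).
Qed.

Lemma cfamZ U (c : U -> R) (q : U -> field R d) : continuous c -> cfam q ->
  cfam (fun u x => c u * q u x).
Proof.
move=> cc [sq cq]; split=> [u|l]; first exact: (smoothZ (c u) (sq u)).
rewrite (_ : (fun z => _) = (fun z => c z.1 * pds l (q z.1) z.2)).
  apply: contM => //; apply: (cont_comp (f := fun z : U * 'rV[R]_d => z.1) (g := c)) => //.
  exact: cont_fst.
by apply/funext => z; rewrite (pdsZ (c z.1) l (sq z.1)).
Qed.

Lemma c0famD U (p q : U -> field R d) : c0fam p -> c0fam q ->
  c0fam (fun u x => p u x + q u x).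
Proof.
move=> [sp cp] [sq cq]; split=> [u|]; first exact: (smoothD (sp u) (sq u)).
exact: (contD cp cq).
Qed.

Lemma c0famM U (p q : U -> field R d) : c0fam p -> c0fam q ->
  c0fam (fun u x => p u x * q u x).
Proof.
move=> [sp cp] [sq cq]; split=> [u|]; first exact: (smoothM (sp u) (sq u)).
exact: (contM cp cq).
Qed.

Lemma c0famN U (p : U -> field R d) : c0fam p -> c0fam (fun u x => - p u x).
Proof.
by move=> [sp cp]; split=> [u|]; [exact: (smoothN (sp u))|exact: (contN cp)].
Qed.

Lemma c0famV U (p : U -> field R d) : (forall u x, p u x != 0) -> c0fam p ->
  c0fam (fun u x => (p u x)^-1).
Proof.
move=> p0 [sp cp]; split=> [u|]; first exact: (smoothV (p0 u) (sp u)).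
exact: (contV (fun z => p0 z.1 z.2) cp).
Qed.

Lemma c0fam_cst U (c : U -> R) : continuous c -> c0fam (fun u (_ : 'rV[R]_d) => c u).
Proof.
move=> cc; split=> [u|]; first exact: smooth_cst.
by apply: (cont_comp (f := fun z : U * 'rV[R]_d => z.1) (g := c)) => //; exact: cont_fst.
Qed.

Lemma c0fam_sum U (I : finType) (F : I -> U -> field R d) :
  (forall k, c0fam (F k)) -> c0fam (fun u x => \sum_k F k u x).
Proof.
move=> cF; split=> [u|].
  by apply: smooth_sum => k; exact: (c0fam_smooth u (cF k)).
by apply: cont_sum => k; have [] := cF k.
Qed.

Lemma c0fam_tint U (f : U -> field R d) : c0fam f -> continuous (fun u => tint (f u)).
Proof. by case=> sf cf; exact: (tint_param_continuous (f := fun z => f z.1 z.2) cf). Qed.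

Lemma cube_bounded f : continuous f -> exists2 M, 0 <= M & forall x, cube x -> `|f x| <= M.
Proof.
move=> cf; have := @EVT_max_rV R d (fun x => `|f x|) (@cube R d).
case.
- by exists 0 => i; rewrite mxE lexx ler01.
- exact: cube_compact.
- apply: continuous_subspaceT.
  by apply: (cont_comp (f := f) (g := fun y : R => `|y|)) => //; exact: norm_continuous.
- move=> c _ H; exists `|f c| => // x cx; apply: H; exact: mem_set.
Qed.

(** Joint continuity becomes uniform closeness by compactness of the cube, and periodicity extends
    it to all points. The induction on [k] removes the innermost derivative, since [pd i] maps
    families to families. *)
Lemma cfam_near_close U (q : U -> field R d) u k e : cfam q -> 0 < e ->
  \forall v \near u, C_k_close k e (q v) (q u).
Proof.
move=> cq e0; elim: k q cq => [|k IH] q [sq cq].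
  have := compact_uniform_near u (@cube_compact R d) (cq [::]) e0.
  apply: filterS => v Hv [|//] _ x; rewrite /=.
  have [y cy Hy] := periodic_cube x.
  rewrite -(Hy _ (smooth_periodic (sq v))) -(Hy _ (smooth_periodic (sq u))).
  exact: (Hv y cy).
have H0 := compact_uniform_near u (@cube_compact R d) (cq [::]) e0.
have H1 : \forall v \near u, forall i, C_k_close k e (pd i (q v)) (pd i (q u)).
  by apply: filter_forall => i; apply: IH; exact: (cfam_pd i (conj sq cq)).
near=> v => l; case/lastP: l => [_ x|l i].
  have [y cy Hy] := periodic_cube x.
  rewrite /= -(Hy _ (smooth_periodic (sq v))) -(Hy _ (smooth_periodic (sq u))).
  by move: y cy {Hy}; near: v; exact: H0.
rewrite size_rcons ltnS => lk x; rewrite pds_rcons (pdB i (sq v) (sq u)).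
have H2 : C_k_close k e (pd i (q v)) (pd i (q u)) by move: i; near: v; exact: H1.
exact: (H2 l lk x).
Unshelve. all: by end_near. Qed.

Lemma C_k_close_le k k' e e' p q : (k <= k')%N -> e' <= e ->
  C_k_close k' e' p q -> C_k_close k e p q.
Proof.
by move=> kk ee H l lk x; rewrite (le_trans _ ee)//; apply: H; exact: leq_trans kk.
Qed.

Lemma C_k_close0 k e p q : C_k_close k e p q -> forall x, `|p x - q x| <= e.
Proof. by move=> H; exact: (H [::]). Qed.

Lemma C_k_close_convex k e p0 p1 q t : smooth p0 -> smooth p1 -> smooth q -> 0 <= t <= 1 ->
  C_k_close k e p0 q -> C_k_close k e p1 q ->
  C_k_close k e (fun x => p0 x + t * (p1 x - p0 x)) q.
Proof.
move=> s0 s1 sq /andP[t0 t1] H0 H1 l lk x.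
have {H0} := H0 l lk x; have {H1} := H1 l lk x.
have s10 : smooth (fun x => p1 x - p0 x) by exact: (smoothB s1 s0).
rewrite (pdsB l s1 sq) (pdsB l s0 sq) (pdsB l (smoothD s0 (smoothZ t s10)) sq).
rewrite (pdsD l s0 (smoothZ t s10)) (pdsZ t l s10) (pdsB l s1 s0).
move=> H1 H0.
rewrite (_ : _ - _ = (1 - t) * (pds l p0 x - pds l q x) + t * (pds l p1 x - pds l q x)); last by ring.
rewrite (le_trans (ler_normD _ _))// !normrM (ger0_norm t0) ger0_norm ?subr_ge0//.
rewrite [leRHS](_ : e = (1 - t) * e + t * e); last by ring.
by rewrite lerD// ler_wpM2l// subr_ge0.
Qed.

End families.

(** * Functionals with continuous first variation *)

Section functionals.
Context {R : realType} {d : nat}.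
Context (Q : set (field R d)).
Context (hQ : state_space Q).
Implicit Types (U : topologicalType) (f g h p q : field R d) (i : 'I_d).

Lemma state_smooth q : Q q -> smooth q.
Proof. by case: hQ => H _; exact: H. Qed.

Lemma state_near U (q : U -> field R d) u : cfam q -> Q (q u) ->
  \forall v \near u, Q (q v).
Proof.
move=> cq; case: hQ => _ H /H [k [e [e0 He]]].
apply: filterS (cfam_near_close u k cq e0) => v.
exact: (He _ (cfam_smooth v cq)).
Qed.

(** By linearity the increment splits into [T] of a small difference, bounded by the operator
    estimate, and the oscillation of the fixed field [T (q u) i]. *)
Lemma velocity_c0fam U (T : field R d -> vfield R d) (q : U -> field R d) i :
  velocity_operator T -> cfam q -> c0fam (fun u => T (q u) i).
Proof.
case=> sT linT _ [k [C HC]] cq; have sq u := cfam_smooth u cq.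
split=> [u|]; first exact: (sT _ (sq u) i).
move=> -[u x]; apply/cvgrPdist_le => e e0.
have e20 : 0 < e / 2 by rewrite divr_gt0.
have c0 : 0 < e / 2 / (`|C| + 1) by rewrite divr_gt0// ltr_wpDl.
have cTu : continuous (T (q u) i) by exact: (smooth_continuous (sT _ (sq u) i)).
have H1 : \forall z \near (u, x), `|T (q u) i x - T (q u) i z.2| <= e / 2.
  have c2 : continuous (fun z : U * 'rV[R]_d => T (q u) i z.2).
    apply: (cont_comp (f := fun z : U * 'rV[R]_d => z.2) (g := T (q u) i)) => //.
    exact: cont_snd.
  by have /cvgrPdist_le /(_ _ e20) := c2 (u, x).
have H2 : \forall z \near (u, x), C_k_close k (e / 2 / (`|C| + 1)) (q z.1) (q u).
  exact: (@cont_fst U 'rV[R]_d (u, x) _ (cfam_near_close u k cq c0)).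
near=> z => /=.
have h1 : `|T (q u) i x - T (q u) i z.2| <= e / 2 by near: z; exact: H1.
have h2 : C_k_close k (e / 2 / (`|C| + 1)) (q z.1) (q u) by near: z; exact: H2.
have sD : smooth (fun y => q z.1 y - q u y) by exact: (smoothB (sq z.1) (sq u)).
have h3 : `|T (fun y => q z.1 y - q u y) i z.2| <= C * (e / 2 / (`|C| + 1)).
  apply: HC => // l lk y; rewrite (pdsB l sD (smooth_cst 0)) pds_cst.
  by rewrite (_ : (if l is [::] then _ else _) = 0) ?subr0; [exact: h2|case: (l)].
have E : T (q z.1) i z.2 = T (fun y => q z.1 y - q u y) i z.2 + T (q u) i z.2.
  rewrite -[X in X + _]mul1r -(linT 1 _ _ sD (sq u)).
  by congr (T _ i z.2); apply/funext => y; rewrite mul1r subrK.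
rewrite E opprD addrCA addrC (le_trans (ler_normD _ _))//.
rewrite [leRHS]splitr lerD// normrN (le_trans h3)//.
rewrite (le_trans (y := `|C| * (e / 2 / (`|C| + 1))))//.
  by rewrite ler_wpM2r ?(ltW c0)// ler_norm.
by rewrite mulrCA ger_pMr// ler_pdivrMr ?ltr_wpDl// mul1r lerDl.
Unshelve. all: by end_near. Qed.

Context (F : field R d -> R) (dF : field R d -> field R d).
Context (hF : C1_functional Q F dF).

Lemma C1_functional_MVT p0 p1 : smooth p0 -> smooth p1 ->
  (forall t, 0 <= t <= 1 -> Q (fun x => p0 x + t * (p1 x - p0 x))) ->
  exists2 t, 0 <= t <= 1 &
    F p1 - F p0 = tint (fun x => dF (fun x => p0 x + t * (p1 x - p0 x)) x * (p1 x - p0 x)).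
Proof.
move=> s0 s1 HQ.
have s10 : smooth (fun x => p1 x - p0 x) by exact: (smoothB s1 s0).
pose P t : field R d := fun x => p0 x + t * (p1 x - p0 x).
have D t : 0 <= t <= 1 -> is_tderive [set r | 0 <= r <= 1] (fun r => F (P r)) t
    (tint (fun x => dF (P t) x * (p1 x - p0 x))).
  move=> t01; apply: is_derive_is_tderive.
  have [_ _ /(_ _ s10) H] := hF.1 _ (HQ t t01).
  apply/is_derive_line; move: H.
  congr (is_derive _ _ _ _); apply/funext => e; congr F; apply/funext => x.
  by rewrite /P [e *: 1]mulr1; ring.
have [x /andP[x0 x1] E] := is_tderive_MVT D (lexx 0) ltr01 (lexx 1).
exists x; first by rewrite (ltW x0) (ltW x1).
rewrite -[RHS]mulr1 -[X in _ * X]subr0 -E /P; congr (F _ - F _); apply/funext => y; ring.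
Qed.

(** A mean value theorem uniform on a neighbourhood of [q]: the weight [g] is [dF] at an
    intermediate state of the segment, and convexity keeps that state in the neighbourhood. *)
Lemma C1_functional_local q e : Q q -> 0 < e -> exists k r, [/\ 0 < r,
   forall p, smooth p -> C_k_close k r p q -> Q p &
   forall p0 p1, smooth p0 -> smooth p1 -> C_k_close k r p0 q -> C_k_close k r p1 q ->
   exists g, [/\ continuous g, forall x, `|g x - dF q x| <= e &
      F p1 - F p0 = tint (fun x => g x * (p1 x - p0 x))]].
Proof.
move=> Qq e0; case: hQ => _ /(_ _ Qq) [k1 [r1 [r10 H1]]].
have [k2 [r2 [r20 H2]]] := hF.2 _ Qq _ e0.
have HQ p : smooth p -> C_k_close (maxn k1 k2) (Num.min r1 r2) p q -> Q p.
  move=> sp H; apply: H1 => //; apply: C_k_close_le H; first exact: leq_maxl.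
  by rewrite ge_min lexx.
have r0 : 0 < Num.min r1 r2 by rewrite lt_min r10.
exists (maxn k1 k2), (Num.min r1 r2).
split; first exact: r0.
  exact HQ.
move=> p0 p1 s0 s1 c0 c1.
have sq := state_smooth Qq.
have s10 t : smooth (fun x => p0 x + t * (p1 x - p0 x)).
  exact: (smoothD s0 (smoothZ t (smoothB s1 s0))).
have cl t : 0 <= t <= 1 ->
    C_k_close (maxn k1 k2) (Num.min r1 r2) (fun x => p0 x + t * (p1 x - p0 x)) q.
  by move=> t01; exact: (C_k_close_convex s0 s1 sq t01 c0 c1).
have Ht t : 0 <= t <= 1 -> Q (fun x => p0 x + t * (p1 x - p0 x)).
  by move=> /cl; exact: (HQ _ (s10 t)).
have [t t01 E] := C1_functional_MVT s0 s1 Ht.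
exists (dF (fun x => p0 x + t * (p1 x - p0 x))); split=> //.
  by have [] := hF.1 _ (Ht t t01).
apply: H2; first exact: Ht.
apply: C_k_close_le (cl t t01); first exact: leq_maxr.
by rewrite ge_min lexx orbT.
Qed.

Lemma C1_functional_dF_continuous q : Q q -> continuous (dF q).
Proof. by move=> Qq; have [] := hF.1 _ Qq. Qed.

Lemma C1_functional_continuous U (q : U -> field R d) :
  cfam q -> (forall u, Q (q u)) -> continuous (fun u => F (q u)).
Proof.
move=> cq Hq u; apply/cvgrPdist_le => e e0; have sq v := cfam_smooth v cq.
have [k [r [r0 _ H]]] := C1_functional_local (Hq u) ltr01.
have [M M0 HM] := cube_bounded (C1_functional_dF_continuous (Hq u)).
have k0 : 0 < Num.min r (e / (M + 1)).
  by rewrite lt_min r0 divr_gt0// ltr_wpDl.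
apply: filterS (cfam_near_close u k cq k0) => v Hv.
have c1 : C_k_close k r (q v) (q u).
  by apply: C_k_close_le Hv => //; rewrite ge_min lexx.
have c2 : C_k_close k r (q u) (q u).
  move=> l _ x; rewrite (pdsB l (sq u) (sq u)) subrr normr0; exact: ltW.
have [g [cg Hg ->]] := H _ _ (sq v) (sq u) c1 c2.
have sB := smoothB (sq u) (sq v).
apply: tint_norm_le; first exact: (contM cg (smooth_continuous sB)).
move=> x cx; have h1 : `|q u x - q v x| <= e / (M + 1).
  by rewrite distrC (le_trans (C_k_close0 Hv x))// ge_min lexx orbT.
have h2 : `|g x| <= M + 1.
  rewrite -(subrK (dF (q u) x) (g x)) (le_trans (ler_normD _ _))// addrC.
  by rewrite lerD// HM.
rewrite normrM (le_trans (ler_pM _ _ h2 h1))//.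
by rewrite mulrC divfK// gt_eqF// ltr_wpDl.
Qed.

(** Strict differentiability: the base state [q z.1] moves while the derivative is taken at [q u].
    This makes the expansion uniform along a path by compactness in time. *)
Lemma C1_functional_diff U (q : U -> field R d) u h e :
  cfam q -> smooth h -> Q (q u) -> 0 < e ->
  \forall z \near (u, 0 : R), Q (fun x => q z.1 x + z.2 * h x) /\
   `|F (fun x => q z.1 x + z.2 * h x) - F (q z.1) - z.2 * tint (fun x => dF (q u) x * h x)|
     <= e * `|z.2|.
Proof.
move=> cq sh Qu e0; have sq v := cfam_smooth v cq.
have ch := smooth_continuous sh.
have [M M0 HM] := cube_bounded ch.
have k0 : 0 < e / (M + 1) by rewrite divr_gt0// ltr_wpDl.
have [k [r [r0 HQ H]]] := C1_functional_local Qu k0.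
have cF1 : cfam (fun z : U * R => fun x => q z.1 x + z.2 * h x).
  apply: cfamD; first by apply: (cfam_comp (c := fst)) => //; exact: cont_fst.
  by apply: cfamZ; [exact: cont_snd|exact: cfam_cst].
have cF2 : cfam (fun z : U * R => q z.1).
  by apply: (cfam_comp (c := fst)) => //; exact: cont_fst.
have E0 : (fun x => q u x + 0 * h x) = q u by apply/funext => x; rewrite mul0r addr0.
have N1 := cfam_near_close (u, 0) k cF1 r0; have N2 := cfam_near_close (u, 0) k cF2 r0.
near=> z.
have n1 : C_k_close k r (fun x => q z.1 x + z.2 * h x) (q u).
  by rewrite -E0; near: z; exact: N1.
have n2 : C_k_close k r (q z.1) (q u) by near: z; exact: N2.
have s1 := cfam_smooth z cF1.
split; first exact: (HQ _ s1 n1).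
have [g [cg Hg ->]] := H _ _ (sq z.1) s1 n2 n1.
have cd := C1_functional_dF_continuous Qu.
rewrite (_ : (fun x => g x * _) = (fun x => z.2 * (g x * h x))); last first.
  by apply/funext => x; ring.
rewrite (tintZ _ (contM cg ch)) -mulrBr -(tintB (contM cg ch) (contM cd ch)).
rewrite normrM mulrC ler_wpM2r//.
apply: tint_norm_le; first exact: (contB (contM cg ch) (contM cd ch)).
move=> x cx; rewrite -mulrBl normrM (le_trans (ler_pM _ _ (Hg x) (HM x cx)))//.
by rewrite mulrAC ler_pdivrMr ?ltr_wpDl// ler_wpM2l ?lerDl// ltW.
Unshelve. all: by end_near. Qed.

End functionals.

(** * Dynamic programming *)

Section clamping.
Context {R : realType}.

(** Composition with [clamp] freezes a path outside [[a, b]], which turns continuity relative to the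
    interval into continuity on the line. It is also used to keep perturbation sizes within
    [[- dl, dl]]. *)
Definition clamp (a b s : R) : R := Num.max a (Num.min b s).

Lemma clamp_id a b s : a <= s <= b -> clamp a b s = s.
Proof. by move=> /andP[as_ sb]; rewrite /clamp (min_idPr sb) (max_idPr as_). Qed.

Lemma clamp_itv a b s : a <= b -> a <= clamp a b s <= b.
Proof. by move=> ab; rewrite /clamp le_max lexx/= ge_max ab ge_min lexx. Qed.

Lemma cont_clamp a b : continuous (clamp a b).
Proof.
move=> s; apply: (@continuous_max R R (fun=> a) (fun s => Num.min b s)); first exact: cvg_cst.
by apply: (@continuous_min R R (fun=> b) (fun s => s)); [exact: cvg_cst|exact: cvg_id].
Qed.

Lemma within_comp (V : topologicalType) (A : set R) (c : R -> R) (f : R * V -> R) :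
  continuous c -> (forall s, A (c s)) ->
  {within [set z : R * V | A z.1], continuous f} ->
  continuous (fun z => f (c z.1, z.2)).
Proof.
move=> cc Ac /subspace_continuousP cf z B /(cf (c z.1, z.2) (Ac z.1)) /= HB.
have cc2 : continuous (fun z : R * V => (c z.1, z.2)).
  apply: cont_pair; last exact: cont_snd.
  by apply: (cont_comp (f := fun z : R * V => z.1) (g := c)) => //; exact: cont_fst.
have H : \forall y \near z, A (c y.1) -> B (f (c y.1, y.2)) by exact: (cc2 z _ HB).
by apply: filterS H => y; apply; exact: Ac.
Qed.

Lemma within_clamp (V : topologicalType) (a b : R) (f : R * V -> R) : a <= b ->
  {within [set z : R * V | a <= z.1 <= b], continuous f} ->
  continuous (fun z => f (clamp a b z.1, z.2)).
Proof.
move=> ab; apply: (within_comp (A := [set s | a <= s <= b]) (c := clamp a b)).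
  exact: cont_clamp.
by move=> s; exact: clamp_itv.
Qed.

End clamping.

(** * Gluing admissible paths *)

Section control.
Context {R : realType} {d : nat}.
Context (Q : set (field R d)).
Context (T : field R d -> vfield R d).
Context (D : R).

Lemma smooth_path_clamp a b (q : R -> field R d) : a <= b -> smooth_path a b q ->
  cfam (fun s => q (clamp a b s)).
Proof.
move=> ab [sq cq]; split=> [s|l]; first by apply: sq; exact: clamp_itv.
exact: (within_clamp ab (cq l)).
Qed.

Definition run_cost (F : field R d -> R) (q : field R d) (al : vfield R d) : R :=
  tint (fun x => 2^-1 * dot al al x * q x) + F q.

(* Unlike in [admissible], the data are defined at all times, so that continuity is
   never relative to [a, b], and the control has no discontinuity. *)
Definition piece (a b : R) (p : R -> field R d) (al : R -> vfield R d) :=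
  [/\ cfam p, forall s, Q (p s), forall i, c0fam (fun s => al s i)
    & forall s, a <= s <= b -> forall x,
        is_tderive [set r | a <= r <= b] (fun r => p r x) s (transport T D (p s) (al s) x)].

Lemma piece_sub a b a' b' p al : a <= a' -> b' <= b -> piece a b p al -> piece a' b' p al.
Proof.
move=> aa bb [cp Qp cal dp]; split=> // s /andP[as_ sb] x.
have := dp s; rewrite (le_trans aa as_) (le_trans sb bb) => /(_ isT x).
by apply: is_tderive_subset => r /= /andP[ar rb]; rewrite (le_trans aa ar) (le_trans rb bb).
Qed.

Lemma velocity_piece (hT : velocity_operator T) a b p (V : R -> vfield R d) : cfam p ->
  (forall s, Q (p s)) -> (forall i, c0fam (fun s => V s i)) ->
  (forall s, a <= s <= b -> forall x, is_tderive [set r | a <= r <= b] (fun r => p r x) s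
     (D * lapl (p s) x - diverg (fun i y => V s i y * p s y) x)) ->
  piece a b p (fun s i x => V s i x - T (p s) i x).
Proof.
move=> cp Qp cV dp; split=> //.
  by move=> i; exact: (c0famD (cV i) (c0famN (velocity_c0fam i hT cp))).
move=> s sab x; have := dp s sab x; congr is_tderive.
rewrite /transport; congr (_ - diverg _ x); apply/funext => i; apply/funext => y.
by rewrite addrC subrK.
Qed.

Lemma c0fam_dot (U : topologicalType) (v w : U -> vfield R d) : (forall i, c0fam (fun u => v u i)) ->
  (forall i, c0fam (fun u => w u i)) -> @c0fam R d U (fun u => dot (v u) (w u)).
Proof. by move=> cv cw; apply: c0fam_sum => i; exact: (c0famM (cv i) (cw i)). Qed.

Lemma cont_run_cost (U : topologicalType) (hQ : state_space Q) F dF (hF : C1_functional Q F dF)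
    (p : U -> field R d) (al : U -> vfield R d) :
  cfam p -> (forall u, Q (p u)) -> (forall i, c0fam (fun u => al u i)) ->
  continuous (fun u => run_cost F (p u) (al u)).
Proof.
move=> cp Qp cal; apply: contD; last exact: (C1_functional_continuous hQ hF cp Qp).
have c2 : c0fam (fun (u : U) (_ : 'rV[R]_d) => 2^-1 : R) by apply: c0fam_cst; exact: cont_cst.
exact: (c0fam_tint (c0famM (c0famM c2 (c0fam_dot cal cal)) (cfam_c0fam cp))).
Qed.

Definition concat A (m : R) (f g : R -> A) (s : R) : A := if s <= m then f s else g s.

(** Equality of the fields at [m] carries over to all their spatial derivatives, so each derivative
    is continuous on two closed sets and thus on their union. *)
Lemma concat_smooth_path t m tf (p p' : R -> field R d) : t <= m <= tf ->
  p m = p' m -> cfam p -> cfam p' -> smooth_path t tf (concat m p p').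
Proof.
move=> /andP[tm mtf] pm [sp cp] [sp' cp']; split=> [s _|l].
  by rewrite /concat; case: ifP.
have -> : [set z : R * 'rV[R]_d | t <= z.1 <= tf] =
   [set z | t <= z.1 <= m] `|` [set z | m <= z.1 <= tf].
  apply/seteqP; split=> z /=.
    by move=> /andP[tz zt]; have [zm|zm] := leP z.1 m; [left|right]; rewrite ?tz ?zt ?(ltW zm).
  by move=> [/andP[-> zm]|/andP[mz ->]]; rewrite ?(le_trans zm) ?(le_trans tm).
have cl a b : closed [set z : R * 'rV[R]_d | a <= z.1 <= b].
  rewrite (_ : [set z | _] = fst @^-1` `[a, b]%classic).
    apply: closed_comp; last exact: itv_closed.
    by move=> z _; exact: cont_fst.
  by apply/seteqP; split=> z /=; rewrite in_itv.
have W a b (f g : R -> field R d) : (forall s, a <= s <= b -> f s = g s) ->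
    continuous (fun z : R * 'rV[R]_d => pds l (f z.1) z.2) ->
    {within [set z : R * 'rV[R]_d | a <= z.1 <= b], continuous (fun z => pds l (g z.1) z.2)}.
  move=> fg cf; apply: (@subspace_eq_continuous _ _ _ (fun z => pds l (f z.1) z.2)).
    by move=> z; rewrite inE /= => /fg ->.
  exact: continuous_subspaceT.
apply: withinU_continuous; [exact: cl|exact: cl| |].
- by apply: W (cp l) => s /andP[_ sm]; rewrite /concat sm.
- apply: W (cp' l) => s /andP[ms _]; rewrite /concat; case: ifP => // sm.
  by have -> : s = m by apply/eqP; rewrite eq_le sm.
Qed.

Lemma piece_admissible t m tf p p' al al' : t <= m <= tf -> p m = p' m ->
  piece t m p al -> piece m tf p' al' ->
  admissible Q T D tf (p t) t (concat m p p') (concat m al al').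
Proof.
move=> tmt pm [cp Qp cal dp] [cp' Qp' cal' dp']; have /andP[tm mtf] := tmt.
split.
- by rewrite /concat tm.
- exact: concat_smooth_path.
- by move=> s _; rewrite /concat; case: ifP.
- move=> s _ i; rewrite /concat; case: ifP => _; first exact: (c0fam_smooth s (cal i)).
  exact: (c0fam_smooth s (cal' i)).
(* At the gluing time the control may jump and the path may have a corner. *)
exists [:: m]; split.
- move=> i; apply/subspace_continuousP => -[s x] /= [/andP[ts stf]].
  rewrite inE => sm.
  have [slt|] := ltP s m.
    have N : \forall z \near (s, x), z.1 < m.
      exact: (@cont_fst R 'rV[R]_d (s, x) _ (lt_nbhsl slt)).
    have c1 : (fun z : R * 'rV[R]_d => al z.1 i z.2) @ within [set z : R * 'rV[R]_d | t <= z.1 <= tf /\ z.1 \notin [:: m]] (nbhs (s, x)) --> al s i x.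
      by apply: cvg_within_filter; have [_ /(_ (s, x))] := cal i.
    have E : concat m al al' s = al s by rewrite /concat (ltW slt).
    rewrite -[X in _ --> X]/(concat m al al' s i x) E.
    apply: cvg_trans c1; apply: near_eq_cvg.
    apply: cvg_within; apply: filterS N => z zm.
    have Ez : concat m al al' z.1 = al z.1 by rewrite /concat (ltW zm).
    exact: (esym (congr1 (fun f : vfield R d => f i z.2) Ez)).
  rewrite le_eqVlt eq_sym (negbTE sm) /= => slt.
  have N : \forall z \near (s, x), m < z.1.
    exact: (@cont_fst R 'rV[R]_d (s, x) _ (lt_nbhsr slt)).
  have c1 : (fun z : R * 'rV[R]_d => al' z.1 i z.2) @ within [set z : R * 'rV[R]_d | t <= z.1 <= tf /\ z.1 \notin [:: m]] (nbhs (s, x)) --> al' s i x.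
    by apply: cvg_within_filter; have [_ /(_ (s, x))] := cal' i.
  have E : concat m al al' s = al' s by rewrite /concat leNgt slt.
  rewrite -[X in _ --> X]/(concat m al al' s i x) E.
  apply: cvg_trans c1; apply: near_eq_cvg.
  apply: cvg_within; apply: filterS N => z zm.
  have Ez : concat m al al' z.1 = al' z.1 by rewrite /concat leNgt zm.
  exact: (esym (congr1 (fun f : vfield R d => f i z.2) Ez)).
- move=> s /andP[ts stf]; rewrite inE => sm x.
  have [slt|] := ltP s m.
    rewrite /concat (ltW slt).
    apply: (is_tderive_near_eq (dl := m - s) (B := [set r | t <= r <= m]) (f := fun r => p r x)).
    + by rewrite subr_gt0.
    + by rewrite /= ts stf.
    + move=> r /= /andP[tr rtf]; rewrite ltr_norml => /andP[_]; rewrite ltrD2r => rm.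
      by rewrite tr (ltW rm).
    + by apply: dp; rewrite ts (ltW slt).
  rewrite le_eqVlt eq_sym (negbTE sm) /= => slt.
  rewrite /concat [s <= m]leNgt slt /=.
  apply: (is_tderive_near_eq (dl := s - m) (B := [set r | m <= r <= tf]) (f := fun r => p' r x)).
  + by rewrite subr_gt0.
  + by rewrite /= ts stf.
  + move=> r /= /andP[tr rtf]; rewrite ltr_norml => /andP[+ _]; rewrite opprB ltrD2r => rm.
    by rewrite rtf (ltW rm) leNgt rm.
  + by apply: dp'; rewrite stf (ltW slt).
Qed.

Lemma integral_concat (t m tf : R) (f g : R -> R) : t <= m <= tf -> continuous f -> continuous g ->
  (\int[lebesgue_measure]_(s in `[t, tf]) (concat m f g s)%:E)%E = (Int t m f + Int m tf g)%:E.
Proof.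
move=> /andP[tm mtf] cf cg.
have I1 (s : R) : s \in `[t, m]%classic -> f s = concat m f g s.
  by rewrite inE /= in_itv /concat /= => /andP[_ ->].
have I2 (s : R) : s \in `]m, tf]%classic -> g s = concat m f g s.
  by rewrite inE /= in_itv /concat /= [s <= m]leNgt => /andP[-> _].
have m1 : measurable_fun `[t, m] (concat m f g).
  apply: (eq_measurable_fun f) => //.
  by apply: (measurable_funS measurableT) => //; exact: continuous_measurable_fun.
have m2 : measurable_fun `]m, tf] (concat m f g).
  apply: (eq_measurable_fun g) => //.
  by apply: (measurable_funS measurableT) => //; exact: continuous_measurable_fun.
(* The second interval is open at [m], because [concat] takes the value of its first function
   there. *)
have -> : `[t, tf]%classic = `[t, m]%classic `|` `]m, tf]%classic.
  by rewrite -itv_bndbnd_setU// bnd_simp.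
rewrite integral_setU_EFin//=.
- rewrite EFinD; congr (_ + _)%E.
    by rewrite -EFin_Int//; apply: eq_integral => s /I1 <-.
  rewrite -EFin_Int// -integral_itv_obnd_cbnd.
    by apply: eq_integral => s /I2 <-.
  apply/measurable_EFinP; apply: (measurable_funS measurableT) => //.
  exact: continuous_measurable_fun.
- by apply/measurable_funU.
- apply/disj_setPLR => s /=; rewrite !in_itv/= => /andP[_ sm].
  by apply/negP; rewrite negb_and -leNgt sm.
Qed.

Lemma concat_cost t m tf F G p p' al al' : t <= m <= tf -> p m = p' m ->
  continuous (fun s => run_cost F (p s) (al s)) ->
  continuous (fun s => run_cost F (p' s) (al' s)) ->
  cost F G tf t (concat m p p') (concat m al al') =
  (G (p' tf) + (Int t m (fun s => run_cost F (p s) (al s)) +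
                Int m tf (fun s => run_cost F (p' s) (al' s))))%:E.
Proof.
move=> tmt pm c1 c2; have /andP[tm mtf] := tmt.
rewrite EFinD -(integral_concat tmt c1 c2) /cost; congr (_ + _)%E.
  congr ((G _)%:E); rewrite /concat; case: ifP => // tfm.
  by have -> : tf = m by apply/eqP; rewrite eq_le tfm.
by apply: eq_integral => s _; rewrite /concat; case: ifP.
Qed.

End control.

(** * Value function and the principle of optimality *)

Section value_function.
Context {R : realType} {d : nat}.
Context (Q : set (field R d)) (hQ : state_space Q).
Context (T : field R d -> vfield R d).
Context (Tadj : vfield R d -> field R d).
Context (D tf : R) (F G : field R d -> R) (dF dG : field R d -> field R d).
Context (hF : C1_functional Q F dF).
Context (hopt : forall q t, Q q -> t <= tf -> exists qs phis : R -> field R d,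
  optimal_solution Q T Tadj D F G dF dG tf q t qs phis).

Notation V q t := (fine (value Q T D F G tf q t)).
Notation piece := (piece Q T D).
Notation L q phi := (fun s => run_cost F (q s) (grad (phi s))).

(** An optimal solution frozen outside [[t, tf]]. The equation of [phi] then holds at every [s],
    being the one at the clamped time, whereas [dphi] is the time derivative on [[t, tf]] only. *)
Definition optimal_data (t : R) (q phi dphi : R -> field R d) :=
  [/\ piece t tf q (fun s => grad (phi s)), cfam phi,
      continuous (fun z : R * 'rV[R]_d => dphi z.1 z.2),
      forall s, t <= s <= tf -> forall x,
        is_tderive [set r | t <= r <= tf] (fun r => phi r x) s (dphi s x)
    & [/\ forall x, phi tf x = - dG (q tf) x,
      forall s x, dphi s x + 2^-1 * dot (grad (phi s)) (grad (phi s)) x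
              + dot (grad (phi s)) (T (q s)) x
              + Tadj (fun i y => grad (phi s) i y * q s y) x
              + D * lapl (phi s) x = dF (q s) x
    & value Q T D F G tf (q t) t = (G (q tf) + Int t tf (L q phi))%:E]].

Lemma c0fam_grad (U : topologicalType) (phi : U -> field R d) i :
  cfam phi -> c0fam (fun u => grad (phi u) i).
Proof. by move=> cphi; exact: (cfam_c0fam (cfam_pd i cphi)). Qed.

Lemma cont_L (q phi : R -> field R d) : cfam q -> (forall s, Q (q s)) -> cfam phi -> continuous (L q phi).
Proof.
move=> cq Qq cphi; apply: (cont_run_cost hQ hF cq Qq) => i; exact: c0fam_grad.
Qed.

Lemma optimal_dataP q0 t qs phis : t <= tf ->
  optimal_solution Q T Tadj D F G dF dG tf q0 t qs phis ->
  exists q phi dphi, [/\ optimal_data t q phi dphi, q t = q0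
    & forall s, t <= s <= tf -> q s = qs s /\ phi s = phis s].
Proof.
move=> ttf [[_ _ Qqs _ _] costE [spq spphi qt phiT [dq [dphi [[dq1 _] [dphi1 dphi2] eq1 eq2]]]]].
pose q s := qs (clamp t tf s); pose phi s := phis (clamp t tf s).
pose dph s := dphi (clamp t tf s).
have cq : cfam q by exact: smooth_path_clamp.
have cphi : cfam phi by exact: smooth_path_clamp.
have Qq s : Q (q s) by apply: Qqs; exact: clamp_itv.
have E s : t <= s <= tf -> q s = qs s /\ phi s = phis s.
  by move=> st; rewrite /q /phi clamp_id.
have qt0 : q t = q0 by have [-> _] : q t = qs t /\ phi t = phis t; [apply: E; rewrite lexx|].
exists q, phi, dph; split=> //; split=> //.
- split=> //; first by move=> i; exact: c0fam_grad.
  move=> s st x; have [-> ->] := E s st.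
  have -> : transport T D (qs s) (grad (phis s)) x = dq s x.
    by rewrite /transport -(eq1 s st x) addrK.
  apply: (is_tderive_eq (f := fun r => qs r x)) => //; last exact: dq1.
  by move=> r rt; have [->] := E r rt.
- exact: (within_clamp ttf dphi2).
- move=> s st x; rewrite /dph (clamp_id st).
  apply: (is_tderive_eq (f := fun r => phis r x)) => //; last exact: dphi1.
  by move=> r rt; have [_ ->] := E r rt.
- have tt : t <= tf <= tf by rewrite ttf lexx.
  split.
  + by move=> x; have [-> ->] := E tf tt.
  + by move=> s x; exact: (eq2 _ (clamp_itv s ttf) x).
  + rewrite qt0 -costE /cost EFinD -EFin_Int; last exact: cont_L.
    have [<- _] := E tf tt; congr (_ + _)%E.
    apply: eq_integral => s; rewrite inE /= in_itv /= => /E [-> ->].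
    by [].
Qed.

(** An optimal pair attains the value, and its running cost is continuous in time, hence has a
    finite integral. *)
Lemma value_fin_num q t : Q q -> t <= tf -> value Q T D F G tf q t \is a fin_num.
Proof.
move=> Qq ttf; have [qs [phis /(optimal_dataP ttf)]] := hopt Qq ttf.
by move=> [q' [phi [dphi [[_ _ _ _ [_ _ +]] <- _]]]] => ->.
Qed.

Lemma value_final q : Q q -> value Q T D F G tf q tf = (G q)%:E.
Proof.
move=> Qq; have [qs [phis /(optimal_dataP (lexx tf))]] := hopt Qq (lexx tf).
by move=> [q' [phi [dphi [[_ _ _ _ [_ _ +]] <- _]]]] => ->; rewrite Int_nn addr0.
Qed.

Lemma value_le_pieces (t m : R) p p' al al' : t <= m <= tf -> p m = p' m ->
  piece t m p al -> piece m tf p' al' ->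
  V (p t) t <= G (p' tf) + (Int t m (fun s => run_cost F (p s) (al s)) +
                Int m tf (fun s => run_cost F (p' s) (al' s))).
Proof.
move=> tmt pm P1 P2; have /andP[tm mtf] := tmt.
have [cp Qp cal _] := P1; have [cp' Qp' cal' _] := P2.
rewrite -lee_fin fineK; last by apply: value_fin_num => //; exact: le_trans mtf.
apply: ereal_inf_lbound => /=; exists (concat m p p'), (concat m al al').
split; first exact: piece_admissible.
by rewrite concat_cost//; exact: (cont_run_cost hQ hF).
Qed.

(** Dynamic programming inequality: the piece is continued by an optimal path from [p m]. As the
    infimum is attained, no approximation is involved. *)
Lemma value_le_piece (t m : R) p al : t <= m <= tf -> piece t m p al ->
  V (p t) t <= Int t m (fun s => run_cost F (p s) (al s)) + V (p m) m.
Proof.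
move=> tmt P1; have /andP[tm mtf] := tmt; have [_ Qp _ _] := P1.
have [qs [phis /(optimal_dataP mtf)]] := hopt (Qp m) mtf.
move=> [q' [phi [dphi [[P2 _ _ _ [_ _ E]] qm _]]]].
have := value_le_pieces tmt (esym qm) P1 P2.
by rewrite -qm E /= addrCA.
Qed.

(** The tail of an optimal path is optimal. *)
Lemma value_optimal_tail (t : R) q phi dphi (s : R) : t <= s <= tf -> optimal_data t q phi dphi ->
  V (q s) s = Int s tf (L q phi) + G (q tf).
Proof.
move=> /andP[ts stf] [P1 cphi _ _ [_ _ E]]; have [cq Qq _ _] := P1.
have cL := cont_L cq Qq cphi.
apply/eqP; rewrite eq_le; apply/andP; split.
  (* Upper bound: the tail itself is a competitor, glued to the degenerate piece over [[s, s]]. *)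
  have P2 : piece s tf q (fun s => grad (phi s)) by exact: piece_sub P1.
  have P0 : piece s s q (fun s => grad (phi s)) by exact: piece_sub P1.
  have := value_le_pieces (t := s) (m := s) _ erefl P0 P2.
  by rewrite lexx stf Int_nn add0r addrC; apply.
(* Lower bound: a cheaper continuation at [s] would lower the optimal cost from [t]. *)
have P0 : piece t s q (fun s => grad (phi s)) by exact: piece_sub P1.
have := value_le_piece (m := s) _ P0; rewrite ts stf => /(_ isT).
rewrite E /= (Int_cat cL ts stf); lra.
Qed.

Lemma value_optimal_step (t : R) q phi dphi (s m : R) : t <= s -> s <= m -> m <= tf ->
  optimal_data t q phi dphi -> V (q s) s = Int s m (L q phi) + V (q m) m.
Proof.
move=> ts sm mtf O; have [[cq Qq _ _] cphi _ _ _] := O.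
rewrite (value_optimal_tail _ O) ?ts ?(le_trans sm)//.
rewrite (value_optimal_tail _ O) ?mtf ?(le_trans ts)//.
by rewrite (Int_cat (cont_L cq Qq cphi) sm mtf) addrA.
Qed.

End value_function.

(** * The first variation of the Hamiltonian *)

Section pointwise.
Context {R : realType} {d : nat}.
Implicit Types (v w z : vfield R d) (f g h q : field R d).

Lemma dotDl v w z x : dot (fun i y => v i y + w i y) z x = dot v z x + dot w z x.
Proof. by rewrite /dot -big_split; apply: eq_bigr => i _; rewrite mulrDl. Qed.

Lemma dotZl (c : R) v w x : dot (fun i y => c * v i y) w x = c * dot v w x.
Proof. by rewrite /dot mulr_sumr; apply: eq_bigr => i _; rewrite mulrA. Qed.

Lemma dotMl f v w x : dot (fun i y => v i y * f y) w x = dot v w x * f x.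
Proof. by rewrite /dot mulr_suml; apply: eq_bigr => i _; rewrite mulrAC. Qed.

Lemma dotDr v w z x : dot v (fun i y => w i y + z i y) x = dot v w x + dot v z x.
Proof. by rewrite dotC dotDl !(dotC _ v). Qed.

Lemma dotZr (c : R) v w x : dot v (fun i y => c * w i y) x = c * dot v w x.
Proof. by rewrite dotC dotZl (dotC w). Qed.

Lemma dotMr f v w x : dot v (fun i y => w i y * f y) x = dot v w x * f x.
Proof. by rewrite dotC dotMl (dotC w). Qed.

Lemma grad_line q h (e : R) : smooth q -> smooth h ->
  grad (fun x => q x + e * h x) = (fun i x => grad q i x + e * grad h i x).
Proof.
move=> sq sh; apply/funext => i.
by rewrite /grad (pdD i sq (smoothZ e sh)) (pdZ e i sh).
Qed.

Lemma velocity_line (T : field R d -> vfield R d) q h (e : R) : velocity_operator T ->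
  smooth q -> smooth h ->
  T (fun x => q x + e * h x) = (fun i x => T q i x + e * T h i x).
Proof.
move=> [_ lT _ _] sq sh; apply/funext => i; apply/funext => x.
rewrite [RHS]addrC -(lT e h q sh sq) ; congr (T _ i x).
by apply/funext => y; rewrite addrC.
Qed.

(** The shape of [H2] along a line of states: a polynomial of degree two in [e], minus the
    contribution of [F]. *)
Lemma is_derive_quadratic (a b c l : R) (f : R -> R) : is_derive (0 : R) (1 : R) f l ->
  is_derive (0 : R) (1 : R) (fun e : R => a + e * b + e * e * c - f e) (b - l).
Proof.
move=> /(is_derive_is_tderive setT) df.
have T0 : nbhs (0 : R) [set: R] by have /= := @filterT _ _ (nbhs_filter (0 : R)).
apply: (is_tderive_is_derive T0).
have q0 : is_tderive setT (fun e : R => e * e * c) 0 0.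
  apply/is_tderiveP => e e0; exists (e / (`|c| + 1)).
    by rewrite divr_gt0// ltr_wpDl.
  move=> r _; rewrite !(subr0, mul0r) ltr_pdivlMr ?ltr_wpDl// => re.
  rewrite normrM normrM mulrAC ler_wpM2r// (le_trans _ (ltW re))// ler_wpM2l//.
  by rewrite lerDl.
have h1 : is_tderive setT (fun r => b * r + a) 0 b by exact: is_tderive_affine.
have h2 : is_tderive setT (fun r => -1 * f r) 0 (-1 * l) by exact: is_tderiveZ.
have := is_tderiveD (is_tderiveD h1 q0) h2.
rewrite addr0 mulN1r; apply: is_tderive_eq => // r _.
by rewrite mulN1r [b * r]mulrC [r * b + a]addrC.
Qed.

End pointwise.

Section hamiltonian.
Context {R : realType} {d : nat}.
Context (Q : set (field R d)) (hQ : state_space Q).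
Context (T : field R d -> vfield R d) (hT : velocity_operator T).
Context (Tadj : vfield R d -> field R d) (hTadj : adjoint_operator T Tadj).
Context (D : R) (F : field R d -> R) (dF : field R d -> field R d).
Context (hF : C1_functional Q F dF).

Lemma vsmoothM (v : vfield R d) f : vsmooth v -> smooth f -> vsmooth (fun i y => v i y * f y).
Proof. by move=> sv sf i; exact: (smoothM (sv i) sf). Qed.

Lemma velocity_vsmooth q : smooth q -> vsmooth (T q).
Proof. by case: hT => H _ _ _; exact: H. Qed.

(** The adjoint takes [T] off [h], and integration by parts takes the gradient off [h]; this
    exhibits the density of the first variation. *)
Lemma tint_adjoint q phi h : smooth q -> smooth phi -> smooth h ->
  tint (fun x => dot (grad phi) (T h) x * q x - D * dot (grad phi) (grad h) x) =
  tint (fun x => (Tadj (fun i y => grad phi i y * q y) x + D * lapl phi x) * h x).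
Proof.
move=> sq sp sh.
have sg := smooth_grad sp; have sTh := velocity_vsmooth sh.
have sgq := vsmoothM sg sq.
have [sTa adj] := hTadj sgq.
have s1 : smooth (fun x => dot (grad phi) (T h) x * q x).
  exact: (smoothM (smooth_dot sg sTh) sq).
have s2 : smooth (fun x => D * dot (grad phi) (grad h) x).
  exact: (smoothZ D (smooth_dot sg (smooth_grad sh))).
have s3 : smooth (fun x => Tadj (fun i y => grad phi i y * q y) x * h x).
  exact: (smoothM sTa sh).
have s4 : smooth (fun x => diverg (grad phi) x * h x).
  exact: (smoothM (smooth_diverg sg) sh).
rewrite (tintB (smooth_continuous s1) (smooth_continuous s2)).
rewrite (tintZ D (smooth_continuous (smooth_dot sg (smooth_grad sh)))).
rewrite (tint_dot_grad sg sh) mulrN opprK -(tintZ D (smooth_continuous s4)).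
have -> : (fun x => dot (grad phi) (T h) x * q x) = dot (fun i y => grad phi i y * q y) (T h).
  by apply/funext => x; rewrite dotMl.
rewrite (adj _ sh) -(tintD (smooth_continuous s3)); last first.
  exact: (smooth_continuous (smoothZ D s4)).
by congr tint; apply/funext => x; rewrite /lapl; ring.
Qed.

(** Apart from [F], the Hamiltonian is quadratic in the state because [T] is linear. The density of
    its linear part is [- dphi] by the equation of [phi]. *)
Lemma H2_first_variation q phi dphi : Q q -> smooth phi ->
  (forall x, dphi x + 2^-1 * dot (grad phi) (grad phi) x + dot (grad phi) (T q) x
    + Tadj (fun i y => grad phi i y * q y) x + D * lapl phi x = dF q x) ->
  first_variation (fun p => H2 T D F p phi) q (fun x => - dphi x).
Proof.
move=> Qq sp eqn; have sq := state_smooth hQ Qq.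
have [pF cF dFq] := hF.1 _ Qq.
have sg := smooth_grad sp; have sTq := velocity_vsmooth sq.
have [sTa _] := hTadj (vsmoothM sg sq).
pose K : field R d := fun x => 2^-1 * dot (grad phi) (grad phi) x + dot (grad phi) (T q) x.
pose S : field R d := fun x => K x
  + (Tadj (fun i y => grad phi i y * q y) x + D * lapl phi x).
have sK : smooth K.
  exact: (smoothD (smoothZ 2^-1 (smooth_dot sg sg)) (smooth_dot sg sTq)).
have sTD : smooth (fun x => Tadj (fun i y => grad phi i y * q y) x + D * lapl phi x).
  exact: (smoothD sTa (smoothZ D (smooth_lapl sp))).
have sS : smooth S by exact: (smoothD sK sTD).
have E : (fun x => - dphi x) = (fun x => S x - dF q x).
  by apply/funext => x; rewrite -eqn /S /K; ring.
rewrite E; split.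
- by move=> i x; rewrite (smooth_periodic sS) pF.
- exact: (contB (smooth_continuous sS) cF).
move=> h sh.
have sTh := velocity_vsmooth sh; have sgh := smooth_grad sh; have sgq := smooth_grad sq.
pose A : field R d := fun x => K x * q x - D * dot (grad phi) (grad q) x.
(* [A], [B] and [C] are the integrands of order 0, 1 and 2 in [e]; the second order comes from [T h]
   multiplied by [h]. *)
pose B : field R d := fun x => K x * h x
  + (dot (grad phi) (T h) x * q x - D * dot (grad phi) (grad h) x).
pose C : field R d := fun x => dot (grad phi) (T h) x * h x.
have sA : smooth A by exact: (smoothB (smoothM sK sq) (smoothZ D (smooth_dot sg sgq))).
have sB2 : smooth (fun x => dot (grad phi) (T h) x * q x - D * dot (grad phi) (grad h) x).
  exact: (smoothB (smoothM (smooth_dot sg sTh) sq) (smoothZ D (smooth_dot sg sgh))).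
have sB : smooth B by exact: (smoothD (smoothM sK sh) sB2).
have sC : smooth C by exact: (smoothM (smooth_dot sg sTh) sh).
have -> : (fun e => H2 T D F (fun x => q x + e * h x) phi) =
    (fun e => tint A + e * tint B + e * e * tint C - F (fun x => q x + e * h x)).
  apply/funext => e; rewrite /H2; congr (_ - _).
  rewrite -(tintZ e (smooth_continuous sB)) -(tintZ (e * e) (smooth_continuous sC)).
  rewrite -(tintD (smooth_continuous sA) (smooth_continuous (smoothZ e sB))).
  rewrite -(tintD (smooth_continuous (smoothD sA (smoothZ e sB)))
                  (smooth_continuous (smoothZ (e * e) sC))).
  congr tint; apply/funext => x.
  rewrite (grad_line e sq sh) (velocity_line e hT sq sh) !dotDr !dotZr /A /B /C /K; ring.
have -> : tint (fun x => (S x - dF q x) * h x) = tint B - tint (fun x => dF q x * h x).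
  have sSh : smooth (fun x => S x * h x) by exact: (smoothM sS sh).
  rewrite (_ : (fun x => (S x - _) * _) = (fun x => S x * h x - dF q x * h x)); last first.
    by apply/funext => x; rewrite mulrBl.
  rewrite (tintB (smooth_continuous sSh) (contM cF (smooth_continuous sh))); congr (_ - _).
  rewrite (tintD (smooth_continuous (smoothM sK sh)) (smooth_continuous sB2)).
  rewrite (tint_adjoint sq sp sh).
  rewrite -(tintD (smooth_continuous (smoothM sK sh)) (smooth_continuous (smoothM sTD sh))).
  by congr tint; apply/funext => x; rewrite /S mulrDl.
exact: (is_derive_quadratic _ _ _ (dFq h sh)).
Qed.

End hamiltonian.

(** * Positivity of the states *)

Section positivity.
Context {R : realType} {d : nat}.

Lemma lapl_line (q h : field R d) (k : R) x : smooth q -> smooth h ->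
  lapl (fun y => q y + k * h y) x = lapl q x + k * lapl h x.
Proof.
move=> sq sh; rewrite /lapl (grad_line k sq sh).
have sgh := smooth_grad sh.
have skg : vsmooth (fun i y => k * grad h i y) by move=> i; exact: (smoothZ k (sgh i)).
by rewrite (divergD (smooth_grad sq) skg) (divergZ k sgh).
Qed.

(** In the hypothesis the term [D * k * grad h] cancels the diffusion of the perturbation, and
    [- K * w] makes it grow at the rate [K * diverg w]. The ramp uses [h = diverg w]; with [K = 0]
    the perturbation stays constant in time. *)
Lemma flux_line (D k K : R) (q h : field R d) (v V w : vfield R d) x :
  smooth q -> smooth h -> vsmooth v -> vsmooth w ->
  (forall i y, V i y * (q y + k * h y) = v i y * q y + (D * k * grad h i y - K * w i y)) ->
  D * lapl (fun y => q y + k * h y) x - diverg (fun i y => V i y * (q y + k * h y)) x =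
  D * lapl q x - diverg (fun i y => v i y * q y) x + K * diverg w x.
Proof.
move=> sq sh sv sw HV.
have sgh := smooth_grad sh.
have svq : vsmooth (fun i y => v i y * q y) by exact: vsmoothM.
have sg : vsmooth (fun i y => D * k * grad h i y) by move=> i; exact: (smoothZ _ (sgh i)).
have sKw : vsmooth (fun i y => - K * w i y) by move=> i; exact: (smoothZ _ (sw i)).
rewrite (lapl_line k x sq sh).
have -> : (fun i y => V i y * (q y + k * h y)) =
    (fun i y => v i y * q y + (D * k * grad h i y + - K * w i y)).
  by apply/funext => i; apply/funext => y; rewrite HV mulNr.
have sgw : vsmooth (fun i y => D * k * grad h i y + - K * w i y).
  by move=> i; exact: (smoothD (sg i) (sKw i)).
have E1 := congr1 (fun f => f x) (divergD svq sgw).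
have E2 := congr1 (fun f => f x) (divergD sg sKw).
have E3 := congr1 (fun f => f x) (divergZ (D * k) sgh).
have E4 := congr1 (fun f => f x) (divergZ (- K) sw).
apply: (etrans (congr1 (fun z => D * (lapl q x + k * lapl h x) - z) E1)).
apply: (etrans (congr1 (fun z => D * (lapl q x + k * lapl h x) - (diverg _ x + z)) E2)).
apply: (etrans (congr1 (fun z => D * (lapl q x + k * lapl h x) - (diverg _ x + (z + _))) E3)).
apply: (etrans (congr1 (fun z => D * (lapl q x + k * lapl h x) - (diverg _ x + (_ + z))) E4)).
rewrite /lapl; generalize (diverg (grad q) x) (diverg (grad h) x) (diverg w x).
by generalize (diverg (fun i y => v i y * q y) x) => A B1 B2 B3; ring.
Qed.

Lemma pd_flat n (u : field R d) i : smooth u ->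
  pd i (fun x => flat n (u x)) =
  (fun x => (flat n.+2 (u x) + - n%:R * flat n.+1 (u x)) * pd i u x).
Proof. by move=> su; exact: (has_pdE (has_pd_flat n (has_pd_smooth i su))). Qed.

(** Flatness makes these derivatives vanish at the edge [u x = 0] as well, so that no point lies
    outside both cases of [ramp_flux]. *)
Lemma flat_support (u : field R d) i0 x : smooth u -> u x <= 0 ->
  [/\ flat 0 (u x) = 0, pd i0 (fun y => flat 0 (u y)) x = 0
    & forall j, pd j (pd i0 (fun y => flat 0 (u y))) x = 0].
Proof.
move=> su ux; have s2 n := smooth_flat n su; split.
- exact: flat0.
- by rewrite (pd_flat 0 i0 su) !flat0// mulr0 addr0 mul0r.
- move=> j; rewrite (pd_flat 0 i0 su).
  have -> : (fun y => (flat 2 (u y) + - 0%:R * flat 1 (u y)) * pd i0 u y) =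
      (fun y => flat 2 (u y) * pd i0 u y).
    by apply/funext => y; rewrite oppr0 mul0r addr0.
  rewrite (pdM j (s2 2%N) (smooth_pd i0 su)) (pd_flat 2 j su).
  by rewrite !flat0// mulr0 addr0 !mul0r addr0.
Qed.

(** The ramp direction has to be the divergence of a flux with prescribed support; the flux [b] in
    one coordinate direction gives [pd i0 b]. Such a direction exists as soon as [d] is positive. *)
Definition unit_field (i0 : 'I_d) (b : field R d) : vfield R d :=
  fun i y => (i == i0)%:R * b y.

Lemma unit_field_smooth i0 b : smooth b -> vsmooth (unit_field i0 b).
Proof. by move=> sb i; exact: (smoothZ _ sb). Qed.

Lemma diverg_unit_field i0 b : smooth b -> diverg (unit_field i0 b) = pd i0 b.
Proof.
move=> sb; apply/funext => x; rewrite /diverg (bigD1 i0)//= big1.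
  by rewrite (pdZ _ i0 sb) eqxx mul1r addr0.
by move=> i /negbTE ii0; rewrite (pdZ _ i sb) ii0 mul0r.
Qed.

Lemma dot_unit_field i0 b (v : vfield R d) x : dot v (unit_field i0 b) x = v i0 x * b x.
Proof.
rewrite /dot (bigD1 i0)//= big1 /unit_field ?eqxx ?mul1r ?addr0//.
by move=> i /negbTE ->; rewrite mul0r mulr0.
Qed.

End positivity.

(* [damp c q0] is [1 / q0] on the support of [bump c q0], where [q0 <= - c], and is
   smooth everywhere. *)
Definition bump (R : realType) (d : nat) (c : R) (q0 : field R d) : field R d :=
  fun x => flat 0 (- c - q0 x).

Definition damp (R : realType) (d : nat) (c : R) (q0 : field R d) : field R d :=
  fun x => q0 x * (q0 x * q0 x + flat 0 (q0 x + c))^-1.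

Section positivity_of_states.
Context {R : realType} {d : nat}.
Context (Q : set (field R d)) (hQ : state_space Q).
Context (T : field R d -> vfield R d) (hT : velocity_operator T).
Context (Tadj : vfield R d -> field R d).
Context (D tf : R) (F G : field R d -> R) (dF dG : field R d -> field R d).
Context (hF : C1_functional Q F dF).
Context (hopt : forall q t, Q q -> t <= tf -> exists qs phis : R -> field R d,
  optimal_solution Q T Tadj D F G dF dG tf q t qs phis).

Notation V q t := (fine (value Q T D F G tf q t)).
Notation L q phi := (fun s => run_cost F (q s) (grad (phi s))).

(* The ramp [q s + K (s - t - eta) g], with [g := pd i0 (bump c q0)], leads from
   [q0 - K eta g] to [q (t + eta)]. Its cost exceeds that of [q] by [eta] times a
   quadratic polynomial in [K], whose leading coefficient is negative if [q0] is
   below [- c] somewhere, whereas the value at time [t] changes by [O(K eta)] only. *)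
Section ramp.
Context (q0 : field R d) (i0 : 'I_d) (c K t : R).
Context (Qq0 : Q q0) (c0 : 0 < c).
Context (q phi dphi : R -> field R d).
Context (hO : optimal_data Q T Tadj D tf F G dF dG t q phi dphi) (hq : q t = q0).
Context (dl : R) (dl0 : 0 < dl).
Context (hdl : forall s k, `|s - t| <= dl -> `|k| <= dl ->
  Q (fun x => q s x + k * pd i0 (bump c q0) x) /\
  forall x, `|q s x + k * pd i0 (bump c q0) x - q0 x| <= c / 2).

Let b := bump c q0.
Let zeta x := flat 0 (q0 x + c).
Let g := pd i0 b.
Let w := unit_field i0 b.
Let qc (u : R * R) := q (clamp t (t + dl) u.1).
Let kc (u : R * R) := clamp (- dl) dl u.2.
Let P (u : R * R) : field R d := fun x => qc u x + kc u * g x.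
Let vc (u : R * R) : vfield R d :=
  fun i x => T (qc u) i x + grad (phi (clamp t (t + dl) u.1)) i x.
(* [zeta] vanishes on the support of [b] and is positive elsewhere, so that [om] is
   smooth and equals [1 / P] on that support. *)
Let om (u : R * R) : field R d := fun x => P u x * (P u x * P u x + zeta x)^-1.
Let W (u : R * R) : vfield R d := fun i x =>
  vc u i x + (D * kc u * grad g i x + (- K * w i x + - kc u * (g x * vc u i x))) * om u x.

Lemma ramp_smooth : [/\ smooth q0, smooth b, smooth zeta & smooth g].
Proof.
have sq0 := state_smooth hQ Qq0.
have sb : smooth b by exact: (smooth_flat 0 (smoothB (smooth_cst (- c)) sq0)).
split; [exact: sq0|exact: sb| |exact: (smooth_pd i0 sb)].
exact: (smooth_flat 0 (smoothD sq0 (smooth_cst c))).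
Qed.

Lemma ramp_itv u : [/\ `|clamp t (t + dl) u.1 - t| <= dl & `|kc u| <= dl].
Proof.
have tt : t <= t + dl by rewrite lerDl ltW.
have /andP[h1 h2] := clamp_itv u.1 tt.
split; first by rewrite ger0_norm ?subr_ge0// lerBlDl.
have dd : - dl <= dl by rewrite -subr_ge0 opprK addr_ge0// ltW.
by rewrite ler_norml; exact: clamp_itv.
Qed.

Lemma ramp_state u : Q (P u) /\ forall x, `|P u x - q0 x| <= c / 2.
Proof. by have [h1 h2] := ramp_itv u; exact: hdl. Qed.

(** The margin [c / 2] in [hdl] keeps the ramp away from zero where [q0 <= - c], so the flux can be
    divided by it there. *)
Lemma ramp_neg u x : q0 x <= - c -> P u x < 0.
Proof.
move=> qx; have [_ /(_ x)] := ramp_state u; rewrite ler_norml => /andP[_ h].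
by have := c0; lra.
Qed.

Lemma ramp_den u x : P u x * P u x + zeta x != 0.
Proof.
rewrite gt_eqF//; have [qx|qx] := leP (q0 x) (- c).
  rewrite ltr_pwDl//; last first.
    by rewrite /zeta /flat; case: ifP => // z0; rewrite mulr_ge0 ?expR_ge0// invr_ge0 exprn_ge0// ltW.
  by rewrite -expr2 lt_def sqr_ge0 sqrf_eq0 lt_eqF// ramp_neg.
rewrite ltr_wpDl// -?expr2 ?sqr_ge0// /zeta flat_gt0//.
by move: qx; rewrite -subr_gt0 opprK.
Qed.

Lemma cont_kc : continuous kc.
Proof.
apply: (cont_comp (f := fun u : R * R => u.2) (g := clamp (- dl) dl)); first exact: cont_snd.
exact: cont_clamp.
Qed.

Lemma cont_sc : continuous (fun u : R * R => clamp t (t + dl) u.1).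
Proof.
apply: (cont_comp (f := fun u : R * R => u.1) (g := clamp t (t + dl))); first exact: cont_fst.
exact: cont_clamp.
Qed.

Lemma ramp_cfam_qc : cfam qc.
Proof. by have [[cq _ _ _] _ _ _ _] := hO; exact: (cfam_comp cont_sc cq). Qed.

Lemma ramp_cfam : cfam P.
Proof.
have [_ _ _ sg] := ramp_smooth.
exact: (cfamD ramp_cfam_qc (cfamZ cont_kc (cfam_cst _ sg))).
Qed.

Lemma ramp_c0fam_vc i : c0fam (fun u => vc u i).
Proof.
have [_ cphi _ _ _] := hO.
exact: (c0famD (velocity_c0fam i hT ramp_cfam_qc) (c0fam_grad i (cfam_comp cont_sc cphi))).
Qed.

Lemma ramp_c0fam i : c0fam (fun u => W u i).
Proof.
have [_ sb sz sg] := ramp_smooth.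
have cv := ramp_c0fam_vc i; have cP := cfam_c0fam ramp_cfam.
have cf (f : field R d) : smooth f -> c0fam (fun _ : R * R => f).
  by move=> sf; exact: (cfam_c0fam (cfam_cst _ sf)).
have cden : c0fam (fun u x => P u x * P u x + zeta x).
  exact (c0famD (c0famM cP cP) (cf zeta sz)).
have com : c0fam om by exact (c0famM cP (c0famV ramp_den cden)).
have ck : c0fam (fun u (_ : 'rV[R]_d) => D * kc u).
  by apply: c0fam_cst; apply: contM; [exact: cont_cst|exact: cont_kc].
have ck2 : c0fam (fun u (_ : 'rV[R]_d) => - kc u).
  by apply: c0fam_cst; apply: contN; exact: cont_kc.
have cK : c0fam (fun (u : R * R) (_ : 'rV[R]_d) => - K).
  by apply: c0fam_cst; exact: cont_cst.
have c1 := c0famM ck (cf _ (smooth_grad sg i)).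
have c2 := c0famM cK (cf _ (unit_field_smooth i0 sb i)).
have c3 := c0famM ck2 (c0famM (cf _ sg) cv).
exact: (c0famD cv (c0famM (c0famD c1 (c0famD c2 c3)) com)).
Qed.

(** The identity required by [flux_line]. Where [q0 <= - c] one has [om * P = 1], and the term
    [- k g v] in [W] compensates for [v P = v q + k g v]. Elsewhere [b] and its first two
    derivatives vanish, and both sides are [v q]. *)
Lemma ramp_flux u i y : W u i y * P u y =
  vc u i y * qc u y + (D * kc u * grad g i y - K * w i y).
Proof.
have [qy|qy] := leP (q0 y) (- c).
  have p0 : P u y != 0 by rewrite lt_eqF// ramp_neg.
  have z0 : zeta y = 0 by rewrite /zeta flat0//; move: qy; rewrite -subr_le0 opprK.
  have -> : W u i y * P u y = vc u i y * P u y +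
     (D * kc u * grad g i y + (- K * w i y + - kc u * (g y * vc u i y))) * (om u y * P u y).
    by rewrite /W; ring.
  have -> : om u y * P u y = 1 by rewrite /om z0 addr0; field.
  by rewrite /P; ring.
have [sq0 sb _ _] := ramp_smooth.
have uy : - c - q0 y <= 0 by move: qy (c0); lra.
have [b0 g0 gg0] := flat_support i0 (smoothB (smooth_cst (- c)) sq0) uy.
have w0 : w i y = 0 by rewrite /w /unit_field /b /bump b0 mulr0.
have gy : g y = 0 by [].
have ggy : grad g i y = 0 by exact: gg0.
by rewrite /W /P w0 gy ggy !(mulr0, mul0r, addr0, subr0).
Qed.

Definition ramp_cost (u : R * R) : R := run_cost F (P u) (fun i x => W u i x - T (P u) i x).

Lemma cont_ramp_cost : continuous ramp_cost.
Proof.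
apply: (cont_run_cost hQ hF ramp_cfam).
  by move=> u; have [] := ramp_state u.
move=> i; exact: (c0famD (ramp_c0fam i) (c0famN (velocity_c0fam i hT ramp_cfam))).
Qed.

(** At amplitude 0 the control is [grad phi - K w / q0] on the support of [b], so the coefficient of
    [K ^ 2] is half the integral of [b ^ 2 / q0]. *)
Lemma ramp_cost0 : ramp_cost (t, 0) = L q phi t
  - K * tint (fun x => grad (phi t) i0 x * b x * damp c q0 x * q0 x)
  + K * K * (2^-1 * tint (fun x => b x * b x * (damp c q0 x * damp c q0 x) * q0 x)).
Proof.
have [sq0 sb sz sg] := ramp_smooth.
have tt : t <= t + dl by rewrite lerDl ltW.
have k0 : kc (t, 0) = 0.
  by rewrite /kc /= clamp_id// oppr_le0 (ltW dl0).
have qc0 : qc (t, 0) = q0 by rewrite /qc clamp_id ?lexx ?tt// hq.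
have P0 : P (t, 0) = q0.
  by apply/funext => x; rewrite /P k0 qc0 mul0r addr0.
have om0 : om (t, 0) = damp c q0 by rewrite /om P0.
have som : smooth (damp c q0).
  apply: (smoothM sq0); apply: smoothV.
    by move=> x; have := ramp_den (t, 0) x; rewrite P0.
  exact: (smoothD (smoothM sq0 sq0) sz).
have sphi : smooth (phi t) by have [_ cphi _ _ _] := hO; exact: (cfam_smooth t cphi).
have sg0 := smooth_grad sphi i0.
have s1 : smooth (fun x => grad (phi t) i0 x * b x * damp c q0 x * q0 x).
  exact: (smoothM (smoothM (smoothM sg0 sb) som) sq0).
have s2 : smooth (fun x => b x * b x * (damp c q0 x * damp c q0 x) * q0 x).
  exact: (smoothM (smoothM (smoothM sb sb) (smoothM som som)) sq0).
have s0 : smooth (fun x => 2^-1 * dot (grad (phi t)) (grad (phi t)) x * q0 x).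
  exact: (smoothM (smoothZ _ (smooth_dot (smooth_grad sphi) (smooth_grad sphi))) sq0).
have -> : ramp_cost (t, 0) = run_cost F q0
    (fun i x => grad (phi t) i x + (- K) * (w i x * damp c q0 x)).
  rewrite /ramp_cost P0; congr run_cost; apply/funext => i; apply/funext => x.
  rewrite /W k0 /vc qc0 om0 /= clamp_id ?lexx ?tt//; ring.
rewrite /run_cost hq.
have -> : (fun x => 2^-1 * dot (fun i y => grad (phi t) i y + - K * (w i y * damp c q0 y))
      (fun i y => grad (phi t) i y + - K * (w i y * damp c q0 y)) x * q0 x) =
    (fun x => 2^-1 * dot (grad (phi t)) (grad (phi t)) x * q0 x
       + (- K * (grad (phi t) i0 x * b x * damp c q0 x * q0 x)
       + K * K * 2^-1 * (b x * b x * (damp c q0 x * damp c q0 x) * q0 x))).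
  apply/funext => x.
  have Ew v y : dot v w y = v i0 y * b y by exact: dot_unit_field.
  rewrite dotDl !dotDr !dotZl !dotZr !(dotMl (damp c q0)) !(dotMr (damp c q0)) (dotC w (grad (phi t))) !Ew.
  have -> : w i0 x = b x by rewrite /w /unit_field eqxx mul1r.
  by generalize (dot (grad (phi t)) (grad (phi t)) x) (grad (phi t) i0 x) (b x) (damp c q0 x) (q0 x)
     => X1 X2 X3 X4 X5; field.
have sK1 := smoothZ (- K) s1; have sK2 := smoothZ (K * K * 2^-1) s2.
rewrite (tintD (smooth_continuous s0) (smooth_continuous (smoothD sK1 sK2))).
rewrite (tintD (smooth_continuous sK1) (smooth_continuous sK2)).
rewrite (tintZ _ (smooth_continuous s1)) (tintZ _ (smooth_continuous s2)).
by generalize (tint (fun x => grad (phi t) i0 x * b x * damp c q0 x * q0 x)) => X; ring.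
Qed.

(** The amplitude rises from [- K * eta] to 0 with slope [K]. The bounds by [dl] keep both clamps
    inactive during the ramp. *)
Lemma ramp_piece eta : 0 < eta -> eta <= dl -> 0 <= K -> K * eta <= dl -> t + eta <= tf ->
  piece Q T D t (t + eta) (fun s => P (s, K * (s - t - eta)))
    (fun s i x => W (s, K * (s - t - eta)) i x - T (P (s, K * (s - t - eta))) i x).
Proof.
move=> eta0 etadl K0 Kdl etatf.
have [sq0 sb _ sg] := ramp_smooth.
have cs : continuous (fun s : R => (s, K * (s - t - eta))).
  apply: cont_pair; first exact: cont_id.
  apply: contM; first exact: cont_cst.
  by apply: contB; [apply: contB; [exact: cont_id|exact: cont_cst]|exact: cont_cst].
apply: velocity_piece.
- exact: hT.
- exact: (cfam_comp cs ramp_cfam).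
- by move=> s; have [] := ramp_state (s, K * (s - t - eta)).
- by move=> i; exact: (c0fam_comp cs (ramp_c0fam i)).
move=> s /andP[ts se] x.
have E r : t <= r <= t + eta -> qc (r, K * (r - t - eta)) = q r /\
    kc (r, K * (r - t - eta)) = K * (r - t - eta) /\
    clamp t (t + dl) r = r.
  move=> /andP[tr re].
  have cr : clamp t (t + dl) r = r by rewrite clamp_id// tr (le_trans re)// lerD2l.
  rewrite /qc /kc /= cr; split=> //; split=> //; apply: clamp_id.
  have rn : r - t - eta <= 0 by lra.
  apply/andP; split; last by rewrite (le_trans (mulr_ge0_le0 K0 rn))// ltW.
  rewrite lerNl -mulrN (le_trans _ Kdl)// ler_wpM2l//; lra.
have se' : t <= s <= t + eta by rewrite ts se.
have [Eq [Ek Ec]] := E s se'.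
have [[cq Qq cal dp] cphi _ _ _] := hO.
have sqs := cfam_smooth s cq.
have sphi := cfam_smooth s cphi.
have svc : vsmooth (vc (s, K * (s - t - eta))).
  by move=> i; exact: (c0fam_smooth _ (ramp_c0fam_vc i)).
have H := flux_line (D := D) (k := K * (s - t - eta)) (K := K) (q := q s) (h := g)
  (v := vc (s, K * (s - t - eta))) (V := W (s, K * (s - t - eta))) (w := w) x sqs sg svc
  (unit_field_smooth i0 sb).
have EP : P (s, K * (s - t - eta)) = (fun y => q s y + K * (s - t - eta) * g y).
  by apply/funext => y; rewrite /P Eq Ek.
rewrite EP H; last first.
  by move=> i y; have := ramp_flux (s, K * (s - t - eta)) i y; rewrite EP Eq Ek.
rewrite (diverg_unit_field i0 sb) -/g.
apply: (is_tderive_eq (f := fun r => q r x + g x * (K * r + K * (- t - eta)))).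
- by rewrite /= ts se.
- by move=> r /= rt; have [Er [Ekr _]] := E r rt; rewrite /P Er Ekr; ring.
rewrite [K * g x]mulrC; apply: is_tderiveD; last first.
  by apply: is_tderiveZ; exact: is_tderive_affine.
have := dp s _ x; rewrite ts (le_trans se etatf) => /(_ isT) dps.
have -> : D * lapl (q s) x - diverg (fun i y => vc (s, K * (s - t - eta)) i y * q s y) x =
    transport T D (q s) (grad (phi s)) x.
  rewrite /transport; congr (_ - diverg _ x); apply/funext => i; apply/funext => y.
  by rewrite /vc Eq Ec.
by apply: is_tderive_subset dps => r /= /andP[-> re]; rewrite (le_trans re).
Qed.

(** The ramp ends on the optimal path, so the value at [q (t + eta)] cancels between the two
    costs. *)
Lemma ramp_value eta : 0 < eta -> eta <= dl -> 0 <= K -> K * eta <= dl -> t + eta <= tf ->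
  V (fun x => q0 x + - (K * eta) * g x) t - V q0 t <=
  Int t (t + eta) (fun s => ramp_cost (s, K * (s - t - eta)) - L q phi s).
Proof.
move=> eta0 etadl K0 Kdl etatf.
have te : t <= t + eta by rewrite lerDl ltW.
have hP := ramp_piece eta0 etadl K0 Kdl etatf.
have := value_le_piece hQ hF hopt _ hP; rewrite te etatf => /(_ isT).
have [[cq Qq cal dp] cphi _ _ _] := hO.
have := value_optimal_step hQ hF hopt (lexx t) te etatf hO.
have -> : P (t, K * (t - t - eta)) = (fun x => q0 x + - (K * eta) * g x).
  apply/funext => x; rewrite /P /qc /kc /= !clamp_id ?hq.
  - by rewrite subrr sub0r mulrN.
  - rewrite subrr sub0r mulrN lerN2 Kdl /= (le_trans (y := 0)) ?(ltW dl0)// oppr_le0.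
    by rewrite mulr_ge0// ltW.
  - by rewrite lexx lerDl ltW.
have -> : P (t + eta, K * (t + eta - t - eta)) = q (t + eta).
  apply/funext => x; rewrite /P /qc /kc /= !clamp_id.
  - by rewrite (_ : t + eta - t - eta = 0) ?mulr0 ?mul0r ?addr0//; ring.
  - by rewrite (_ : t + eta - t - eta = 0) ?mulr0 ?oppr_le0 ?(ltW dl0)//; ring.
  - by rewrite lerDl (ltW eta0) lerD2l.
rewrite hq => -> H.
have cs : continuous (fun s : R => (s, K * (s - t - eta))).
  apply: cont_pair; first exact: cont_id.
  apply: contM; first exact: cont_cst.
  by apply: contB; [apply: contB; [exact: cont_id|exact: cont_cst]|exact: cont_cst].
have c1 : continuous (fun s : R => ramp_cost (s, K * (s - t - eta))).
  exact: (cont_comp cs cont_ramp_cost).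
rewrite (IntB _ _ c1 (cont_L hQ hF cq Qq cphi)).
by move: H; rewrite -/ramp_cost; lra.
Qed.

End ramp.
End positivity_of_states.

Section positive_states.
Context {R : realType} {d : nat}.
Context (Q : set (field R d)) (hQ : state_space Q).
Context (T : field R d -> vfield R d) (hT : velocity_operator T).
Context (Tadj : vfield R d -> field R d).
Context (D tf : R) (F G : field R d -> R) (dF dG : field R d -> field R d).
Context (hF : C1_functional Q F dF).
Context (hopt : forall q t, Q q -> t <= tf -> exists qs phis : R -> field R d,
  optimal_solution Q T Tadj D F G dF dG tf q t qs phis).

Notation V q t := (fine (value Q T D F G tf q t)).
Notation L q phi := (fun s => run_cost F (q s) (grad (phi s))).

Lemma near_pairP (x y : R) (P : R -> R -> Prop) :
  (\forall z \near (x, y), P z.1 z.2) ->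
  exists2 dl, 0 < dl & forall s k, `|s - x| < dl -> `|k - y| < dl -> P s k.
Proof.
move=> [[A B] /= [/nbhs_ballP[a /= a0 HA] /nbhs_ballP[b /= b0 HB]] sAB].
exists (Num.min a b); first by rewrite lt_min a0.
move=> s k; rewrite !lt_min => /andP[sa _] /andP[_ kb].
by apply: (sAB (s, k)); split => /=; [apply: HA|apply: HB]; rewrite /ball/= distrC.
Qed.

Lemma ramp_room q0 (g : field R d) (q : R -> field R d) (t c : R) : 0 < c ->
  Q q0 -> smooth g -> cfam q -> q t = q0 ->
  exists2 dl, 0 < dl & forall s k, `|s - t| <= dl -> `|k| <= dl ->
    Q (fun x => q s x + k * g x) /\ forall x, `|q s x + k * g x - q0 x| <= c / 2.
Proof.
move=> c0 Qq0 sg cq qt.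
have c1 : cfam (fun u : R * R => fun x => q u.1 x + u.2 * g x).
  apply: cfamD; first by apply: (cfam_comp (c := fst)) => //; exact: cont_fst.
  by apply: cfamZ; [exact: cont_snd|exact: cfam_cst].
have E0 : (fun x => q t x + 0 * g x) = q0.
  by apply/funext => x; rewrite mul0r addr0 qt.
have N1 := state_near hQ (u := (t, 0)) c1; rewrite /= E0 in N1.
have c20 : 0 < c / 2 by rewrite divr_gt0.
have N2 := cfam_near_close (t, 0) 0 c1 c20; rewrite /= E0 in N2.
have N : \forall z \near (t, 0 : R), Q (fun x => q z.1 x + z.2 * g x) /\
   C_k_close 0 (c / 2) (fun x => q z.1 x + z.2 * g x) q0.
  by near=> z; split; near: z; [exact: N1|exact: N2].
have [dl dl0 H] := near_pairP (P := fun s k => Q (fun x => q s x + k * g x) /\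
   C_k_close 0 (c / 2) (fun x => q s x + k * g x) q0) N.
exists (dl / 2); first by rewrite divr_gt0.
have h2 : dl / 2 < dl by rewrite ltr_pdivrMr// ltr_pMr// ltr1n.
move=> s k sd kd; have [||h3 h4] := H s k.
- exact: le_lt_trans h2.
- by rewrite subr0; exact: le_lt_trans h2.
- by split=> // x; exact: (C_k_close0 h4 x).
Unshelve. all: by end_near. Qed.

Lemma bump_damp_neg (c : R) (q0 : field R d) x0 : smooth q0 -> 0 < c -> cube x0 -> q0 x0 < - c ->
  tint (fun x => bump c q0 x * bump c q0 x * (damp c q0 x * damp c q0 x) * q0 x) < 0.
Proof.
move=> sq0 c0 cx qx.
have B0 x : - c <= q0 x -> bump c q0 x = 0.
  by move=> h; rewrite /bump flat0//; lra.
have den x : q0 x * q0 x + flat 0 (q0 x + c) != 0.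
  rewrite gt_eqF//; have [qx'|qx'] := leP (q0 x) (- c).
    rewrite flat0; last by rewrite -lerBrDr sub0r.
    by rewrite addr0 -expr2 lt_def sqr_ge0 sqrf_eq0 lt_eqF// (le_lt_trans qx')// oppr_lt0.
  by rewrite ltr_wpDl -?expr2 ?sqr_ge0// flat_gt0// -ltrBlDr sub0r.
have sb : smooth (bump c q0) by exact: (smooth_flat 0 (smoothB (smooth_cst (- c)) sq0)).
have sd : smooth (damp c q0).
  apply: (smoothM sq0); apply: (smoothV den).
  exact: (smoothD (smoothM sq0 sq0) (smooth_flat 0 (smoothD sq0 (smooth_cst c)))).
have sf : smooth (fun x => bump c q0 x * bump c q0 x * (damp c q0 x * damp c q0 x) * q0 x).
  exact: (smoothM (smoothM (smoothM sb sb) (smoothM sd sd)) sq0).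
rewrite -oppr_gt0 -(tintN (smooth_continuous sf)).
apply: (tint_gt0 (x := x0)) => //.
- exact: (smooth_continuous (smoothN sf)).
- move=> x _; have [h|h] := leP (- c) (q0 x); first by rewrite B0// !mul0r oppr0.
  rewrite -mulrN mulr_ge0 ?oppr_ge0 ?(le_trans (ltW h)) ?oppr_le0 ?(ltW c0)//.
  by rewrite -!expr2 mulr_ge0 ?sqr_ge0.
- have b0 : 0 < bump c q0 x0 by rewrite /bump flat_gt0// subr_gt0.
  have d0 : damp c q0 x0 != 0.
    by rewrite /damp mulf_neq0 ?invr_eq0 ?den// lt_eqF// (lt_trans qx) ?oppr_lt0.
  rewrite -mulrN mulr_gt0 ?oppr_gt0 ?(lt_trans qx) ?oppr_lt0//.
  apply: mulr_gt0; first exact: mulr_gt0.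
  by rewrite -expr2 lt_def sqr_ge0 sqrf_eq0 d0.
Qed.

(** For fixed [K], dividing the comparison by a small [eta] gives [key]. Its left side is linear in
    [K], while its right side contains [K ^ 2 * C / 2] with [C < 0]; a large [K] is
    contradictory. *)
Lemma state_not_neg (i0 : 'I_d) q0 (t : R) gV x0 : Q q0 -> t < tf ->
  first_variation (fun p => V p t) q0 gV -> cube x0 -> q0 x0 < 0 -> False.
Proof.
move=> Qq0 ttf [_ _ dV] cx0 qx0; have sq0 := state_smooth hQ Qq0.
pose c := - q0 x0 / 2.
have c0 : 0 < c by rewrite divr_gt0// oppr_gt0.
have qc : q0 x0 < - c by rewrite /c; lra.
have sb : smooth (bump c q0) by exact: (smooth_flat 0 (smoothB (smooth_cst (- c)) sq0)).
have sg := smooth_pd i0 sb.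
pose g := pd i0 (bump c q0).
have [qs [phis /(optimal_dataP hQ hF (ltW ttf))]] := hopt Qq0 (ltW ttf).
move=> [q [phi [dphi [hO qt _]]]].
have [[cq Qq _ _] cphi _ _ _] := hO.
have [dl dl0 Hdl] := ramp_room c0 Qq0 sg cq qt.
have := bump_damp_neg sq0 c0 cx0 qc; set C := tint _ => C0.
pose B := tint (fun x => grad (phi t) i0 x * bump c q0 x * damp c q0 x * q0 x).
pose A := tint (fun x => gV x * g x).
(* The error [- K] comes from the first variation of [V] over a displacement of size [K * eta], the
   error 1 from the continuity of the running cost. Both tolerances are 1, and [eta] is chosen after
   [K]. *)
have key K : 0 < K -> - K * A - K <= - K * B + K * K * (2^-1 * C) + 1.
  move=> K0.
  have /(is_derive_is_tderive setT) /is_tderiveP /(_ _ ltr01) [d1 d10 Hd1] := dV _ sg.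
  have cRL : continuous (fun u : R * R =>
      ramp_cost T D F q0 i0 c K t q phi dl u - L q phi u.1).
    apply: contB; first exact: (cont_ramp_cost hQ hT hF (K := K) Qq0 c0 hO dl0 Hdl).
    apply: (cont_comp (f := fun u : R * R => u.1) (g := L q phi)); first exact: cont_fst.
    exact: (cont_L hQ hF cq Qq cphi).
  have N : \forall u \near (t, 0 : R),
     ramp_cost T D F q0 i0 c K t q phi dl (u.1, u.2) - L q phi u.1 <=
     ramp_cost T D F q0 i0 c K t q phi dl (t, 0) - L q phi t + 1.
    have /cvgrPdist_lt /(_ _ ltr01) := cRL (t, 0).
    apply: filterS => -[u1 u2] /=; rewrite ltr_norml => /andP[h _]; lra.
  have [d2 d20 Hd2] := near_pairP (P := fun s k =>
     ramp_cost T D F q0 i0 c K t q phi dl (s, k) - L q phi s <=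
     ramp_cost T D F q0 i0 c K t q phi dl (t, 0) - L q phi t + 1) N.
  have [eta [[eta0 h1 h2 h3] [h4 h5 h6]]] : exists eta : R, [/\ 0 < eta, eta <= dl,
      K * eta <= dl & t + eta <= tf] /\ [/\ K * eta < d1, eta < d2 & K * eta < d2].
    pose e := Num.min (Num.min dl (dl / K)) (Num.min (tf - t) (Num.min (d1 / K) (Num.min d2 (d2 / K)))).
    have e0 : 0 < e by rewrite !lt_min dl0 d20 subr_gt0 ttf !divr_gt0.
    have e2 : e / 2 < e by rewrite ltr_pdivrMr// ltr_pMr// ltr1n.
    exists (e / 2).
    have : e / 2 < e by [].
    rewrite {2}/e !lt_min => /andP[/andP[l1 l2] /andP[l3 /andP[l4 /andP[l5 l6]]]].
    rewrite !ltr_pdivlMr// in l2 l4 l6.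
    split; split=> //.
    - by rewrite divr_gt0.
    - exact: ltW.
    - by rewrite mulrC ltW.
    - by rewrite addrC -lerBrDr ltW.
    - by rewrite mulrC.
    - by rewrite mulrC.
  have te : t <= t + eta by rewrite lerDl ltW.
  have RV := ramp_value hQ hT hF hopt (K := K) Qq0 c0 hO qt dl0 Hdl eta0 h1 (ltW K0) h2 h3.
  have cI : continuous (fun s : R => ramp_cost T D F q0 i0 c K t q phi dl (s, K * (s - t - eta)) - L q phi s).
    apply: (cont_comp (f := fun s : R => (s, K * (s - t - eta)))
      (g := fun u : R * R => ramp_cost T D F q0 i0 c K t q phi dl u - L q phi u.1)) => //.
    apply: cont_pair; first exact: cont_id.
    apply: contM; first exact: cont_cst.
    by apply: contB; [apply: contB; [exact: cont_id|exact: cont_cst]|exact: cont_cst].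
  have IB : Int t (t + eta) (fun s => ramp_cost T D F q0 i0 c K t q phi dl (s, K * (s - t - eta)) - L q phi s)
      <= (ramp_cost T D F q0 i0 c K t q phi dl (t, 0) - L q phi t + 1) * (t + eta - t).
    rewrite -(Int_cst _ te); apply: ler_Int => //; first exact: cont_cst.
    move=> s /andP[ts se]; apply: Hd2.
      by rewrite ger0_norm ?subr_ge0//; lra.
    rewrite subr0 normrM gtr0_norm// (le_lt_trans _ h6)// ler_wpM2l ?(ltW K0)//.
    by rewrite ler_norml; apply/andP; split; lra.
  have R0 := ramp_cost0 hQ K Qq0 c0 hO qt dl0 Hdl.
  have := Hd1 (- (K * eta)) I; rewrite subr0 normrN gtr0_norm ?mulr_gt0// => /(_ h4).
  have -> : (fun x => q0 x + 0 * pd i0 (bump c q0) x) = q0.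
    by apply/funext => x; rewrite mul0r addr0.
  rewrite ler_norml => /andP[DL _].
  have := le_trans RV IB; rewrite R0 -/B -/C => H.
  have {}H : (- K * A - K) * eta <= (- K * B + K * K * (2^-1 * C) + 1) * eta.
    move: H DL; rewrite -/g -/A.
    set X := fine _; set Y := fine _; set Z := run_cost _ _ _ => H DL.
    by move: H DL; rewrite (_ : t + eta - t = eta); [lra|ring].
  by rewrite -(ler_pM2r eta0).
(* [K] is taken with [K >= 1] and [X <= K * (- C / 2)]. The summand 2 in [X] then reduces [key] to
   [2 * K <= 1]. *)
pose X := `|A + 1 - B| + 2.
have X2 : 2 <= X by rewrite lerDr.
have C2 : 0 < - C / 2 by rewrite divr_gt0// oppr_gt0.
pose K := 1 + X / (- C / 2).
have K1 : 1 <= K by rewrite lerDl divr_ge0 ?(ltW C2)// (le_trans _ X2).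
have KX : X <= K * (- C / 2).
  by rewrite /K mulrDl divfK ?gt_eqF// lerDr mul1r ltW.
have := key K (lt_le_trans ltr01 K1).
have AB : A + 1 - B <= X - 2 by rewrite /X addrK ler_norm.
have KK : K * X <= K * (K * (- C / 2)) by rewrite ler_wpM2l// (le_trans _ K1).
have KAB : K * (A + 1 - B) <= K * (X - 2) by rewrite ler_wpM2l// (le_trans _ K1).
move: K1 KK KAB; clear; move=> K1 KK KAB H.
have : K * K * (2^-1 * C) = - (K * (K * (- C / 2))) by field.
by move=> E; rewrite E in H; move: (K * (K * (- C / 2))) H KK => Z; lra.
Qed.

End positive_states.

(** * The first variation of the value *)

Section envelope.
Context {R : realType} {d : nat} (hd : (0 < d)%N).
Context (Q : set (field R d)) (hQ : state_space Q).
Context (T : field R d -> vfield R d) (hT : velocity_operator T).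
Context (Tadj : vfield R d -> field R d) (hTadj : adjoint_operator T Tadj).
Context (D tf : R) (F G : field R d -> R) (dF dG : field R d -> field R d).
Context (hF : C1_functional Q F dF).
Context (hopt : forall q t, Q q -> t <= tf -> exists qs phis : R -> field R d,
  optimal_solution Q T Tadj D F G dF dG tf q t qs phis).

Notation V q t := (fine (value Q T D F G tf q t)).
Notation L q phi := (fun s => run_cost F (q s) (grad (phi s))).

Context (dtV : field R d -> R -> R) (dV : field R d -> R -> field R d).
Context (hV : classically_differentiable Q tf (fun q t => V q t) dtV dV).

(** If [q x <= 0], openness of [Q] provides the state [q - e / 2], which is negative at [x]. It is
    refuted at [tf - 1], a time that leaves room for a ramp before [tf]. *)
Lemma state_pos q x : Q q -> 0 < q x.
Proof.
move=> Qq; rewrite ltNge; apply/negP => qx.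
have sq := state_smooth hQ Qq.
have [y cy /(_ _ (smooth_periodic sq)) qy] := periodic_cube x.
have cf : cfam (fun e : R => fun x => q x + e * 1).
  apply: (cfamD (cfam_cst _ sq)); apply: (cfamZ (@cont_id R)).
  exact: (cfam_cst _ (smooth_cst 1)).
have E0 : (fun x => q x + 0 * 1) = q by apply/funext => z; rewrite mul0r addr0.
have := state_near hQ (u := 0) cf; rewrite /= E0 => /(_ Qq) /nbhs_ballP [e /= e0 He].
have Q1 : Q (fun x => q x + (- (e / 2)) * 1).
  apply: He; rewrite /ball /= sub0r opprK gtr0_norm ?divr_gt0//.
  by rewrite ltr_pdivrMr// ltr_pMr// ltr1n.
have tt : tf - 1 < tf by rewrite ltrBlDr ltrDl.
have [_ /(_ _ (ltW tt)) fv _ _] := hV Q1.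
apply: (state_not_neg hQ hT hF hopt (Ordinal hd) Q1 tt fv cy).
by rewrite qy mulr1 -oppr_gt0 opprD opprK ltr_wpDl ?oppr_ge0 ?divr_gt0.
Qed.

Lemma optimal_data_sub t s q phi dphi : t <= s <= tf ->
  optimal_data Q T Tadj D tf F G dF dG t q phi dphi ->
  optimal_data Q T Tadj D tf F G dF dG s q phi dphi.
Proof.
move=> tstf O; have /andP[ts stf] := tstf.
have [[cq Qq cal dp] cphi cdphi dphi1 [phiT eqn _]] := O.
split=> //.
- by apply: (piece_sub ts (lexx tf)); split.
- move=> r /andP[sr rtf] x.
  have := dphi1 r; rewrite (le_trans ts sr) rtf => /(_ isT x).
  by apply: is_tderive_subset => r' /= /andP[h1 h2]; rewrite (le_trans ts h1) h2.
split=> //.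
rewrite -[LHS](fineK (value_fin_num hQ hF hopt (Qq s) stf)).
by rewrite (value_optimal_tail hQ hF hopt tstf O) addrC.
Qed.

(** Compactness in time: estimates valid near each [(s, 0)] hold for a common size of [e]. *)
Lemma near_segment (a b : R) (P : R -> R -> Prop) :
  (forall s, a <= s <= b -> \forall z \near (s, 0 : R), P z.1 z.2) ->
  exists2 dl, 0 < dl & forall s e, a <= s <= b -> `|e| < dl -> P s e.
Proof.
move=> H; have /compact_near_coveringP cK := @segment_compact R a b.
have := cK R (nbhs (0 : R)) (fun e s => P s e).
case=> [s|dl /= dl0 Hd]; first by rewrite /= in_itv /= => /H.
exists dl => // s e sab edl; apply: (Hd e); last by rewrite /= in_itv.
by rewrite /= sub0r normrN.
Qed.

(* The line [q s + e h] has velocity [(v q + D e grad h) / (q + e h)], where [v] is the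
   velocity of [q]; the control changes by [e X] and the kinetic cost by [e tint M]. *)
Section family.
Context (t : R) (ttf : t <= tf) (q phi dphi : R -> field R d) (h : field R d) (dl : R).
Context (hO : optimal_data Q T Tadj D tf F G dF dG t q phi dphi) (sh : smooth h).
Context (dl0 : 0 < dl).
Context (hdl : forall s e, t <= s <= tf -> `|e| <= dl -> Q (fun x => q s x + e * h x)).

Let sc (u : R * R) := clamp t tf u.2.
Let ec (u : R * R) := clamp (- dl) dl u.1.
Let qc u := q (sc u).
Let phic u := phi (sc u).
Let P (u : R * R) : field R d := fun x => qc u x + ec u * h x.
Let vc (u : R * R) : vfield R d := fun i x => T (qc u) i x + grad (phic u) i x.
(** The change of velocity divided by [e], with the quotient carried out, so that it is also defined
    and continuous at [e = 0]. *)
Let Y (u : R * R) : vfield R d := fun i x =>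
  (D * grad h i x + - (h x * vc u i x)) * (P u x)^-1.
Let W (u : R * R) : vfield R d := fun i x => vc u i x + ec u * Y u i x.
Let X (u : R * R) : vfield R d := fun i x => Y u i x + - T h i x.
Let M (u : R * R) : field R d := fun x =>
  2^-1 * dot (grad (phic u)) (grad (phic u)) x * h x
  + (dot (grad (phic u)) (X u) x + 2^-1 * ec u * dot (X u) (X u) x) * P u x.

Lemma family_itv u : t <= sc u <= tf /\ `|ec u| <= dl.
Proof.
split; first exact: clamp_itv.
by rewrite ler_norml; apply: clamp_itv; rewrite -subr_ge0 opprK addr_ge0// ltW.
Qed.

Lemma family_state u : Q (P u).
Proof. by have [h1 h2] := family_itv u; exact: hdl. Qed.

Lemma family_neq0 u x : P u x != 0.
Proof. by rewrite gt_eqF// state_pos//; exact: family_state. Qed.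

Lemma cont_fc : continuous sc.
Proof.
apply: (cont_comp (f := fun u : R * R => u.2) (g := clamp t tf)); first exact: cont_snd.
exact: cont_clamp.
Qed.

Lemma cont_ec : continuous ec.
Proof.
apply: (cont_comp (f := fun u : R * R => u.1) (g := clamp (- dl) dl)); first exact: cont_fst.
exact: cont_clamp.
Qed.

Lemma family_cfam_qc : cfam qc.
Proof. by have [[cq _ _ _] _ _ _ _] := hO; exact: (cfam_comp cont_fc cq). Qed.

Lemma family_cfam_phic : cfam phic.
Proof. by have [_ cphi _ _ _] := hO; exact: (cfam_comp cont_fc cphi). Qed.

Lemma family_cfam : cfam P.
Proof. exact: (cfamD family_cfam_qc (cfamZ cont_ec (cfam_cst _ sh))). Qed.

Lemma family_c0fam_cst (f : field R d) : smooth f -> c0fam (fun _ : R * R => f).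
Proof. by move=> sf; exact: (cfam_c0fam (cfam_cst _ sf)). Qed.

Lemma family_c0fam_Y i : c0fam (fun u => Y u i).
Proof.
have cv : c0fam (fun u => vc u i).
  exact: (c0famD (velocity_c0fam i hT family_cfam_qc) (c0fam_grad i family_cfam_phic)).
have cP := c0famV family_neq0 (cfam_c0fam family_cfam).
have c1 := family_c0fam_cst (smoothZ D (smooth_grad sh i)).
have c2 := c0famN (c0famM (family_c0fam_cst sh) cv).
exact: (c0famM (c0famD c1 c2) cP).
Qed.

Lemma family_c0fam_ec : c0fam (fun u (_ : 'rV[R]_d) => ec u).
Proof. by apply: c0fam_cst; exact: cont_ec. Qed.

Lemma family_c0fam_W i : c0fam (fun u => W u i).
Proof.
have cv : c0fam (fun u => vc u i).
  exact: (c0famD (velocity_c0fam i hT family_cfam_qc) (c0fam_grad i family_cfam_phic)).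
exact: (c0famD cv (c0famM family_c0fam_ec (family_c0fam_Y i))).
Qed.

Lemma family_c0fam_M : c0fam M.
Proof.
have cX i : c0fam (fun u => X u i).
  have sTh : smooth (T h i) by exact: (velocity_vsmooth hT sh).
  exact: (c0famD (family_c0fam_Y i) (family_c0fam_cst (smoothN sTh))).
have cg i : c0fam (fun u => grad (phic u) i) by exact: (c0fam_grad i family_cfam_phic).
have c2 : c0fam (fun (u : R * R) (_ : 'rV[R]_d) => 2^-1 : R).
  by apply: c0fam_cst; exact: cont_cst.
have c1 := c0famM (c0famM c2 (c0fam_dot cg cg)) (family_c0fam_cst sh).
have c3 := c0famM (c0famM c2 family_c0fam_ec) (c0fam_dot cX cX).
exact: (c0famD c1 (c0famM (c0famD (c0fam_dot cg cX) c3) (cfam_c0fam family_cfam))).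
Qed.

Definition family_slope (u : R * R) : R := tint (M u).

Lemma cont_family_slope : continuous family_slope.
Proof. by exact: (c0fam_tint family_c0fam_M). Qed.

Definition family_cost (u : R * R) : R := run_cost F (P u) (fun i x => W u i x - T (P u) i x).

Lemma cont_family_cost : continuous family_cost.
Proof.
apply: (cont_run_cost hQ hF family_cfam family_state) => i.
exact: (c0famD (family_c0fam_W i) (c0famN (velocity_c0fam i hT family_cfam))).
Qed.

Lemma family_costE e s : t <= s <= tf -> `|e| <= dl ->
  family_cost (e, s) - L q phi s =
  e * family_slope (e, s) + (F (fun x => q s x + e * h x) - F (q s)).
Proof.
move=> st edl.
have Es : sc (e, s) = s by rewrite /sc clamp_id.
have Ee : ec (e, s) = e by rewrite /ec clamp_id//= -ler_norml.
have EP : P (e, s) = fun x => q s x + e * h x by rewrite /P /qc Es Ee.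
have sq := cfam_smooth (e, s) family_cfam_qc; rewrite /qc Es in sq.
have sphi := cfam_smooth (e, s) family_cfam_phic; rewrite /phic Es in sphi.
have sg := smooth_grad sphi.
rewrite /family_cost /run_cost EP [in RHS]addrA.
have -> : (fun i x => W (e, s) i x - T (fun x => q s x + e * h x) i x) =
    (fun i x => grad (phi s) i x + e * X (e, s) i x).
  apply/funext => i; apply/funext => x; rewrite (velocity_line e hT sq sh).
  by rewrite /W /X /vc /phic /qc Es Ee; ring.
have sM := c0fam_smooth (e, s) family_c0fam_M.
have s0 : smooth (fun x => 2^-1 * dot (grad (phi s)) (grad (phi s)) x * q s x).
  exact: (smoothM (smoothZ _ (smooth_dot sg sg)) sq).
have -> : (fun x => 2^-1 * dot (fun i y => grad (phi s) i y + e * X (e, s) i y)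
     (fun i y => grad (phi s) i y + e * X (e, s) i y) x * (q s x + e * h x)) =
   (fun x => 2^-1 * dot (grad (phi s)) (grad (phi s)) x * q s x + e * M (e, s) x).
  apply/funext => x; rewrite /M EP /phic Es Ee.
  generalize (X (e, s)) => Xe.
  rewrite dotDl !dotDr !dotZl !dotZr (dotC Xe (grad (phi s))).
  generalize (dot (grad (phi s)) (grad (phi s)) x) (dot (grad (phi s)) Xe x)
    (dot Xe Xe x) (q s x) (h x) => X1 X2 X3 X4 X5.
  by field.
rewrite (tintD (smooth_continuous s0) (smooth_continuous (smoothZ e sM))).
rewrite (tintZ e (smooth_continuous sM)) -/(family_slope (e, s)).
by generalize (family_slope (e, s)) => X1; ring.
Qed.

(** At [e = 0] the integrand [M] is minus the linear part of the Hamiltonian in direction [h], which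
    the equation of [phi] turns into [dphi - dF]. The term [dF] will cancel against the first
    variation of [F] in the running cost, leaving the integral of [dphi * h]. *)
Lemma family_slope0 s : t <= s <= tf -> family_slope (0, s) =
  tint (fun x => dphi s x * h x) - tint (fun x => dF (q s) x * h x).
Proof.
move=> st; have [[cq Qq _ _] cphi cdphi _ [_ eqn _]] := hO.
have Es : sc (0, s) = s by rewrite /sc clamp_id.
have Ee : ec (0, s) = 0 by rewrite /ec clamp_id//= oppr_le0 (ltW dl0).
have EP : P (0, s) = q s.
  by apply/funext => x; rewrite /P /qc Es Ee mul0r addr0.
have sq := cfam_smooth s cq; have sphi := cfam_smooth s cphi.
have sg := smooth_grad sphi; have sTq := velocity_vsmooth hT sq.
have sTh := velocity_vsmooth hT sh; have sgh := smooth_grad sh.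
have [sTa _] := hTadj (vsmoothM sg sq).
have qn0 x : q s x != 0 by rewrite gt_eqF// state_pos.
have cdF := C1_functional_dF_continuous hF (Qq s).
have cdp : continuous (dphi s).
  apply: (cont_comp (f := fun x : 'rV[R]_d => (s, x))
    (g := fun z : R * 'rV[R]_d => dphi z.1 z.2)) => //.
  by apply: cont_pair; [exact: cont_cst|exact: cont_id].
have ch := smooth_continuous sh.
pose K : field R d := fun x => 2^-1 * dot (grad (phi s)) (grad (phi s)) x + dot (grad (phi s)) (T (q s)) x.
have sK : smooth K.
  exact: (smoothD (smoothZ 2^-1 (smooth_dot sg sg)) (smooth_dot sg sTq)).
have sN : smooth (fun x => dot (grad (phi s)) (T h) x * q s x - D * dot (grad (phi s)) (grad h) x).
  exact: (smoothB (smoothM (smooth_dot sg sTh) sq) (smoothZ D (smooth_dot sg sgh))).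
have sKh := smoothM sK sh.
have sS : smooth (fun x => (Tadj (fun i y => grad (phi s) i y * q s y) x + D * lapl (phi s) x) * h x).
  exact: (smoothM (smoothD sTa (smoothZ D (smooth_lapl sphi))) sh).
rewrite -(tintB (contM cdp ch) (contM cdF ch)) /family_slope.
have -> : M (0, s) = (fun x => - (K x * h x) -
    (dot (grad (phi s)) (T h) x * q s x - D * dot (grad (phi s)) (grad h) x)).
  apply/funext => x; rewrite /M EP /phic Es Ee mulr0 mul0r addr0.
  have -> : X (0, s) = (fun i y => D * (grad h i y * (q s y)^-1)
      + (- 1 * (T (q s) i y * (h y * (q s y)^-1) + grad (phi s) i y * (h y * (q s y)^-1)) + - 1 * T h i y)).
    apply/funext => i; apply/funext => y; rewrite /X /Y /vc EP /qc /phic Es; field.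
    by exact: qn0.
  rewrite dotDr dotZr (dotMr (fun y => (q s y)^-1)) dotDr !dotZr dotDr.
  rewrite !(dotMr (fun y => h y * (q s y)^-1)) /K.
  have := qn0 x.
  generalize (dot (grad (phi s)) (grad (phi s)) x) (dot (grad (phi s)) (grad h) x)
    (dot (grad (phi s)) (T (q s)) x) (dot (grad (phi s)) (T h) x) (q s x) (h x).
  by move=> X1 X2 X3 X4 X5 X6 n0; field.
rewrite (tintB (smooth_continuous (smoothN sKh)) (smooth_continuous sN)).
rewrite (tint_adjoint hT hTadj D sq sphi sh).
rewrite -(tintB (smooth_continuous (smoothN sKh)) (smooth_continuous sS)).
by congr tint; apply/funext => x; rewrite -(eqn s x) /K; ring.
Qed.

(** As [h] is constant in time, [flux_line] applies with [K = 0]: only the diffusion of [e * h] has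
    to be compensated. *)
Lemma family_piece e : `|e| <= dl ->
  piece Q T D t tf (fun s => P (e, s)) (fun s i x => W (e, s) i x - T (P (e, s)) i x).
Proof.
move=> edl.
have cs : continuous (fun s : R => (e, s)).
  by apply: cont_pair; [exact: cont_cst|exact: cont_id].
apply: velocity_piece.
- exact: hT.
- exact: (cfam_comp cs family_cfam).
- by move=> s; exact: family_state.
- by move=> i; exact: (c0fam_comp cs (family_c0fam_W i)).
move=> s st x.
have [[cq Qq _ dp] cphi _ _ _] := hO.
have Ee r : ec (e, r) = e by rewrite /ec clamp_id//= -ler_norml.
have EP r : t <= r <= tf -> P (e, r) = fun x => q r x + e * h x.
  by move=> rt; rewrite /P /qc /sc clamp_id// Ee.
have Ev : vc (e, s) = fun i x => T (q s) i x + grad (phi s) i x.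
  by rewrite /vc /qc /phic /sc clamp_id.
have sq := cfam_smooth s cq; have sphi := cfam_smooth s cphi.
have svc : vsmooth (vc (e, s)).
  rewrite Ev => i; exact: (smoothD (velocity_vsmooth hT sq i) (smooth_grad sphi i)).
have s0 : vsmooth (fun (_ : 'I_d) (_ : 'rV[R]_d) => 0 : R) by move=> i; exact: smooth_cst.
have H := flux_line (D := D) (k := e) (K := 0) (q := q s) (h := h) (v := vc (e, s))
  (V := W (e, s)) x sq sh svc s0.
rewrite (EP s st) H; last first.
  move=> i y; have := family_neq0 (e, s) y; rewrite /W /Y (EP s st) Ee => n0.
  by field.
rewrite mul0r addr0.
have -> : D * lapl (q s) x - diverg (fun i y => vc (e, s) i y * q s y) x =
    transport T D (q s) (grad (phi s)) x by rewrite Ev.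
apply: (is_tderive_eq (f := fun r => q r x + e * h x)).
- exact: st.
- by move=> r rt; rewrite (EP r rt).
rewrite -[transport _ _ _ _ _]addr0; apply: is_tderiveD; last exact: is_tderive_cst.
exact: dp.
Qed.

Lemma family_value e : `|e| <= dl ->
  V (fun x => q t x + e * h x) t - V (q t) t <=
  Int t tf (fun s => family_cost (e, s) - L q phi s)
  + (G (fun x => q tf x + e * h x) - G (q tf)).
Proof.
move=> edl; have [[cq Qq _ dp] cphi _ _ _] := hO.
have tt : t <= t <= tf by rewrite lexx ttf.
have t2 : t <= tf <= tf by rewrite lexx ttf.
have Ee r : ec (e, r) = e by rewrite /ec clamp_id//= -ler_norml.
have EP r : t <= r <= tf -> P (e, r) = fun x => q r x + e * h x.
  by move=> rt; rewrite /P /qc /sc clamp_id// Ee.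
have := value_le_piece hQ hF hopt t2 (family_piece edl).
rewrite (EP t tt) (EP tf t2) (value_optimal_tail hQ hF hopt tt hO).
rewrite (value_final hQ hF hopt (hdl t2 edl)) /=.
have cs : continuous (fun s : R => (e, s)).
  by apply: cont_pair; [exact: cont_cst|exact: cont_id].
have c1 : continuous (fun s : R => family_cost (e, s)).
  exact: (cont_comp cs cont_family_cost).
rewrite (IntB _ _ c1 (cont_L hQ hF cq Qq cphi)) -/family_cost => H.
by move: H; lra.
Qed.

End family.
End envelope.

(** * Identification of [phi] with the gradient of the value *)

Section adjoint_state.
Context {R : realType} {d : nat} (hd : (0 < d)%N).
Context (Q : set (field R d)) (hQ : state_space Q).
Context (T : field R d -> vfield R d) (hT : velocity_operator T).
Context (Tadj : vfield R d -> field R d) (hTadj : adjoint_operator T Tadj).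
Context (D tf : R) (F G : field R d -> R) (dF dG : field R d -> field R d).
Context (hF : C1_functional Q F dF) (hG : C1_functional Q G dG).
Context (hopt : forall q t, Q q -> t <= tf -> exists qs phis : R -> field R d,
  optimal_solution Q T Tadj D F G dF dG tf q t qs phis).

Notation V q t := (fine (value Q T D F G tf q t)).
Notation L q phi := (fun s => run_cost F (q s) (grad (phi s))).

Context (dtV : field R d -> R -> R) (dV : field R d -> R -> field R d).
Context (hV : classically_differentiable Q tf (fun q t => V q t) dtV dV).

(** An inequality up to [o(x)] between two linear functions, used for both signs of [x], forces
    equal slopes. The factor [C] lets callers add up several errors of size [e]. *)
Lemma slope_eq (a b C : R) : 0 <= C ->
  (forall e, 0 < e -> exists2 r, 0 < r & forall x, `|x| < r -> x * a <= x * b + C * e * `|x|) ->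
  a = b.
Proof.
move=> C0 H; apply/eqP; rewrite -subr_eq0 -normr_eq0; apply/negPn/negP => n0.
have p0 : 0 < `|a - b| by rewrite lt_def n0 normr_ge0.
have k0 : 0 < `|a - b| / (C + 1) / 2 by rewrite !divr_gt0// ltr_wpDl.
have [r r0 Hr] := H _ k0.
have CE : C * (`|a - b| / (C + 1) / 2) < `|a - b|.
  have c1 : 0 < C + 1 by rewrite ltr_wpDl.
  rewrite mulrA ltr_pdivrMr// mulrA ltr_pdivrMr//.
  rewrite mulrC -mulrA ltr_pM2l//; lra.
have r2 : r / 2 < r by rewrite ltr_pdivrMr// ltr_pMr// ltr1n.
have r20 : 0 < r / 2 by rewrite divr_gt0.
have [ab|ab] := leP 0 (a - b).
  have := Hr (r / 2); rewrite gtr0_norm// => /(_ r2) h.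
  rewrite (ger0_norm ab) in CE h.
  have : r / 2 * (a - b) <= r / 2 * (C * ((a - b) / (C + 1) / 2)) by lra.
  by rewrite ler_pM2l// leNgt CE.
have := Hr (- (r / 2)); rewrite normrN gtr0_norm// => /(_ r2) h.
rewrite (ltr0_norm ab) in CE h.
have : r / 2 * - (a - b) <= r / 2 * (C * (- (a - b) / (C + 1) / 2)) by lra.
by rewrite ler_pM2l// leNgt CE.
Qed.

(** The running cost contributes the integral of [dphi * h], that is, the difference of the
    integrals of [phi * h] at [tf] and at [t]. The final condition on [phi] cancels the part at [tf]
    against the variation of [G]. *)
Lemma tint_value_gradient t q phi dphi h : t <= tf ->
  optimal_data Q T Tadj D tf F G dF dG t q phi dphi -> smooth h ->
  tint (fun x => dV (q t) t x * h x) = - tint (fun x => phi t x * h x).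
Proof.
move=> ttf hO sh.
have [[cq Qq _ dp] cphi cdphi dphi1 [phiT eqn _]] := hO.
have ch := smooth_continuous sh.
have sqs s := cfam_smooth s cq; have sphi s := cfam_smooth s cphi.
have cline : cfam (fun z : R * R => fun x => q z.1 x + z.2 * h x).
  apply: cfamD; first by apply: (cfam_comp (c := fst)) => //; exact: cont_fst.
  by apply: cfamZ; [exact: cont_snd|exact: (cfam_cst _ sh)].
have Ez s : (fun x => q s x + 0 * h x) = q s by apply/funext => x; rewrite mul0r addr0.
have [dl1 dl10 Hdl1] : exists2 dl, 0 < dl & forall s e, t <= s <= tf -> `|e| < dl ->
    Q (fun x => q s x + e * h x).
  apply: (near_segment (P := fun s e => Q (fun x => q s x + e * h x))) => s _.
  have := state_near hQ (u := (s, 0)) cline; rewrite /= Ez; exact.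
pose dl := dl1 / 2.
have dl0 : 0 < dl by rewrite divr_gt0.
have hdl s e : t <= s <= tf -> `|e| <= dl -> Q (fun x => q s x + e * h x).
  move=> st edl; apply: Hdl1 => //; apply: le_lt_trans edl _.
  by rewrite ltr_pdivrMr// ltr_pMr// ltr1n.
pose S := family_slope T D tf t q phi h dl.
pose C := family_cost T D tf F t q phi h dl.
have cS : continuous S by exact: (cont_family_slope hd hQ hT hF hopt hV ttf hO sh dl0 hdl).
have cC : continuous C by exact: (cont_family_cost hd hQ hT hF hopt hV ttf hO sh dl0 hdl).
pose W s := tint (fun x => dphi s x * h x).
have cdh : continuous (fun z : R * 'rV[R]_d => dphi z.1 z.2 * h z.2).
  apply: (contM cdphi).
  by apply: (cont_comp (f := fun z : R * 'rV[R]_d => z.2) (g := h)) => //; exact: cont_snd.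
have cW : continuous W.
  exact: (tint_param_continuous (f := fun z => dphi z.1 z.2 * h z.2) cdh).
have S0 s : t <= s <= tf -> S (0, s) = W s - tint (fun x => dF (q s) x * h x).
  by move=> st; exact: (family_slope0 hd hQ hT hTadj hF hopt hV hO sh dl0 st).
have CE s e : t <= s <= tf -> `|e| <= dl -> C (e, s) - L q phi s =
    e * S (e, s) + (F (fun x => q s x + e * h x) - F (q s)).
  by move=> st edl; exact: (family_costE hd hQ hT hF hopt hV ttf hO sh dl0 hdl st edl).
have cL := cont_L hQ hF cq Qq cphi.
have IW : Int t tf W = tint (fun x => phi tf x * h x) - tint (fun x => phi t x * h x).
  apply: (Int_is_tderive (F := fun s => tint (fun x => phi s x * h x))) => //.
  apply: (tint_is_tderive (f := fun z => phi z.1 z.2 * h z.2) (df := fun z => dphi z.1 z.2 * h z.2)) => //.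
    apply: contM; first by have [_ /(_ [::])] := cphi.
    by apply: (cont_comp (f := fun z : R * 'rV[R]_d => z.2) (g := h)) => //; exact: cont_snd.
  move=> s st x _ /=.
  rewrite [dphi s x * h x]mulrC.
  apply: (is_tderive_eq (f := fun r => h x * phi r x)) => //.
    by move=> r _; rewrite mulrC.
  by apply: is_tderiveZ; exact: dphi1.
have fT : tint (fun x => phi tf x * h x) = - tint (fun x => dG (q tf) x * h x).
  have cdG := C1_functional_dF_continuous hG (Qq tf).
  rewrite -(tintN (contM cdG ch)); congr tint; apply/funext => x.
  by rewrite phiT mulNr.
have [_ /(_ _ ttf) [_ _ /(_ _ sh) dVh] _ _] := hV (Qq t).
(* Per unit of time, two errors [e] come from the expansion of [F] and one from the slope; the
   expansions of [G] and of [V] add one each. *)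
apply: (slope_eq (C := 3 * (tf - t) + 2)) => //.
  by rewrite addr_ge0// mulr_ge0// subr_ge0.
move=> e e0.
(* On [[t, tf]] the difference [W s - S (0, s)] is the variation of [F] in direction [h], by [S0].
   This form is known to be continuous in [s], also for nearby times outside the interval. *)
have [r1 r10 H1] : exists2 r, 0 < r & forall s k, t <= s <= tf -> `|k| < r ->
    `|F (fun x => q s x + k * h x) - F (q s) - k * (W s - S (0, s))| <= 2 * e * `|k| /\
    `|S (k, s) - S (0, s)| <= e.
  apply: (near_segment (P := fun s k =>
    `|F (fun x => q s x + k * h x) - F (q s) - k * (W s - S (0, s))| <= 2 * e * `|k| /\
    `|S (k, s) - S (0, s)| <= e)) => s st.
  have N1 := C1_functional_diff hQ hF (u := s) cq sh (Qq s) e0.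
  have c0 : continuous (fun s : R => S (0, s)).
    apply: (cont_comp (f := fun s : R => (0 : R, s)) (g := S)) => //.
    by apply: cont_pair; [exact: cont_cst|exact: cont_id].
  have c1 : continuous (fun z : R * R => W z.1 - S (0, z.1)).
    apply: (cont_comp (f := fun z : R * R => z.1) (g := fun s => W s - S (0, s))).
      exact: cont_fst.
    exact: (contB cW c0).
  have c2 : continuous (fun z : R * R => S (z.2, z.1) - S (0, z.1)).
    apply: contB.
      apply: (cont_comp (f := fun z : R * R => (z.2, z.1)) (g := S)) => //.
      by apply: cont_pair; [exact: cont_snd|exact: cont_fst].
    by apply: (cont_comp (f := fun z : R * R => z.1) (g := fun s => S (0, s))) => //; exact: cont_fst.
  have /cvgrPdist_le /(_ _ e0) N2 := c1 (s, 0).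
  have /cvgrPdist_le /(_ _ e0) N3 := c2 (s, 0).
  near=> z.
  have n1 : `|F (fun x => q z.1 x + z.2 * h x) - F (q z.1) - z.2 * tint (fun x => dF (q s) x * h x)|
     <= e * `|z.2|.
    by near: z; apply: filterS N1 => z [].
  have n2 : `|W s - S (0, s) - (W z.1 - S (0, z.1))| <= e by near: z; exact: N2.
  have n3 : `|S (0, s) - S (0, s) - (S (z.2, z.1) - S (0, z.1))| <= e by near: z; exact: N3.
  split; last by rewrite subrr sub0r normrN in n3.
  have -> : F (fun x => q z.1 x + z.2 * h x) - F (q z.1) - z.2 * (W z.1 - S (0, z.1)) =
     (F (fun x => q z.1 x + z.2 * h x) - F (q z.1) - z.2 * tint (fun x => dF (q s) x * h x))
     + z.2 * (W s - S (0, s) - (W z.1 - S (0, z.1))).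
    by rewrite (S0 s st); ring.
  rewrite (le_trans (ler_normD _ _))// [2 * e]mulrC mulrAC mulr_natr mulr2n lerD//.
  by rewrite normrM mulrC ler_wpM2r.
have c1G : cfam (fun _ : R => q tf) by exact: (cfam_cst _ (sqs tf)).
have NG := C1_functional_diff hQ hG (u := 0) c1G sh (Qq tf) e0.
have [r2 r20 H2] := near_pairP (P := fun _ k => Q (fun x => q tf x + k * h x) /\
   `|G (fun x => q tf x + k * h x) - G (q tf) - k * tint (fun x => dG (q tf) x * h x)|
     <= e * `|k|) NG.
have /(is_derive_is_tderive setT) /is_tderiveP /(_ _ e0) [r3 r30 H3] := dVh.
exists (Num.min dl (Num.min r1 (Num.min r2 r3))); first by rewrite !lt_min dl0 r10 r20.
move=> k; rewrite !lt_min => /andP[k0 /andP[k1 /andP[k2 k3]]].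
have := family_value hd hQ hT hF hopt hV ttf hO sh dl0 hdl (ltW k0).
rewrite -/C => FV.
have /andP[g1 g2] : - (e * `|k|) <=
   G (fun x => q tf x + k * h x) - G (q tf) - k * tint (fun x => dG (q tf) x * h x) <= e * `|k|.
  have k2' : `|k - 0| < r2 by rewrite subr0.
  have z2 : `|0 - 0 : R| < r2 by rewrite subrr normr0.
  by rewrite -ler_norml; have [_] := H2 0 k z2 k2'.
have := H3 k I; rewrite subr0 => /(_ k3).
rewrite (_ : (fun x => q t x + 0 * h x) = q t); last exact: Ez.
rewrite ler_norml => /andP[v1 _].
have cs : continuous (fun s : R => (k, s)).
  by apply: cont_pair; [exact: cont_cst|exact: cont_id].
have cCL : continuous (fun s => C (k, s) - L q phi s).
  by apply: (contB _ cL); exact: (cont_comp cs cC).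
have IB : Int t tf (fun s => C (k, s) - L q phi s) <= k * Int t tf W + 3 * e * `|k| * (tf - t).
  rewrite -(IntZ _ _ _ cW) -(Int_cst _ ttf) -IntD; last exact: cont_cst.
  - apply: ler_Int => //.
      by apply: contD; [apply: contM => //; exact: cont_cst|exact: cont_cst].
    move=> s st; rewrite (CE s k st (ltW k0)).
    have [] := H1 s k st k1; rewrite ler_norml => /andP[_ h1] h2.
    have h3 : k * (S (k, s) - S (0, s)) <= e * `|k|.
      by rewrite (le_trans (ler_norm _))// normrM mulrC ler_wpM2r.
    by move: h1 h3; move: (S (k, s)) (S (0, s)) (W s) (F _) (F (q s)) => A1 A2 A3 A4 A5; lra.
  - by apply: contM => //; exact: cont_cst.
move: FV IB; rewrite IW fT => FV IB.
have := le_trans FV (lerD IB (lexx _)).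
move: v1 g2; set A1 := fine _; set A2 := fine _; set A3 := tint _; set A4 := G _; set A5 := G _.
set A6 := tint _; set A7 := tint _; set A8 := e * _ => v1 g2 FV2.
have -> : (3 * (tf - t) + 2) * e * `|k| = 3 * (tf - t) * A8 + 2 * A8 by rewrite /A8; ring.
have E8 : 3 * e * `|k| * (tf - t) = 3 * (tf - t) * A8 by rewrite /A8; ring.
rewrite E8 in FV2; move: (3 * (tf - t) * A8) FV2 v1 g2 => A9; lra.
Unshelve. all: by end_near. Qed.

(** The tail from [s] is optimal, and the test field [h = dV + phi] makes the integral of a square
    vanish. *)
Lemma optimal_gradient t q phi dphi s : t <= s <= tf ->
  optimal_data Q T Tadj D tf F G dF dG t q phi dphi ->
  forall x, phi s x = - dV (q s) s x.
Proof.
move=> tstf O x; have /andP[ts stf] := tstf.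
have Os := optimal_data_sub hQ hF hopt tstf O.
have [[cq Qq _ _] cphi _ _ _] := O.
have [_ _ /(_ _ stf) sdV _] := hV (Qq s).
have sphi := cfam_smooth s cphi.
have sD : smooth (fun x => dV (q s) s x + phi s x) by exact: (smoothD sdV sphi).
have s1 := smoothM sdV sD; have s2 := smoothM sphi sD.
have := tint_value_gradient stf Os sD => E.
have : tint (fun x => (dV (q s) s x + phi s x) * (dV (q s) s x + phi s x)) = 0.
  transitivity (tint (fun x => dV (q s) s x * (dV (q s) s x + phi s x) +
      phi s x * (dV (q s) s x + phi s x))).
    by congr tint; apply/funext => y; rewrite mulrDl.
  by rewrite (tintD (smooth_continuous s1) (smooth_continuous s2)) E addNr.
move=> /(tint_sqr_eq0 (smooth_periodic sD) (smooth_continuous sD)) /(_ x) /eqP.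
by rewrite addrC addr_eq0 => /eqP.
Qed.

End adjoint_state.

(** * The Hamilton-Jacobi equation *)

Section hamilton_jacobi.
Context {R : realType} {d : nat} (hd : (0 < d)%N).
Context (Q : set (field R d)) (hQ : state_space Q).
Context (T : field R d -> vfield R d) (hT : velocity_operator T).
Context (Tadj : vfield R d -> field R d) (hTadj : adjoint_operator T Tadj).
Context (D tf : R) (F G : field R d -> R) (dF dG : field R d -> field R d).
Context (hF : C1_functional Q F dF) (hG : C1_functional Q G dG).
Context (hopt : forall q t, Q q -> t <= tf -> exists qs phis : R -> field R d,
  optimal_solution Q T Tadj D F G dF dG tf q t qs phis).

Notation V q t := (fine (value Q T D F G tf q t)).
Notation L q phi := (fun s => run_cost F (q s) (grad (phi s))).

Context (dtV : field R d -> R -> R) (dV : field R d -> R -> field R d).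
Context (hV : classically_differentiable Q tf (fun q t => V q t) dtV dV).

Section time_change.
Context (t : R) (q phi dphi : R -> field R d).
Context (hO : optimal_data Q T Tadj D tf F G dF dG t q phi dphi).

(* The optimal control is [a + b]; along the same path run at speed [mu] the control
   is [mu a + b]. *)
Let b (s : R) : vfield R d := fun i x => D * (grad (q s) i x * (q s x)^-1) + - T (q s) i x.
(** Along the path the state equation reads [dq = - diverg (a q)], since [b] absorbs both [T] and
    the diffusion. Hence a change of speed rescales [a] and leaves [b] alone. *)
Let a (s : R) : vfield R d := fun i x => grad (phi s) i x + - b s i x.
Let A (s : R) := tint (fun x => dot (a s) (a s) x * q s x).
Let B (s : R) := tint (fun x => dot (a s) (b s) x * q s x).
Let C (s : R) := tint (fun x => 2^-1 * dot (b s) (b s) x * q s x) + F (q s).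

Lemma path_neq0 s x : q s x != 0.
Proof.
have [[_ Qq _ _] _ _ _ _] := hO.
by rewrite gt_eqF// (state_pos hd hQ hT hF hopt hV).
Qed.

Lemma path_c0fam : [/\ c0fam q, forall i, c0fam (fun s => b s i) & forall i, c0fam (fun s => a s i)].
Proof.
have [[cq Qq _ _] cphi _ _ _] := hO.
have c0q := cfam_c0fam cq.
have cD : c0fam (fun (_ : R) (_ : 'rV[R]_d) => D) by apply: c0fam_cst; exact: cont_cst.
have cb i : c0fam (fun s => b s i).
  exact: (c0famD (c0famM cD (c0famM (c0fam_grad i cq) (c0famV path_neq0 c0q)))
    (c0famN (velocity_c0fam i hT cq))).
split=> // i; exact: (c0famD (c0fam_grad i cphi) (c0famN (cb i))).
Qed.

Lemma cont_A : continuous A.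
Proof. by have [c0q cb ca] := path_c0fam; exact: (c0fam_tint (c0famM (c0fam_dot ca ca) c0q)). Qed.

Lemma cont_B : continuous B.
Proof. by have [c0q cb ca] := path_c0fam; exact: (c0fam_tint (c0famM (c0fam_dot ca cb) c0q)). Qed.

Lemma cont_C : continuous C.
Proof.
have [[cq Qq _ _] cphi _ _ _] := hO; have [c0q cb ca] := path_c0fam.
apply: contD; last exact: (C1_functional_continuous hQ hF cq Qq).
have c2 : c0fam (fun (_ : R) (_ : 'rV[R]_d) => 2^-1 : R) by apply: c0fam_cst; exact: cont_cst.
exact: (c0fam_tint (c0famM (c0famM c2 (c0fam_dot cb cb)) c0q)).
Qed.

Lemma speed_cost s (mu : R) : run_cost F (q s) (fun i x => mu * a s i x + b s i x) =
  2^-1 * mu * mu * A s + mu * B s + C s.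
Proof.
have [c0q cb ca] := path_c0fam.
have sq := c0fam_smooth s c0q.
have sa : vsmooth (a s) by move=> i; exact: (c0fam_smooth s (ca i)).
have sb : vsmooth (b s) by move=> i; exact: (c0fam_smooth s (cb i)).
have s1 := smoothM (smooth_dot sa sa) sq.
have s2 := smoothM (smooth_dot sa sb) sq.
have s3 := smoothM (smoothZ 2^-1 (smooth_dot sb sb)) sq.
have z1 := smoothZ (2^-1 * mu * mu) s1; have z2 := smoothZ mu s2.
rewrite /run_cost /C addrA; congr (_ + _).
rewrite /A /B -(tintZ _ (smooth_continuous s1)) -(tintZ mu (smooth_continuous s2)).
rewrite -(tintD (smooth_continuous z1) (smooth_continuous z2)).
rewrite -(tintD (smooth_continuous (smoothD z1 z2)) (smooth_continuous s3)).
congr tint; apply/funext => x.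
generalize (a s) (b s) => a1 b1.
rewrite dotDl !dotDr !dotZl !dotZr (dotC b1 a1).
generalize (dot a1 a1 x) (dot a1 b1 x) (dot b1 b1 x) (q s x) => X1 X2 X3 X4.
by field.
Qed.

Lemma speed1 s : (fun i x => 1 * a s i x + b s i x) = grad (phi s).
Proof. by apply/funext => i; apply/funext => x; rewrite mul1r subrK. Qed.

(** Since [T q * q - D * grad q = - b * q], the integrand of [H2] is
    [(|a + b|^2 / 2 - (a + b) . b) q], that is, [(|a|^2 - |b|^2) q / 2]. *)
Lemma speed_H2 s : H2 T D F (q s) (phi s) = 2^-1 * A s - C s.
Proof.
have [[cq Qq _ _] cphi _ _ _] := hO; have [c0q cb ca] := path_c0fam.
have sq := c0fam_smooth s c0q.
have sa : vsmooth (a s) by move=> i; exact: (c0fam_smooth s (ca i)).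
have sb : vsmooth (b s) by move=> i; exact: (c0fam_smooth s (cb i)).
have s1 := smoothM (smooth_dot sa sa) sq.
have s3 := smoothM (smoothZ 2^-1 (smooth_dot sb sb)) sq.
rewrite /H2 /C opprD addrA; congr (_ - _).
rewrite /A -(tintZ _ (smooth_continuous s1)).
rewrite -(tintB (smooth_continuous (smoothZ 2^-1 s1)) (smooth_continuous s3)).
congr tint; apply/funext => x.
have Eg : grad (phi s) = (fun i y => a s i y + b s i y).
  by rewrite -speed1; apply/funext => i; apply/funext => y; rewrite mul1r.
have EqT : T (q s) = (fun i y => D * (grad (q s) i y * (q s y)^-1) + - 1 * b s i y).
  by apply/funext => i; apply/funext => y; rewrite /b mulN1r opprD addrA subrr add0r opprK.
rewrite EqT Eg; generalize (a s) (b s) => a1 b1.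
rewrite (dotDr _ (fun i y => D * (grad (q s) i y * (q s y)^-1))) !dotZr (dotMr (fun y => (q s y)^-1)).
rewrite !dotDl !dotDr (dotC b1 a1).
have := path_neq0 s x.
generalize (dot a1 a1 x) (dot a1 b1 x) (dot b1 b1 x) (dot a1 (grad (q s)) x)
  (dot b1 (grad (q s)) x) (q s x) => X1 X2 X3 X4 X5 X6 n0.
by field.
Qed.

Lemma cont_path_H2 : continuous (fun s => H2 T D F (q s) (phi s)).
Proof.
rewrite (_ : (fun s => _) = (fun s => 2^-1 * A s - C s)).
  by apply: contB; [apply: contM; [exact: cont_cst|exact: cont_A]|exact: cont_C].
by apply/funext => s; rewrite speed_H2.
Qed.

(** The speed [mu] and the shift [e] map [[t + tau, t + eta]] onto [[t, t + eta]], so the path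
    leaves from [q t] at time [t + tau] and still reaches [q (t + eta)] at time [t + eta]. The sign
    of [tau] is free. *)
Lemma speed_piece (tau eta : R) : 0 < eta -> tau < eta -> t + eta <= tf ->
  let mu := eta / (eta - tau) in let e := t - mu * (t + tau) in
  piece Q T D (t + tau) (t + eta) (fun s => q (mu * s + e))
    (fun s i x => mu * a (mu * s + e) i x + b (mu * s + e) i x).
Proof.
move=> eta0 te etatf mu e.
have et0 : 0 < eta - tau by rewrite subr_gt0.
have mu0 : 0 < mu by rewrite divr_gt0.
have ca : continuous (fun s => mu * s + e).
  by apply: contD; [apply: contM; [exact: cont_cst|exact: cont_id]|exact: cont_cst].
have [[cq Qq _ dp] cphi _ _ _] := hO.
have e1 : mu * (t + tau) + e = t by rewrite addrC subrK.
have e2 : mu * (t + eta) + e = t + eta.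
  have -> : mu * (t + eta) + e = t + mu * (eta - tau) by rewrite /e; ring.
  by rewrite /mu divfK// gt_eqF.
pose v s : vfield R d := fun i x => T (q s) i x + grad (phi s) i x.
(* The diffusion does not speed up with the path; the second term supplies the missing fraction
   [1 - mu] of it as a flux. *)
pose W s : vfield R d := fun i x => mu * v s i x + (1 - mu) * D * (grad (q s) i x * (q s x)^-1).
have cv i : c0fam (fun s => v s i).
  exact: (c0famD (velocity_c0fam i hT cq) (c0fam_grad i cphi)).
have cst (c : R) : c0fam (fun (_ : R) (_ : 'rV[R]_d) => c) by apply: c0fam_cst; exact: cont_cst.
have cW i : c0fam (fun s => W s i).
  exact: (c0famD (c0famM (cst mu) (cv i)) (c0famM (cst ((1 - mu) * D))
    (c0famM (c0fam_grad i cq) (c0famV path_neq0 (cfam_c0fam cq))))).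
have -> : (fun s i x => mu * a (mu * s + e) i x + b (mu * s + e) i x) =
    (fun s i x => W (mu * s + e) i x - T (q (mu * s + e)) i x).
  by apply/funext => s; apply/funext => i; apply/funext => x; rewrite /W /v /a /b; ring.
apply: velocity_piece.
- exact: hT.
- exact: (cfam_comp ca cq).
- by move=> s; exact: Qq.
- by move=> i; exact: (c0fam_comp ca (cW i)).
move=> s /andP[ts se] x.
set r := mu * s + e.
have rt : t <= r <= t + eta.
  by rewrite -[in X in X <= r]e1 -e2 /r !lerD2r !ler_pM2l// ts.
have sq := cfam_smooth r cq.
have sg := smooth_grad sq.
have sv : vsmooth (v r) by move=> i; exact: (c0fam_smooth r (cv i)).
have svq : vsmooth (fun i y => v r i y * q r y) by exact: vsmoothM.
have sm : vsmooth (fun i y => mu * (v r i y * q r y)) by move=> i; exact: (smoothZ mu (svq i)).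
have sD : vsmooth (fun i y => (1 - mu) * D * grad (q r) i y).
  by move=> i; exact: (smoothZ _ (sg i)).
have -> : D * lapl (q r) x - diverg (fun i y => W r i y * q r y) x =
    mu * transport T D (q r) (grad (phi r)) x.
  have -> : (fun i y => W r i y * q r y) =
      (fun i y => mu * (v r i y * q r y) + (1 - mu) * D * grad (q r) i y).
    apply/funext => i; apply/funext => y; rewrite /W; have := path_neq0 r y.
    by generalize (v r i y) (grad (q r) i y) (q r y) => Y1 Y2 Y3 n0; field.
  have E1 := congr1 (fun f => f x) (divergD sm sD).
  have E2 := congr1 (fun f => f x) (divergZ mu svq).
  have E3 := congr1 (fun f => f x) (divergZ ((1 - mu) * D) sg).
  apply: (etrans (congr1 (fun z => D * lapl (q r) x - z) E1)).
  apply: (etrans (congr1 (fun z => D * lapl (q r) x - (z + _)) E2)).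
  apply: (etrans (congr1 (fun z => D * lapl (q r) x - (_ + z)) E3)).
  rewrite -[transport _ _ _ _ _]/(D * lapl (q r) x - diverg (fun i y => v r i y * q r y) x).
  rewrite /lapl; generalize (diverg (grad (q r)) x).
  by generalize (diverg (fun i y => v r i y * q r y) x) => Y1 Y2; ring.
apply: (is_tderive_comp_affine (B := [set r | t <= r <= tf]) (f := fun r => q r x)).
  move=> r' /= /andP[h1 h2].
  rewrite -[in X in X <= _]e1 lerD2r ler_pM2l// h1 /= (le_trans _ etatf)// -e2.
  by rewrite lerD2r ler_pM2l.
by apply: dp; case/andP: rt => -> h; rewrite (le_trans h).
Qed.

(** At speed [mu] the cost up to [t + eta] is [mu * IA / 2 + IB + IC / mu]. As [mu] has derivative
    [1 / eta] in [tau] at 0, the slope is [(IA / 2 - IC) / eta], the mean of [H2] by [speed_H2]. *)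
Lemma time_derivative_mean (eta : R) : 0 < eta -> t + eta <= tf ->
  eta * dtV (q t) t = Int t (t + eta) (fun s => H2 T D F (q s) (phi s)).
Proof.
move=> eta0 etatf; have [[cq Qq _ dp] cphi _ _ _] := hO.
have tte : t <= t + eta by rewrite lerDl ltW.
have ttf : t <= tf by exact: le_trans etatf.
pose IA := Int t (t + eta) A; pose IB := Int t (t + eta) B; pose IC := Int t (t + eta) C.
have IK (mu : R) : Int t (t + eta) (fun s => 2^-1 * mu * mu * A s + mu * B s + C s) =
    2^-1 * mu * mu * IA + mu * IB + IC.
  have zA : continuous (fun s => 2^-1 * mu * mu * A s).
    by apply: contM; [exact: cont_cst|exact: cont_A].
  have zB : continuous (fun s => mu * B s) by apply: contM; [exact: cont_cst|exact: cont_B].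
  rewrite (IntD _ _ _ cont_C); last exact: (contD zA zB).
  by rewrite (IntD _ _ zA zB) (IntZ _ _ _ cont_A) (IntZ _ _ _ cont_B).
have -> : Int t (t + eta) (fun s => H2 T D F (q s) (phi s)) = 2^-1 * IA - IC.
  rewrite (eq_Int (g := fun s => 2^-1 * A s - C s)); last by move=> s _; rewrite speed_H2.
  have zA : continuous (fun s => 2^-1 * A s) by apply: contM; [exact: cont_cst|exact: cont_A].
  by rewrite (IntB _ _ zA cont_C) (IntZ _ _ _ cont_A).
have V0 : V (q t) t = 2^-1 * IA + IB + IC + V (q (t + eta)) (t + eta).
  rewrite (value_optimal_step hQ hF hopt (lexx t) tte etatf hO); congr (_ + _).
  rewrite (eq_Int (g := fun s => 2^-1 * 1 * 1 * A s + 1 * B s + C s)) ?IK.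
    by rewrite !mulr1 mul1r.
  by move=> s _; rewrite -speed_cost speed1.
apply: (mulfI (x := eta^-1)); first by rewrite invr_eq0 gt_eqF.
rewrite mulKf ?gt_eqF//.
have [/(_ _ ttf) dt _ _ _] := hV (Qq t).
apply: (slope_eq (C := 2)) => // e e0.
move/is_tderiveP: dt => /(_ _ e0) [r1 r10 H1].
(* The exact remainder of the cost is [tau ^ 2 * (IA / 2) / (eta * (eta - tau))]. The bound [m]
   makes it at most [e * |tau|] once [eta - tau >= eta / 2]. *)
pose m := e * (eta * eta / 2) / (`|2^-1 * IA| + 1).
have ee0 : 0 < eta * eta / 2 by rewrite !mulr_gt0// invr_gt0.
have m0 : 0 < m by rewrite divr_gt0 ?mulr_gt0// ltr_wpDl.
exists (Num.min (eta / 2) (Num.min r1 m)); first by rewrite !lt_min r10 m0 divr_gt0.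
move=> tau; rewrite !lt_min => /andP[h1 /andP[h2 h3]].
have e2 : eta / 2 < eta by rewrite ltr_pdivrMr// ltr_pMr// ltr1n.
have tau_eta : tau < eta by rewrite (le_lt_trans (ler_norm _))// (lt_trans h1).
have Etau : eta / 2 <= eta - tau.
  have h1' : tau < eta / 2 := le_lt_trans (ler_norm tau) h1.
  by rewrite lerBrDr -lerBrDl (le_trans (ltW h1'))// lerBrDr -splitr.
have et0 : 0 < eta - tau by rewrite subr_gt0.
have tt : t + tau <= tf by rewrite (le_trans _ etatf)// lerD2l ltW.
have := H1 (t + tau) tt; rewrite [t + tau - t]addrAC subrr add0r => /(_ h2).
rewrite ler_norml => /andP[v1 _].
pose mu := eta / (eta - tau).
have mu0 : 0 < mu by rewrite divr_gt0.
have hP := speed_piece eta0 tau_eta etatf; rewrite /= -/mu in hP.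
set e' := t - mu * (t + tau) in hP.
have Ee1 : mu * (t + tau) + e' = t by rewrite addrC subrK.
have Ee2 : mu * (t + eta) + e' = t + eta.
  have -> : mu * (t + eta) + e' = t + mu * (eta - tau) by rewrite /e'; ring.
  by rewrite /mu divfK// gt_eqF.
have te : t + tau <= t + eta by rewrite lerD2l ltW.
have := value_le_piece hQ hF hopt _ hP; rewrite te etatf => /(_ isT).
rewrite /= Ee1 Ee2.
have cK : continuous (fun s => 2^-1 * mu * mu * A s + mu * B s + C s).
  apply: contD; last exact: cont_C.
  by apply: contD; apply: contM; [exact: cont_cst|exact: cont_A|exact: cont_cst|exact: cont_B].
rewrite (eq_Int (g := fun s => (fun r => 2^-1 * mu * mu * A r + mu * B r + C r) (mu * s + e'))); last first.
  by move=> s _; rewrite speed_cost.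
have := Int_affine e' mu0 te cK; rewrite Ee1 Ee2 IK => EI.
move=> Vt.
set I1 := Int _ _ _ in EI Vt.
have EI1 : I1 = (2^-1 * mu * mu * IA + mu * IB + IC) / mu.
  by rewrite -EI mulrAC divff ?mul1r// gt_eqF.
rewrite EI1 in Vt.
have key : V (q t) (t + tau) - V (q t) t <= tau * (eta^-1 * (2^-1 * IA - IC)) + e * `|tau|.
  have : V (q t) (t + tau) - V (q t) t <=
      (2^-1 * mu * mu * IA + mu * IB + IC) / mu - (2^-1 * IA + IB + IC).
    by rewrite V0 opprD [X in _ + X]addrC addrA lerD2r lerBlDr.
  move=> /le_trans; apply.
  have -> : (2^-1 * mu * mu * IA + mu * IB + IC) / mu - (2^-1 * IA + IB + IC) =
      tau * (eta^-1 * (2^-1 * IA - IC)) + tau * (2^-1 * IA * tau / (eta * (eta - tau))).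
    rewrite /mu; field; by rewrite !gt_eqF.
  rewrite lerD2l (le_trans (ler_norm _))// normrM mulrC ler_wpM2r//.
  rewrite normrM normfV [`|eta * _|]gtr0_norm ?mulr_gt0//.
  rewrite ler_pdivrMr ?mulr_gt0// normrM.
  apply: (@le_trans _ _ (e * (eta * eta / 2))).
    move: h3; rewrite /m ltr_pdivlMr ?ltr_wpDl// => /ltW; apply: le_trans.
    by rewrite mulrC ler_wpM2l// lerDl.
  by rewrite ler_wpM2l ?(ltW e0)// -mulrA ler_wpM2l ?(ltW eta0).
move: v1; rewrite lerBrDl lerBlDr mulrC => /le_trans; apply.
have -> : 2 * e * `|tau| = e * `|tau| + e * `|tau| by ring.
by rewrite addrA lerD2r.
Qed.

Lemma time_derivative_lt : t < tf -> dtV (q t) t = H2 T D F (q t) (phi t).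
Proof.
move=> ttf; apply/eqP; rewrite -subr_eq0 -normr_eq0; apply/negPn/negP => n0.
have p0 : 0 < `|dtV (q t) t - H2 T D F (q t) (phi t)| / 2.
  by rewrite divr_gt0// lt_def n0 normr_ge0.
have tt : t <= t <= tf by rewrite lexx ltW.
have /is_tderiveP /(_ _ p0) [dl dl0 H] := Int_derive cont_path_H2 tt.
pose eta := Num.min (dl / 2) (tf - t).
have eta0 : 0 < eta by rewrite lt_min divr_gt0// subr_gt0.
have etf : t + eta <= tf by rewrite addrC -lerBrDr ge_min lexx orbT.
have edl : eta < dl.
  by rewrite (le_lt_trans (y := dl / 2)) ?ge_min ?lexx// ltr_pdivrMr// ltr_pMr// ltr1n.
have := H (t + eta); rewrite /= lerDl (ltW eta0) etf => /(_ isT).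
rewrite [t + eta - t]addrAC subrr add0r gtr0_norm// => /(_ edl).
rewrite Int_nn subr0 -(time_derivative_mean eta0 etf) [H2 _ _ _ _ _ * eta]mulrC -mulrBr normrM.
rewrite gtr0_norm// [X in _ <= X]mulrC ler_pM2l// leNgt ltr_pdivrMr//.
by rewrite ltr_pMr ?ltr1n// lt_def n0 normr_ge0.
Qed.

End time_change.

Lemma hamilton_jacobi_lt q0 t : Q q0 -> t < tf ->
  dtV q0 t = H2 T D F q0 (fun x => - dV q0 t x).
Proof.
move=> Qq0 ttf; have [qs [phis /(optimal_dataP hQ hF (ltW ttf))]] := hopt Qq0 (ltW ttf).
move=> [q [phi [dphi [hO qt _]]]].
rewrite -qt (time_derivative_lt hO ttf); congr H2; apply/funext => x.
apply: (optimal_gradient hd hQ hT hTadj hF hG hopt hV _ hO).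
by rewrite lexx ltW.
Qed.

Lemma H2_expand q psi : smooth q -> smooth psi ->
  H2 T D F q (fun x => - psi x) =
  2^-1 * tint (fun x => dot (grad psi) (grad psi) x * q x)
  - tint (fun x => dot (grad psi) (T q) x * q x)
  + D * tint (fun x => dot (grad psi) (grad q) x) - F q.
Proof.
move=> sq sp; have sg := smooth_grad sp; have sTq := velocity_vsmooth hT sq.
have s1 := smoothM (smooth_dot sg sg) sq.
have s2 := smoothM (smooth_dot sg sTq) sq.
have s3 := smooth_dot sg (smooth_grad sq).
rewrite /H2; congr (_ - _).
rewrite -(tintZ _ (smooth_continuous s1)) -(tintZ _ (smooth_continuous s3)).
rewrite -(tintB (smooth_continuous (smoothZ 2^-1 s1)) (smooth_continuous s2)).
rewrite -(tintD (smooth_continuous (smoothB (smoothZ 2^-1 s1) s2)) (smooth_continuous (smoothZ D s3))).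
congr tint; apply/funext => x.
have -> : grad (fun x => - psi x) = (fun i y => -1 * grad psi i y).
  by apply/funext => i; apply/funext => y; rewrite /grad (pdN i sp) mulN1r.
rewrite !dotZl dotZr; generalize (dot (grad psi) (grad psi) x) (dot (grad psi) (T q) x)
  (dot (grad psi) (grad q) x) (q x) => X1 X2 X3 X4; ring.
Qed.

(** Needed to let times tend to [tf] at a fixed state. It rests on the joint continuity of
    [grad (dV q t)]; [Num.min tf] freezes the time beyond [tf]. *)
Lemma cont_H2_time q : Q q ->
  continuous (fun s => H2 T D F q (fun x => - dV q (Num.min tf s) x)).
Proof.
move=> Qq; have sq := state_smooth hQ Qq.
have [_ _ sdV cdV] := hV Qq.
have mle s : Num.min tf s <= tf by rewrite ge_min lexx.
have cm : continuous (Num.min tf).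
  by move=> s; apply: (@continuous_min R R (fun=> tf) (fun s => s)); [exact: cvg_cst|exact: cvg_id].
have sV s : smooth (dV q (Num.min tf s)) by exact: (sdV _ (mle s)).
have cg i : c0fam (fun s => grad (dV q (Num.min tf s)) i).
  split=> [s|]; first exact: (smooth_grad (sV s) i).
  exact: (within_comp (A := [set s | s <= tf]) (c := Num.min tf) cm mle (cdV i)).
have cc (f : field R d) : smooth f -> c0fam (fun _ : R => f) by move=> sf; exact: (cfam_c0fam (cfam_cst _ sf)).
have cT i := cc _ (velocity_vsmooth hT sq i).
have cgq i := cc _ (smooth_grad sq i).
rewrite (_ : (fun s => _) = (fun s =>
  2^-1 * tint (fun x => dot (grad (dV q (Num.min tf s))) (grad (dV q (Num.min tf s))) x * q x)
  - tint (fun x => dot (grad (dV q (Num.min tf s))) (T q) x * q x)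
  + D * tint (fun x => dot (grad (dV q (Num.min tf s))) (grad q) x) - F q)); last first.
  by apply/funext => s; rewrite (H2_expand sq (sV s)).
apply: contB; last exact: cont_cst.
apply: contD.
  apply: contB.
    apply: contM; first exact: cont_cst.
    exact: (c0fam_tint (c0famM (c0fam_dot cg cg) (cc _ sq))).
  exact: (c0fam_tint (c0famM (c0fam_dot cg cT) (cc _ sq))).
apply: contM; first exact: cont_cst.
exact: (c0fam_tint (c0fam_dot cg cgq)).
Qed.

(* At [tf] no path can be run at another speed; the equation follows from earlier
   times by the mean value theorem. *)
Lemma hamilton_jacobi q0 t : Q q0 -> t <= tf ->
  dtV q0 t = H2 T D F q0 (fun x => - dV q0 t x).
Proof.
move=> Qq0; rewrite le_eqVlt => /predU1P[->|]; last exact: hamilton_jacobi_lt.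
apply/eqP; rewrite -subr_eq0 -normr_eq0; apply/negPn/negP => n0.
set h := dtV q0 tf - _ in n0.
have p0 : 0 < `|h| / 4 by rewrite divr_gt0// lt_def n0 normr_ge0.
have [dt _ _ _] := hV Qq0.
have /is_tderiveP /(_ _ p0) [d1 d10 H1] := dt tf (lexx tf).
have /cvgrPdist_le /(_ _ p0) [d2 /= d20 H2'] := cont_H2_time Qq0 (x := tf).
pose m := Num.min d1 d2 / 2.
have m0 : 0 < m by rewrite divr_gt0// lt_min d10.
have md : m < Num.min d1 d2 by rewrite ltr_pdivrMr ?ltr_pMr ?ltr1n// lt_min d10.
move: md; rewrite lt_min => /andP[md1 md2].
have hd' s : tf - m <= s <= tf ->
    is_tderive [set r | tf - m <= r <= tf] (fun r => V q0 r) s (dtV q0 s).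
  move=> /andP[_ stf]; apply: is_tderive_subset (dt s stf).
  by move=> r /= /andP[].
have mt : tf - m < tf by rewrite ltrBlDr ltrDl.
(* The difference quotient at [tf] equals [dtV] at an earlier time [x], where the equation is
   already known. *)
have [x /andP[x1 x2] E] := is_tderive_MVT (f := fun r => V q0 r) hd' (lexx _) mt (lexx _).
have := H1 (tf - m); rewrite /= (ltW mt) => /(_ isT).
have -> : tf - m - tf = - m by ring.
rewrite normrN gtr0_norm// => /(_ md1).
have := H2' x; rewrite /= => /(_ _).
have xd : `|tf - x| < d2 by rewrite ger0_norm ?subr_ge0 ?(ltW x2)//; lra.
move=> /(_ xd); rewrite (min_idPl (lexx tf)) (min_idPr (ltW x2)).
rewrite -(hamilton_jacobi_lt Qq0 x2) => h2.
have -> : V q0 (tf - m) - V q0 tf - dtV q0 tf * - m = (dtV q0 tf - dtV q0 x) * m.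
  have E' : V q0 tf - V q0 (tf - m) = dtV q0 x * m by rewrite E; ring.
  by rewrite mulrBl -E'; ring.
rewrite normrM (gtr0_norm m0) ler_pM2r// => h3.
have : `|h| <= `|h| / 4 + `|h| / 4.
  rewrite {1}/h (_ : _ - _ = (dtV q0 tf - dtV q0 x) - (H2 T D F q0 (fun x => - dV q0 tf x) - dtV q0 x)); last by ring.
  by rewrite (le_trans (ler_normB _ _))// lerD.
have : 0 < `|h| by rewrite lt_def n0 normr_ge0.
lra.
Qed.

End hamilton_jacobi.

Theorem proposition6 (R : realType) (d : nat) (hd : (0 < d <= 2)%N)
    (Q : set (field R d)) (hQ : state_space Q)
    (T : field R d -> vfield R d) (hT : velocity_operator T)
    (Tadj : vfield R d -> field R d) (hTadj : adjoint_operator T Tadj)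
    (D tf : R)
    (F G : field R d -> R) (dF dG : field R d -> field R d)
    (hF : C1_functional Q F dF) (hG : C1_functional Q G dG)
    (hopt : forall q t, Q q -> t <= tf -> exists qs phis : R -> field R d,
        optimal_solution Q T Tadj D F G dF dG tf q t qs phis)
    (dtV : field R d -> R -> R) (dV : field R d -> R -> field R d)
    (hV : classically_differentiable Q tf
        (fun q t => fine (value Q T D F G tf q t)) dtV dV) :
  [/\ forall q t, Q q -> t <= tf ->
        value Q T D F G tf q t \is a fin_num,
      forall q t, Q q -> t <= tf ->
        dtV q t - H2 T D F q (fun x => - dV q t x) = 0,
      forall q t, Q q -> t <= tf ->
        dtV q t
        - 2^-1 * tint (fun x => dot (grad (dV q t)) (grad (dV q t)) x * q x)
        + tint (fun x => dot (grad (dV q t)) (T q) x * q x)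
        - D * tint (fun x => dot (grad (dV q t)) (grad q) x)
        + F q = 0,
      forall q, Q q -> value Q T D F G tf q tf = (G q)%:E
    & forall q t (qs phis : R -> field R d), Q q -> t <= tf ->
        optimal_solution Q T Tadj D F G dF dG tf q t qs phis ->
        forall s, t <= s <= tf ->
          (exists dphi : field R d,
            (forall x, is_tderive [set r | t <= r <= tf]
                         (fun r => phis r x) s (dphi x)) /\
            first_variation (fun p => H2 T D F p (phis s)) (qs s)
              (fun x => - dphi x)) /\
          forall x, phis s x = - dV (qs s) s x].
Proof.
have d0 : (0 < d)%N by case/andP: hd.
have HJ q t : Q q -> t <= tf -> dtV q t = H2 T D F q (fun x => - dV q t x).
  exact: (hamilton_jacobi d0 hQ hT hTadj hF hG hopt hV).
split.
- by move=> q t; exact: (value_fin_num hQ hF hopt).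
- by move=> q t Qq ttf; rewrite (HJ q t Qq ttf) subrr.
- move=> q t Qq ttf; have [_ _ /(_ t ttf) sdV _] := hV q Qq.
  rewrite (HJ q t Qq ttf) (H2_expand hT D F (state_smooth hQ Qq) sdV).
  set a := 2^-1 * _; set b := tint _; set c := D * _; ring.
- by move=> q; exact: (value_final hQ hF hopt).
move=> q0 t qs phis Qq0 ttf opt s st.
(* The given solution is replaced by its frozen extension, which agrees with it on [[t, tf]]. *)
have [q [phi [dphi [hO _ E]]]] := optimal_dataP hQ hF ttf opt.
have [[_ Qq _ _] cphi _ dphi1 [_ eqn _]] := hO.
have [Eq Ephi] := E s st; split; last first.
  by rewrite -Eq -Ephi; exact: (optimal_gradient d0 hQ hT hTadj hF hG hopt hV st hO).
exists (dphi s); split.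
  move=> x; apply: (is_tderive_eq (f := fun r => phi r x)); first exact: st.
    by move=> r rt; have [_ ->] := E r rt.
  exact: dphi1.
rewrite -Eq -Ephi.
exact: (H2_first_variation hQ hT hTadj hF (Qq s) (cfam_smooth s cphi) (eqn s)).
Qed.
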